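(* Let $a\in A^s_2$ (on $\mathbb R^n$). There is a constant $C$ depending only on $a$ (and $n$) such that for every rectangle $R=[a_1,b_1]\times\cdots\times[a_n,b_n]$, every $1\le j\le n$, and every vector field $\pmb\sigma$ on $R$ with $j$-th component $\pmb\sigma_j\in L^2_a(R)$ weakly differentiable and such that the right-hand side below is finite, $$\|\pmb\sigma_j-\Pi_R\pmb\sigma_j\|_{L^2_a(R)}\le C\left\{\sum_{i\ne j}\left\|d_i\frac{\partial\pmb\sigma_j}{\partial x_i}\right\|_{L^2_a(R)}+h_j\left\|\frac{\partial\pmb\sigma_j}{\partial x_j}\right\|_{L^2_a(R)}\right\}.$$
   Context: A non-negative $a\in L^1_{loc}(\mathbb R^n)$ belongs to $A^s_2$ (strong $A_2$) if $[a]_{A^s_2}=\sup_R\big(\frac1{|R|}\int_Ra\big)\big(\frac1{|R|}\int_Ra^{-1}\big)<\infty$, the supremum being over all $n$-dimensional rectangles $R$ with faces parallel to the coordinate axes. $L^2_a(R)$ is the $L^2$ space with measure $a\,dx$. For $R=[a_1,b_1]\times\cdots\times[a_n,b_n]$: $d_i(x)=\min\{b_i-x_i,\,x_i-a_i\}$ and $h_i=b_i-a_i$. Lowest order Raviart--Thomas interpolation on $R$: $\mathcal{RT}_0(R)=\{\pmb\tau(x)=(\alpha_1+\beta_1x_1,\dots,\alpha_n+\beta_nx_n):\alpha_i,\beta_i\in\mathbb R\}$, and $\Pi_R\pmb\sigma\in\mathcal{RT}_0(R)$ is determined by $\int_F\Pi_R\pmb\sigma\cdot\pmb n_F=\int_F\pmb\sigma\cdot\pmb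 n_F$ for every face $F$ of $R$ with unit normal $\pmb n_F$. The $j$-th component $(\Pi_R\pmb\sigma)_j$ depends only on $\pmb\sigma_j$ and is denoted $\Pi_R\pmb\sigma_j$: it is the function $\alpha_j+\beta_jx_j$ having the same averages as $\pmb\sigma_j$ on the two faces $x_j=a_j$ and $x_j=b_j$. *)

(* Defs.v *)
From HB Require Import structures.
From mathcomp Require Import all_boot all_order all_algebra.
From mathcomp Require Import all_classical all_reals all_analysis.

Set Implicit Arguments.
Unset Strict Implicit.
Unset Printing Implicit Defensive.

Import Order.TTheory GRing.Theory Num.Theory.
Import numFieldTopology.Exports numFieldNormedType.Exports.

Local Open Scope classical_set_scope.
Local Open Scope ring_scope.

(* R^n is 'rV[R]_n, with the product (= Borel) sigma-algebra generated by the
   coordinates, as the library does for n.-tuple. *)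
Definition measure_rV_display : measure_display.
Proof. exact: default_measure_display. Qed.

Section measurable_rV.
Context {R : realType} (n : nat).

Let coord (i : 'I_n) (x : 'rV[R]_n) : measurableTypeR R := x ord0 i.

Let rV_set0 : g_sigma_preimage coord set0.
Proof. exact: sigma_algebra0. Qed.

Let rV_setC A : g_sigma_preimage coord A -> g_sigma_preimage coord (~` A).
Proof. exact: sigma_algebraC. Qed.

Let rV_bigcup (F : _^nat) : (forall i, g_sigma_preimage coord (F i)) ->
  g_sigma_preimage coord (\bigcup_i (F i)).
Proof. exact: sigma_algebra_bigcup. Qed.

HB.instance Definition _ := @isMeasurable.Build measure_rV_display
  'rV[R]_n (g_sigma_preimage coord) rV_set0 rV_setC rV_bigcup.

End measurable_rV.

(* The point with j-th coordinate c and remaining coordinates y; its inverse is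
   x |-> (x ord0 j, col' j x). *)
Definition insert_coord {T : Type} {n : nat} (j : 'I_n) (c : T)
    (y : 'rV[T]_n.-1) : 'rV[T]_n :=
  \row_i oapp (y ord0) c (unlift j i).

Section measurable_rV_theory.
Context {R : realType}.

Lemma measurable_rVP d (T : measurableType d) n (f : T -> 'rV[R]_n) :
  measurable_fun [set: T] f <->
  forall i, measurable_fun [set: T] (fun x => f x ord0 i : measurableTypeR R).
Proof.
apply: (@iff_trans _ (g_sigma_preimage
    (fun i x => f x ord0 i : measurableTypeR R) `<=` measurable)).
  rewrite (g_sigma_preimage_comp
    (fun i (x : 'rV[R]_n) => x ord0 i : measurableTypeR R) f).
  split=> [mf A [/= C preC <-]|prefS]; first exact: mf.
  by move=> _ A mA; apply: prefS; exists A.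
split=> [coordS i|mf].
- move=> _ A mA.
  apply: coordS; apply: sub_sigma_algebra.
  case: n i f => [[] []//|n i f].
  rewrite -bigcup_mkord_ord.
  exists i; first exact: ltn_ord.
  by exists A => //; rewrite inord_val.
- apply: smallest_sub; first exact: sigma_algebra_measurable.
  case: n f mf => [|n] f mf; first by rewrite big_ord0.
  rewrite -bigcup_mkord_ord; apply: bigcup_sub => i Ii.
  by move=> A [B mB <-]; exact: mf.
Qed.

Lemma measurable_coord n (i : 'I_n) : measurable_fun [set: 'rV[R]_n]
  (fun x : 'rV[R]_n => x ord0 i : measurableTypeR R).
Proof.
have /(measurable_rVP (fun x : 'rV[R]_n => x)) : measurable_fun
  [set: 'rV[R]_n] (fun x : 'rV[R]_n => x) by exact: measurable_id.
exact.
Qed.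

Definition cons_rV n (p : measurableTypeR R * 'rV[R]_n) : 'rV[R]_n.+1 :=
  insert_coord ord0 p.1 p.2.

Lemma measurable_cons_rV n : measurable_fun setT (@cons_rV n).
Proof.
apply/measurable_rVP => i; rewrite /cons_rV/=.
case: (unliftP ord0 i) => [k ->|->].
  under eq_fun do rewrite mxE liftK/=.
  exact: (measurableT_comp (measurable_coord k) measurable_snd).
under eq_fun do rewrite mxE unlift_none/=.
exact: measurable_fst.
Qed.

Definition uncons_rV n (x : 'rV[R]_n.+1) : measurableTypeR R * 'rV[R]_n :=
  (x ord0 ord0, col' ord0 x).

Lemma measurable_uncons_rV n : measurable_fun setT (@uncons_rV n).
Proof.
apply/measurable_fun_pair; first exact: measurable_coord.
apply/measurable_rVP => i; under eq_fun do rewrite mxE.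
exact: measurable_coord.
Qed.

Lemma cons_rVK n : cancel (@cons_rV n) (@uncons_rV n).
Proof.
case=> c y; rewrite /cons_rV/uncons_rV/= mxE unlift_none/=; congr (_, _).
by apply/rowP => k; rewrite !mxE liftK.
Qed.

Section cons_measure.
Variables (n : nat) (m1 : {sigma_finite_measure set (measurableTypeR R) -> \bar R})
  (m2 : {sigma_finite_measure set 'rV[R]_n -> \bar R}).

Definition cons_measure : set 'rV[R]_n.+1 -> \bar R :=
  pushforward (m1 \x m2)%E (@cons_rV n).

HB.instance Definition _ := Measure.copy cons_measure
  (measure_function_pushforward__canonical__measure_function_Measure
     (m1 \x m2)%E (@measurable_cons_rV n)).

Let cons_measure_sigma_finite : sigma_finite setT cons_measure.
Proof.
have /sigma_finiteP[F [TF ndF Foo]] := sigma_finiteT m1.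
have /sigma_finiteP[G [TG ndG Goo]] := sigma_finiteT m2.
exists (fun k => @uncons_rV n @^-1` (F k `*` G k)).
  rewrite -preimage_bigcup (_ : \bigcup_k (F k `*` G k) = setT) ?preimage_setT//.
  rewrite -subTset -setXTT TF TG => -[x y] [/= [k _ Fkx] [l _ Gly]].
  exists (maxn k l) => //; split.
  - by move: x Fkx; exact/subsetPset/ndF/leq_maxl.
  - by move: y Gly; exact/subsetPset/ndG/leq_maxr.
move=> k; have [mF Fk] := Foo k; have [mG Gk] := Goo k; split.
  rewrite -[X in measurable X]setTI.
  exact: (measurable_uncons_rV measurableT (measurableX mF mG)).
rewrite /cons_measure/pushforward -comp_preimage.
rewrite (_ : _ \o _ = id); last by apply/funext => p /=; rewrite cons_rVK.
by rewrite preimage_id product_measure1E// lte_mul_pinfty// ge0_fin_numE.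
Qed.

HB.instance Definition _ := Measure_isSigmaFinite.Build _ _ _ cons_measure
  cons_measure_sigma_finite.

End cons_measure.

(* Lebesgue measure on R^n: the n-fold product of lebesgue_measure. *)
Fixpoint lebesgue_rV n : {sigma_finite_measure set 'rV[R]_n -> \bar R} :=
  match n with
  | 0 => \d_(0 : 'rV[R]_0)
  | m.+1 => cons_measure lebesgue_measure (lebesgue_rV m)
  end.

End measurable_rV_theory.

(* Closed rectangle [a_1, b_1] x .. x [a_n, b_n]. *)
Definition rect {R : realType} {n : nat} (a b : 'rV[R]_n) : set 'rV[R]_n :=
  [set x | forall i, a ord0 i <= x ord0 i <= b ord0 i].

Lemma measurable_rect {R : realType} n (a b : 'rV[R]_n) :
  measurable (rect a b).
Proof.
rewrite (_ : rect a b = \bigcap_(i in [set: 'I_n])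
    ((fun x : 'rV[R]_n => x ord0 i : measurableTypeR R) @^-1`
      `[a ord0 i, b ord0 i])).
  apply: fin_bigcap_measurable => // i _.
  rewrite -[X in measurable X]setTI.
  exact: (measurable_coord i measurableT (measurable_itv _)).
apply/seteqP; split=> x /= xab i; first by move=> _; rewrite /= in_itv/=.
by have := xab i Logic.I; rewrite /= in_itv/=.
Qed.

Lemma lebesgue_rV_rect {R : realType} n (a b : 'rV[R]_n) :
  (forall i, a ord0 i <= b ord0 i) ->
  lebesgue_rV n (rect a b) = (\prod_i (b ord0 i - a ord0 i))%:E.
Proof.
elim: n a b => [|n IH] a b ab.
  by rewrite big_ord0 /= diracE mem_set// => -[].
rewrite big_ord_recl /= /cons_measure /pushforward.
have -> : @cons_rV R n @^-1` rect a b =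
    `[a ord0 ord0, b ord0 ord0]%classic `*` rect (col' ord0 a) (col' ord0 b).
  apply/seteqP; split=> -[c y] /=.
    move=> H; split.
      by have := H ord0; rewrite mxE unlift_none/= in_itv.
    by move=> k; have := H (lift ord0 k); rewrite !mxE liftK.
  rewrite in_itv/= => -[H1 H2] i; rewrite mxE.
  case: (unliftP ord0 i) => [k ->|->] //=.
  by have := H2 k; rewrite !mxE.
rewrite product_measure1E//=; last exact: measurable_rect.
rewrite IH; last by move=> i; rewrite !mxE.
rewrite lebesgue_measure_itv/= lte_fin; under eq_bigr do rewrite !mxE.
by have := ab ord0; rewrite le_eqVlt => /predU1P[->|->//]; rewrite ltxx subrr mul0r mul0e.
Qed.

Section weights_and_interpolation.
Context {R : realType} {n : nat}.
Local Notation mu := (@lebesgue_rV R n).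
Implicit Types (a b x : 'rV[R]_n) (i j : 'I_n) (u v w p phi : 'rV[R]_n -> R).

(* L^1_loc(D); same shape as the library's locally_integrable on R. *)
Definition locally_integrable_rV (D : set 'rV[R]_n) u : Prop :=
  measurable_fun D u /\ forall K, K `<=` D -> compact K ->
  (\int[mu]_(x in K) `|u x|%:E < +oo)%E.

Definition rect_average a b (f : 'rV[R]_n -> \bar R) : \bar R :=
  ((\int[mu]_(x in rect a b) f x) / mu (rect a b))%E.

(* [w]_{A^s_2}; the inverse is that of \bar R, so that 0^-1 = +oo. *)
Definition strong_A2_const w : \bar R :=
  ereal_sup [set (rect_average ab.1 ab.2 (EFin \o w) *
                  rect_average ab.1 ab.2 (fun x => (w x)%:E^-1))%E
    | ab in [set ab : 'rV[R]_n * 'rV[R]_n |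
              forall i, ab.1 ord0 i < ab.2 ord0 i]].

(* Since 0 * +oo = 0 in \bar R, the zero function would have constant 0; it is
   not a weight and is excluded. For any other w, a finite constant forces all
   the averages of w and w^-1 to be positive and finite. *)
Definition strong_A2 w : Prop :=
  [/\ forall x, 0 <= w x,
      locally_integrable_rV setT w,
      ~ {ae mu, forall x, w x = 0} &
      (strong_A2_const w < +oo)%E].

Definition wL2norm w (D : set 'rV[R]_n) u : \bar R :=
  ((\int[mu]_(x in D) (u x ^+ 2 * w x)%:E) `^ 2^-1)%E.

Definition in_wL2 w (D : set 'rV[R]_n) u : Prop :=
  measurable_fun D u /\ (wL2norm w D u < +oo)%E.

Definition partial i phi : 'rV[R]_n -> R :=
  fun x => 'D_(delta_mx ord0 i) phi x.

Definition smooth phi : Prop := forall s : seq 'I_n,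
  continuous (foldr partial phi s) /\
  forall i x, derivable (foldr partial phi s) x (delta_mx ord0 i).

(* C^oo_c(D) *)
Definition test_function (D : set 'rV[R]_n) phi : Prop :=
  smooth phi /\ exists K : set 'rV[R]_n,
    [/\ compact K, K `<=` D & forall x, ~ K x -> phi x = 0].

(* v is the weak partial derivative of u with respect to x_i in the interior of
   [a, b]. As v is only determined a.e., it is harmless to ask that it be
   measurable on the closed rectangle, where norms of v are taken. *)
Definition weak_partial a b i u v : Prop :=
  [/\ locally_integrable_rV (rect a b)° u,
      locally_integrable_rV (rect a b)° v,
      measurable_fun (rect a b) v &
      forall phi, test_function (rect a b)° phi ->
        (\int[mu]_(x in rect a b) (u x * partial i phi x)%:E =
         - \int[mu]_(x in rect a b) (v x * phi x)%:E)%E].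

(* d_i(x) *)
Definition dist_faces a b i x : R :=
  Num.min (b ord0 i - x ord0 i) (x ord0 i - a ord0 i).

(* The face {x in [a, b] | x_j = c}, c = a_j or b_j, is parametrized by the
   (n-1)-dimensional rectangle of the remaining coordinates. *)
Definition face a b j : set 'rV[R]_n.-1 := rect (col' j a) (col' j b).

(* The part of [a, b] at distance at most e from the hyperplane x_j = c. *)
Definition slab a b j (c e : R) : set 'rV[R]_n :=
  rect a b `&` [set x | `|x ord0 j - c| <= e].

(* g is the trace of u on the face x_j = c: g is integrable on the face and the
   mean over the thickness e of the L^1-distance between u and g on the slab next
   to that face tends to 0 with e. *)
Definition face_trace a b j (c : R) u (g : 'rV[R]_n.-1 -> R) : Prop :=
  (lebesgue_rV n.-1).-integrable (face a b j) (EFin \o g) /\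
  (e^-1%:E * \int[mu]_(x in slab a b j c e)
     `|u x - g (col' j x)|%:E)%E @[e --> 0^'+] --> 0%E.

(* p is the j-th component of the lowest order Raviart-Thomas interpolant of a
   field with j-th component u. The other components do not contribute to the
   fluxes through the faces orthogonal to e_j. *)
Definition RT_interp a b j u p : Prop :=
  (exists alpha beta : R, forall x, p x = alpha + beta * x ord0 j) /\
  forall c, c = a ord0 j \/ c = b ord0 j ->
    exists2 g, face_trace a b j c u g &
      (\int[lebesgue_rV n.-1]_(y in face a b j) (p (insert_coord j c y))%:E =
       \int[lebesgue_rV n.-1]_(y in face a b j) (g y)%:E)%E.

End weights_and_interpolation.

(* Main.v *)
Require Import Defs.
From mathcomp Require Import all_boot all_order all_algebra.
From mathcomp Require Import all_classical all_reals all_analysis.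
From mathcomp Require Import measurable_realfun ring lra.
Set Implicit Arguments.
Unset Strict Implicit.
Unset Printing Implicit Defensive.
Import Order.TTheory GRing.Theory Num.Theory.
Import numFieldTopology.Exports numFieldNormedType.Exports.
Local Open Scope classical_set_scope.
Local Open Scope ring_scope.

(** Let [U(t)] be the average of [u = sigma_j] over the slice [x_j = t] of the
    rectangle. The error splits as [u - p = (u - U) + (U - p)], where the first
    term only sees the derivatives in the directions [i <> j] and the second
    one only the derivative in the direction [j].

    The strong A_2 constant controls rectangles of arbitrary proportions, hence
    also very thin ones. By Lebesgue differentiation the restrictions of [w] to
    almost every line and to almost every slice are therefore A_2 weights with
    the same constant ([A2_line], [A2_slice]). Moreover a function with weak
    derivative [v] in a direction is the integral of [v] on almost every line
    in that direction ([ae_ac_line], through tensor product test functions).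

    First term. On an interval, [u] minus its average is bounded in L^2(w) by
    [dist * u'], where [dist] is the distance to the endpoints
    ([line_poincare]). To see this, cut each half of the interval into dyadic
    pieces whose lengths are comparable to [dist]. By A_2 the weight of the
    intervals left over decays geometrically towards the endpoint, so that a
    discrete Hardy inequality sums up the contributions of the pieces
    ([discrete_hardy], [chain_inequality]). Fubini turns this into a bound for
    [u - P_i u], where [P_i] is the average in the direction [i]. Each [P_i] is
    bounded on L^2(w), by A_2 again ([line_avg_bound]), so the errors of
    successive averages add up ([sub_avg_over_bound]) and bound [u - f], where
    [f] is the average of [u] in all directions [i <> j]. As [f] is constant on
    slices, and as the average over a slice is a nearly optimal constant in
    L^2(w), [u - U] is bounded by [u - f] ([sub_face_avg_bound]).

    Second term. Integrating [v_j] along lines up to the faces yields the traces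
    of [u] on the faces [x_j = a_j] and [x_j = b_j], and shows that [U(t)]
    differs from the average of either trace by at most the integral of [|v_j|]
    over the rectangle divided by the measure of the face
    ([face_avg_near_trace]). The interpolant [p] is affine in [x_j] with these
    averages as its boundary values, so it satisfies the same bound.
    Cauchy-Schwarz and A_2 on the whole rectangle turn this bound into
    [h_j * ||v_j||] ([face_avg_interp_bound]). That the traces are unique
    ([face_trace_unique]) identifies every interpolant with this one.

    All estimates are made for squares of norms, which Fubini decomposes;
    square roots are taken at the very end. *)

(** * Fubini in an arbitrary coordinate *)

Section fubini_coordinate.
Context {R : realType}.
Local Notation X := (measurableTypeR R).
Local Notation mu1 := (@lebesgue_measure R).
Local Notation mu := (@lebesgue_rV R).

Definition ins m (j : 'I_m.+1) (p : X * 'rV[R]_m) : 'rV[R]_m.+1 :=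
  @insert_coord R m.+1 j p.1 p.2.

Lemma insert_coordE m (j : 'I_m.+1) (t : R) (y : 'rV[R]_m) :
  @insert_coord R m.+1 j t y ord0 j = t.
Proof. by rewrite mxE unlift_none. Qed.

Lemma insert_coord_lift m (j : 'I_m.+1) (t : R) (y : 'rV[R]_m) k :
  @insert_coord R m.+1 j t y ord0 (lift j k) = y ord0 k.
Proof. by rewrite mxE liftK. Qed.

Lemma col'_insert_coord m (j : 'I_m.+1) (t : R) (y : 'rV[R]_m) :
  col' j (@insert_coord R m.+1 j t y) = y.
Proof. by apply/rowP => k; rewrite mxE insert_coord_lift. Qed.

Lemma insert_coordK m (j : 'I_m.+1) (x : 'rV[R]_m.+1) :
  @insert_coord R m.+1 j (x ord0 j) (col' j x) = x.
Proof.
by apply/rowP => i; rewrite mxE; case: (unliftP j i) => [k|] -> //=; rewrite mxE.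
Qed.

Lemma measurable_ins m (j : 'I_m.+1) : measurable_fun setT (ins j).
Proof.
apply/measurable_rVP => i; rewrite /ins /=.
case: (unliftP j i) => [k ->|->].
  under eq_fun do rewrite insert_coord_lift.
  exact: (measurableT_comp (measurable_coord k) measurable_snd).
under eq_fun do rewrite insert_coordE.
exact: measurable_fst.
Qed.

Lemma measurable_col' m (j : 'I_m.+1) :
  measurable_fun setT (fun x : 'rV[R]_m.+1 => col' j x).
Proof.
apply/measurable_rVP => k; under eq_fun do rewrite mxE; exact: measurable_coord.
Qed.

Lemma measurable_ins1 m (j : 'I_m.+1) (y : 'rV[R]_m) :
  measurable_fun setT (fun t : X => @insert_coord R m.+1 j t y).
Proof. exact: (measurableT_comp (measurable_ins j) (measurable_pair2 y)). Qed.

Lemma measurable_ins2 m (j : 'I_m.+1) (t : X) :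
  measurable_fun setT (fun y : 'rV[R]_m => @insert_coord R m.+1 j t y).
Proof. exact: (measurableT_comp (measurable_ins j) (measurable_pair1 t)). Qed.

Definition box m (B : 'I_m -> set R) : set 'rV[R]_m :=
  [set x | forall i, B i (x ord0 i)].

Lemma measurable_box m (B : 'I_m -> set R) :
  (forall i, measurable (B i : set X)) -> measurable (box B).
Proof.
move=> mB; rewrite (_ : box B = \bigcap_(i in [set: 'I_m])
   ((fun x : 'rV[R]_m => x ord0 i : X) @^-1` B i)); last first.
  by apply/seteqP; split => x /= H i; [move=> _|]; apply: H.
apply: fin_bigcap_measurable => // i _.
rewrite -[X in measurable X]setTI; exact: measurable_coord.
Qed.

Lemma ins_box m (j : 'I_m.+1) (B : 'I_m.+1 -> set R) :
  ins j @^-1` box B = B j `*` box (fun k => B (lift j k)).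
Proof.
apply/seteqP; split => -[t y] /=.
  move=> H; split; first by have := H j; rewrite insert_coordE.
  by move=> k; have := H (lift j k); rewrite insert_coord_lift.
move=> [Ht Hy] i; case: (unliftP j i) => [k ->|->].
  by rewrite insert_coord_lift; exact: Hy.
by rewrite insert_coordE.
Qed.

Lemma lebesgue_rV_box m (B : 'I_m -> set R) :
  (forall i, measurable (B i : set X)) ->
  mu m (box B) = (\prod_i mu1 (B i))%E.
Proof.
elim: m B => [|m IH] B mB.
  by rewrite big_ord0 /= diracE mem_set // => -[].
rewrite big_ord_recl /= /cons_measure /pushforward.
rewrite -[@cons_rV R m @^-1` _]/(ins ord0 @^-1` box B) ins_box.
rewrite product_measure1E //; last exact: measurable_box.
by rewrite IH.
Qed.

Let boxes m : set (set 'rV[R]_m) :=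
  [set A | exists2 B, (forall i, measurable (B i : set X)) & A = box B].

(** Boxes are stable under intersection, so a measure that is finite on an
    exhausting sequence of them is determined by its values on boxes. *)
Lemma measurable_rVE m :
  @measurable _ 'rV[R]_m = <<s boxes (m := m)>>.
Proof.
apply/seteqP; split.
  apply: smallest_sub; first exact: smallest_sigma_algebra.
  case: m => [|m]; first by rewrite big_ord0.
  rewrite -bigcup_mkord_ord; apply: bigcup_sub => i Ii.
  move=> A [B mB <-]; apply: sub_sigma_algebra.
  exists (fun k => if k == inord i then B else setT).
    by move=> k; case: ifP.
  rewrite setTI; apply/seteqP; split => x /=.
    by move=> Bx k; case: eqP => // ->.
  by move=> /(_ (inord i)); rewrite eqxx.
apply: smallest_sub; first exact: sigma_algebra_measurable.
by move=> A [B mB ->]; exact: measurable_box.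
Qed.

Lemma cover_box m : \bigcup_(k : nat) (box (fun=> `[- k%:R, k%:R]%classic)) = [set: 'rV[R]_m].
Proof.
apply/seteqP; split => // x _.
have : exists k : nat, forall i, `|x ord0 i| <= k%:R.
  exists (Num.bound (\sum_i `|x ord0 i|)) => i.
  apply: (@le_trans _ _ (\sum_i `|x ord0 i|)).
    by rewrite (bigD1 i) //= lerDl sumr_ge0.
  by apply/ltW/archi_boundP/sumr_ge0.
case=> k Hk; exists k => // i /=.
by rewrite in_itv /= -ler_norml.
Qed.

(** The recursive definition of the Lebesgue measure singles out the
    coordinate 0. Both sides give a box the product of the lengths of its
    sides, so that all coordinates play the same role. *)
Lemma lebesgue_rV_ins m (j : 'I_m.+1) (A : set 'rV[R]_m.+1) : measurable A ->
  mu m.+1 A = (mu1 \x mu m)%E (ins j @^-1` A).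
Proof.
move=> mA.
pose M2 : {measure set 'rV[R]_m.+1 -> \bar R} :=
  measure_function_pushforward__canonical__measure_function_Measure
     (mu1 \x mu m)%E (@measurable_ins m j).
apply: (@measure_unique _ R 'rV[R]_m.+1 (@boxes m.+1)
  (fun k : nat => box (fun=> `[- k%:R, k%:R]%classic)) _ _ _ _ (mu m.+1) M2) => //.
- exact: measurable_rVE.
- move=> _ _ [B mB ->] [C mC ->]; exists (fun i => B i `&` C i).
    by move=> i; exact: measurableI.
  apply/seteqP; split => x /=.
    by move=> [H1 H2] i; split; [exact: H1|exact: H2].
  by move=> H; split => i; have [] := H i.
- by move=> k; exists (fun=> `[- k%:R, k%:R]%classic).
- exact: cover_box.
- move=> _ [B mB ->].
  apply: (eq_trans (lebesgue_rV_box mB)).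
  rewrite /M2 /= /pushforward ins_box product_measure1E //; last first.
    exact: measurable_box.
  by rewrite lebesgue_rV_box // (bigD1_ord j).
- move=> k.
  have E := @lebesgue_rV_box m.+1 (fun=> `[- k%:R, k%:R]%classic)
    (fun=> measurable_itv _).
  rewrite [ltLHS]E big_const.
  rewrite lebesgue_measure_itv /=; case: ifP => _.
    elim: #|_| => /= [|n IH]; first exact: ltry.
    by rewrite -EFinB lte_mul_pinfty // ?lee_fin // -oppr_le0 opprB; lra.
  elim: #|_| => /= [|n IH]; first exact: ltry.
  by rewrite mul0e.
Qed.

Lemma lebesgue_rV_hyperplane m (j : 'I_m) (c : R) :
  mu m [set x | x ord0 j = c] = 0%E.
Proof.
have E : [set x : 'rV[R]_m | x ord0 j = c] =
    box (fun i => if i == j then [set c] else setT).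
  apply/seteqP; split => x /=.
    by move=> xc i; case: eqP => // ->.
  by move=> /(_ j); rewrite eqxx.
apply: (eq_trans (congr1 (mu m) E)).
apply: (eq_trans (lebesgue_rV_box _)); first by move=> i; case: ifP.
by rewrite (bigD1 j) //= eqxx lebesgue_measure_set1 mul0e.
Qed.

Local Open Scope ereal_scope.

Section ge0_fubini.
Variables (m : nat) (j : 'I_m.+1) (f : 'rV[R]_m.+1 -> \bar R).
Hypotheses (mf : measurable_fun setT f) (f0 : forall x, 0 <= f x).

Let mfi : measurable_fun setT (fun p => f (ins j p)).
Proof. exact: (measurableT_comp mf (measurable_ins j)). Qed.

Let ge0_integral_ins : \int[mu m.+1]_x f x = \int[mu1 \x mu m]_p f (ins j p).
Proof.
pose M2 : {measure set 'rV[R]_m.+1 -> \bar R} :=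
  measure_function_pushforward__canonical__measure_function_Measure
     (mu1 \x mu m)%E (@measurable_ins m j).
have E := @ge0_integral_pushforward _ _ _ _ R (ins j) (measurable_ins j)
  (mu1 \x mu m) setT f measurableT mf (fun x _ => f0 x).
rewrite preimage_setT in E; apply: (eq_trans _ E).
exact: (@eq_measure_integral _ _ R setT M2 (mu m.+1) f)
  (fun A mA _ => lebesgue_rV_ins j mA).
Qed.

Lemma ge0_fubini_coord :
  \int[mu m.+1]_x f x = \int[mu m]_y \int[mu1]_t f (insert_coord j t y).
Proof. by rewrite ge0_integral_ins fubini_tonelli2. Qed.

Lemma ge0_fubini_slice :
  \int[mu m.+1]_x f x = \int[mu1]_t \int[mu m]_y f (insert_coord j t y).
Proof. by rewrite ge0_integral_ins fubini_tonelli1. Qed.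

End ge0_fubini.

Lemma measurable_coord_integral m (j : 'I_m.+1) (f : 'rV[R]_m.+1 -> \bar R) :
  measurable_fun setT f -> (forall x, 0 <= f x) ->
  measurable_fun setT (fun y => \int[mu1]_t f (insert_coord j t y)).
Proof.
move=> mf f0.
have mfi : measurable_fun setT (fun p => f (ins j p)).
  exact: (measurableT_comp mf (measurable_ins j)).
exact: (@measurable_fun_fubini_tonelli_G _ _ _ _ _ mu1 (fun p => f (ins j p)) mfi
  (fun p => f0 _)).
Qed.

Lemma measurable_slice_integral m (j : 'I_m.+1) (f : 'rV[R]_m.+1 -> \bar R) :
  measurable_fun setT f -> (forall x, 0 <= f x) ->
  measurable_fun setT (fun t : X => \int[mu m]_y f (insert_coord j t y)).
Proof.
move=> mf f0.
have mfi : measurable_fun setT (fun p => f (ins j p)).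
  exact: (measurableT_comp mf (measurable_ins j)).
exact: (@measurable_fun_fubini_tonelli_F _ _ _ _ _ (mu m) (fun p => f (ins j p)) mfi
  (fun p => f0 _)).
Qed.

Section integrable.
Variables (m : nat) (j : 'I_m.+1) (f : 'rV[R]_m.+1 -> R).
Hypothesis fi : (mu m.+1).-integrable setT (EFin \o f).

Let mf : measurable_fun setT f.
Proof. by apply/measurable_EFinP; case/integrableP: fi. Qed.

Let mfi : measurable_fun setT (fun p => (f (ins j p))%:E).
Proof. by apply/measurable_EFinP; exact: (measurableT_comp mf (measurable_ins j)). Qed.

Let fiP : (mu1 \x mu m).-integrable setT (fun p => (f (ins j p))%:E).
Proof.
apply/integrableP; split => //.
case/integrableP: fi => _.
rewrite (ge0_fubini_coord j (f := fun x => `|(f x)%:E|)) //; last first.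
  by apply: measurableT_comp => //; exact/measurable_EFinP.
rewrite -(fubini_tonelli2 (fun p => `|(f (ins j p))%:E|)) //.
exact: measurableT_comp.
Qed.

Let EF : \int[mu m.+1]_x (f x)%:E = \int[mu1 \x mu m]_p (f (ins j p))%:E.
Proof.
pose M2 : {measure set 'rV[R]_m.+1 -> \bar R} :=
  measure_function_pushforward__canonical__measure_function_Measure
     (mu1 \x mu m)%E (@measurable_ins m j).
have mf' : measurable_fun setT (EFin \o f) by exact/measurable_EFinP.
have E := @integral_pushforward _ _ _ _ R (ins j) (measurable_ins j)
  (mu1 \x mu m) setT (EFin \o f) mf' fiP measurableT.
rewrite preimage_setT in E; apply: (eq_trans _ E).
exact: (@eq_measure_integral _ _ R setT M2 (mu m.+1) (EFin \o f))
  (fun A mA _ => lebesgue_rV_ins j mA).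
Qed.

Lemma fubini_coord :
  \int[mu m.+1]_x (f x)%:E = \int[mu m]_y \int[mu1]_t (f (insert_coord j t y))%:E.
Proof. by rewrite EF -integral21_prod_meas1. Qed.

Lemma fubini_slice :
  \int[mu m.+1]_x (f x)%:E = \int[mu1]_t \int[mu m]_y (f (insert_coord j t y))%:E.
Proof. by rewrite EF -integral12_prod_meas1. Qed.

Lemma integrable_coord : (mu m).-integrable setT
  (fun y => \int[mu1]_t (f (insert_coord j t y))%:E).
Proof.
apply/integrableP; split; first exact: (measurable_fubini_G fiP).
have := (integrable21ltyP mu1 (mu m) mfi).1 fiP; apply: le_lt_trans.
apply: ge0_le_integral => //.
- exact: measurableT_comp (measurable_fubini_G fiP).
- have mA : measurable_fun setT (fun p => `|(f (ins j p))%:E|).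
    exact: measurableT_comp.
  exact: (measurable_fun_fubini_tonelli_G _ mA).
- move=> y _; apply: le_abse_integral => //.
  exact: (measurableT_comp mfi (measurable_pair2 y)).
Qed.

Lemma integrable_slice : mu1.-integrable setT
  (fun t => \int[mu m]_y (f (insert_coord j t y))%:E).
Proof. exact: (integrable_fubini_F fiP). Qed.

Lemma ae_integrable_coord : {ae mu m, forall y,
  mu1.-integrable setT (fun t => (f (insert_coord j t y))%:E)}.
Proof. exact: (ae_integrable2 fiP). Qed.

Lemma ae_integrable_slice : {ae mu1, forall t,
  (mu m).-integrable setT (fun y => (f (insert_coord j t y))%:E)}.
Proof. exact: (ae_integrable1 fiP). Qed.

End integrable.

Lemma ae_coord m (j : 'I_m.+1) (P : 'rV[R]_m.+1 -> Prop) :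
  {ae mu m.+1, forall x, P x} ->
  {ae mu m, forall y, {ae mu1, forall t, P (insert_coord j t y)}}.
Proof.
move=> [N [mN N0 PN]].
have mI : measurable_fun setT (fun x => (\1_N x)%:E : \bar R).
  by apply/measurable_EFinP; exact: measurable_indic.
have : \int[mu m.+1]_x (\1_N x)%:E = 0 by rewrite integral_indic // setIT.
rewrite (ge0_fubini_coord j mI); last by move=> x; rewrite lee_fin.
have mG := measurable_coord_integral j mI (fun x => ltac:(by rewrite lee_fin)).
move=> I0.
have /(ae_eq_integral_abs _ measurableT mG) : \int[mu m]_y
    `|\int[mu1]_t (\1_N (insert_coord j t y))%:E| = 0.
  rewrite -[RHS]I0; apply: eq_integral => y _; rewrite gee0_abs //.
  by apply: integral_ge0 => t _; rewrite lee_fin.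
apply: filterS => y /(_ Logic.I) Hy.
exists [set t | N (insert_coord j t y)]; split.
- by rewrite -[X in measurable X]setTI; exact: measurable_ins1.
- have mA : measurable [set t : X | N (insert_coord j t y)].
    by rewrite -[X in measurable X]setTI; exact: measurable_ins1.
  rewrite -(setIT [set _ | _]) -integral_indic //.
- by move=> t /= Pt; apply: PN.
Qed.

Lemma ae_slice m (j : 'I_m.+1) (P : 'rV[R]_m.+1 -> Prop) :
  {ae mu m.+1, forall x, P x} ->
  {ae mu1, forall t : X, {ae mu m, forall y, P (insert_coord j t y)}}.
Proof.
move=> [N [mN N0 PN]].
have mI : measurable_fun setT (fun x => (\1_N x)%:E : \bar R).
  by apply/measurable_EFinP; exact: measurable_indic.
have : \int[mu m.+1]_x (\1_N x)%:E = 0 by rewrite integral_indic // setIT.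
rewrite (ge0_fubini_slice j mI); last by move=> x; rewrite lee_fin.
have mG := measurable_slice_integral j mI (fun x => ltac:(by rewrite lee_fin)).
move=> I0.
have /(ae_eq_integral_abs _ measurableT mG) : \int[mu1]_t
    `|\int[mu m]_y (\1_N (insert_coord j t y))%:E| = 0.
  rewrite -[RHS]I0; apply: eq_integral => y _; rewrite gee0_abs //.
  by apply: integral_ge0 => t _; rewrite lee_fin.
apply: filterS => t /(_ Logic.I) Ht.
have mA : measurable [set y | N (insert_coord j t y)].
  by rewrite -[X in measurable X]setTI; exact: measurable_ins2.
exists [set y | N (insert_coord j t y)]; split => //.
- by rewrite -(setIT [set _ | _]) -integral_indic //.
- by move=> y /= Py; apply: PN.
Qed.

(** Tonelli for the indicator function of the complement, whence the
    measurability of the set. *)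
Lemma ae_of_slice m (j : 'I_m.+1) (A : set 'rV[R]_m.+1) : measurable A ->
  {ae mu1, forall t : X, {ae mu m, forall y, A (insert_coord j t y)}} ->
  {ae mu m.+1, forall x, A x}.
Proof.
move=> mA H.
have mC : measurable (~` A) by exact: measurableC.
have mI : measurable_fun setT (fun x => (\1_(~` A) x)%:E : \bar R).
  by apply/measurable_EFinP; exact: measurable_indic.
exists (~` A); split => //.
rewrite -(setIT (~` A)) -integral_indic //.
have I0 x : 0 <= (\1_(~` A) x)%:E :> \bar R by rewrite lee_fin.
rewrite (ge0_fubini_slice j mI) //.
have {}H : {ae mu1, forall t : X, setT t ->
    \int[mu m]_y (\1_(~` A) (insert_coord j t y))%:E = cst 0 t}.
  move: H; apply: filterS => t Ht _ /=.
  have {}Ht : {ae mu m, forall y, setT y ->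
    (\1_(~` A) (insert_coord j t y))%:E = cst 0 y :> \bar R}.
    move: Ht; apply: filterS => y Ay _ /=.
    by rewrite indicE memNset //= => /(_ Ay).
  rewrite (ge0_ae_eq_integral (g := cst 0) _ _ _ _ _ Ht) ?integral0 //.
  exact: (measurableT_comp mI (measurable_ins2 j t)).
rewrite (ge0_ae_eq_integral (g := cst 0) _ _ _ _ _ H) ?integral0 //.
- exact: (measurable_slice_integral j mI I0).
- by move=> t _; apply: integral_ge0.
Qed.

Lemma ae_of_coord m (j : 'I_m.+1) (A : set 'rV[R]_m.+1) : measurable A ->
  {ae mu m, forall y : 'rV[R]_m, {ae mu1, forall t : X, A (insert_coord j t y)}} ->
  {ae mu m.+1, forall x, A x}.
Proof.
move=> mA H.
have mC : measurable (~` A) by exact: measurableC.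
have mI : measurable_fun setT (fun x => (\1_(~` A) x)%:E : \bar R).
  by apply/measurable_EFinP; exact: measurable_indic.
exists (~` A); split => //.
rewrite -(setIT (~` A)) -integral_indic //.
have I0 x : 0 <= (\1_(~` A) x)%:E :> \bar R by rewrite lee_fin.
rewrite (ge0_fubini_coord j mI) //.
have {}H : {ae mu m, forall y, setT y ->
    \int[mu1]_t (\1_(~` A) (insert_coord j t y))%:E = cst 0 y}.
  move: H; apply: filterS => y Hy _ /=.
  have {}Hy : {ae mu1, forall t : X, setT t ->
    (\1_(~` A) (insert_coord j t y))%:E = cst 0 t :> \bar R}.
    move: Hy; apply: filterS => t At _ /=.
    by rewrite indicE memNset //= => /(_ At).
  rewrite (ge0_ae_eq_integral (g := cst 0) _ _ _ _ _ Hy) ?integral0 //.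
  exact: (measurableT_comp mI (measurable_ins1 j y)).
rewrite (ge0_ae_eq_integral (g := cst 0) _ _ _ _ _ H) ?integral0 //.
- exact: (measurable_coord_integral j mI I0).
- by move=> y _; apply: integral_ge0.
Qed.

End fubini_coordinate.

(** * Rectangles and Lebesgue differentiation *)

Section rect_fubini.
Context {R : realType}.
Local Notation X := (measurableTypeR R).
Local Notation mu1 := (@lebesgue_measure R).
Local Notation mu := (@lebesgue_rV R).
Local Open Scope ereal_scope.

Lemma rect_insE m (j : 'I_m.+1) (a b : 'rV[R]_m.+1) (t : R) (y : 'rV[R]_m) :
  rect a b (insert_coord j t y) <->
  `[a ord0 j, b ord0 j]%classic t /\ rect (col' j a) (col' j b) y.
Proof.
split=> [H|[Ht Hy] i].
  split; first by have := H j; rewrite insert_coordE /= in_itv.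
  by move=> k; have := H (lift j k); rewrite insert_coord_lift !mxE.
case: (unliftP j i) => [k|] ->.
  by have := Hy k; rewrite insert_coord_lift !mxE.
by rewrite insert_coordE; move: Ht; rewrite /= in_itv.
Qed.

(** Integrals over a rectangle are integrals of functions extended by zero;
    slicing such an extension extends the slice by zero. *)
Lemma patch_rect_ins m (j : 'I_m.+1) (a b : 'rV[R]_m.+1) T (f : 'rV[R]_m.+1 -> T)
    (c : T) t y :
  patch (fun=> c) (rect a b) f (insert_coord j t y) =
  patch (fun=> c) (rect (col' j a) (col' j b)) (fun y =>
    patch (fun=> c) `[a ord0 j, b ord0 j] (fun t => f (insert_coord j t y)) t) y.
Proof.
rewrite /patch; case: ifPn => [/set_mem/rect_insE[Ht Hy]|H].
  by rewrite mem_set // mem_set.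
case: ifPn => // /set_mem Hy; case: ifPn => // /set_mem Ht.
by move: H; rewrite mem_set //; exact/rect_insE.
Qed.

Lemma ge0_fubini_rect_coord m (j : 'I_m.+1) (a b : 'rV[R]_m.+1)
    (f : 'rV[R]_m.+1 -> \bar R) :
  measurable_fun setT f -> (forall x, 0 <= f x) ->
  \int[mu m.+1]_(x in rect a b) f x =
  \int[mu m]_(y in rect (col' j a) (col' j b))
    \int[mu1]_(t in `[a ord0 j, b ord0 j]) f (insert_coord j t y).
Proof.
move=> mf f0; rewrite integral_mkcond (ge0_fubini_coord j); last 2 first.
- apply/(measurable_restrictT f (measurable_rect a b)).
  exact: measurable_funTS.
- by move=> x; rewrite patchE; case: ifP.
rewrite [RHS]integral_mkcond; apply: eq_integral => y _.
under eq_integral do rewrite patch_rect_ins.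
rewrite [RHS]patchE; case: ifPn => yF; last first.
  by apply: integral0_eq => t _; rewrite patchE (negbTE yF).
rewrite [RHS]integral_mkcond; apply: eq_integral => t _.
by rewrite patchE yF.
Qed.

Lemma ge0_fubini_rect_slice m (j : 'I_m.+1) (a b : 'rV[R]_m.+1)
    (f : 'rV[R]_m.+1 -> \bar R) :
  measurable_fun setT f -> (forall x, 0 <= f x) ->
  \int[mu m.+1]_(x in rect a b) f x =
  \int[mu1]_(t in `[a ord0 j, b ord0 j])
    \int[mu m]_(y in rect (col' j a) (col' j b)) f (insert_coord j t y).
Proof.
move=> mf f0; rewrite integral_mkcond (ge0_fubini_slice j); last 2 first.
- apply/(measurable_restrictT f (measurable_rect a b)).
  exact: measurable_funTS.
- by move=> x; rewrite patchE; case: ifP.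
rewrite [RHS]integral_mkcond; apply: eq_integral => t _.
under eq_integral do rewrite patch_rect_ins.
rewrite [RHS]patchE; case: ifPn => tF; last first.
  by apply: integral0_eq => y _; rewrite !patchE (negbTE tF); case: ifP.
rewrite [RHS]integral_mkcond; apply: eq_integral => y _.
by rewrite !patchE tF.
Qed.

End rect_fubini.

Lemma integrable_cst_lty d (T : measurableType d) (R : realType)
    (m : {measure set T -> \bar R}) (D : set T) (k : R) :
  measurable D -> (m D < +oo)%E -> m.-integrable D (fun=> k%:E).
Proof.
move=> mD Doo; apply/integrableP; split; first exact: measurable_cst.
by rewrite integral_cst //= lte_mul_pinfty ?lee_fin.
Qed.

(** [filterS] with the measure as a parameter, which lets unification find the
    filter. *)
Lemma aeS d (T : measurableType d) (R : realType) (m : {measure set T -> \bar R})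
    (P Q : T -> Prop) : (forall x, P x -> Q x) ->
  {ae m, forall x, P x} -> {ae m, forall x, Q x}.
Proof. by move=> PQ; apply: filterS. Qed.

Lemma aeS2 d (T : measurableType d) (R : realType) (m : {measure set T -> \bar R})
    (P Q S : T -> Prop) : (forall x, P x -> Q x -> S x) ->
  {ae m, forall x, P x} -> {ae m, forall x, Q x} -> {ae m, forall x, S x}.
Proof. by move=> PQ; apply: filterS2. Qed.

Lemma ae_countable d (T : measurableType d) (R : realType)
    (m : {measure set T -> \bar R}) (I : countType) (P : I -> T -> Prop) :
  (forall i, {ae m, forall x, P i x}) -> {ae m, forall x, forall i, P i x}.
Proof.
move=> H.
have : {ae m, forall x, forall n : nat, if unpickle n is Some i then P i x else True}.
  apply/ae_foralln => n; case: (unpickle n) => [i|]; first exact: H.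
  exact: nearW.
by apply: aeS => x Hx i; have := Hx (pickle i); rewrite pickleK.
Qed.

Section lebesgue_differentiation_rect.
Context {R : realType}.
Local Notation X := (measurableTypeR R).
Local Notation mu1 := (@lebesgue_measure R).
Local Notation mu := (@lebesgue_rV R).

(** The interval fills a fixed proportion of the ball of radius [r] without
    being centred at [t]. This freedom is what makes rational endpoints
    possible. *)
Lemma lebesgue_pt_itv (f : R -> R) (t : R) :
  mu1.-integrable setT (EFin \o f) -> lebesgue_pt f t ->
  forall e, 0 < e -> exists2 r0, 0 < r0 & forall r p q, 0 < r < r0 ->
    t - r < p < t - r / 2 -> t + r / 2 < q < t + r ->
    `|(q - p)^-1 * (\int[mu1]_(s in `[p, q]) f s) - f t| < e.
Proof.
move=> fi ft e e0.
have mf : measurable_fun setT f by apply/measurable_EFinP; case/integrableP: fi.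
have /fine_cvgP[Hfin /cvgr0_norm_lt/(_ (e / 2))] := ft.
rewrite divr_gt0 // => /(_ isT) Hlt.
have [d /= d0 Hd] := filterI Hfin Hlt.
exists d => // r p q /andP[r0 rd] /andP[p1 p2] /andP[q1 q2].
have pq : p < q by lra.
have [] := Hd r; first by rewrite /= sub0r normrN gtr0_norm.
  by [].
rewrite /= /davg /iavg lebesgue_measure_ball; last exact: ltW.
set I := (\int[mu1]_(y in ball t r) _)%E => Ifin.
have I0 : (0 <= I)%E by apply: integral_ge0.
have r2 : r *+ 2 != 0 by rewrite mulrn_eq0 /= gt_eqF.
have {Ifin} Ifin : I \is a fin_num.
  move: Ifin I0; rewrite inver (negbTE r2); case: I => [//| |//] + _.
  by rewrite mulry gtr0_sg ?mul1e // invr_gt0 pmulrn_lgt0.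
rewrite inver (negbTE r2) -(fineK Ifin) -EFinM /=.
have fI0 : 0 <= fine I by exact: fine_ge0.
rewrite ger0_norm; last by rewrite mulr_ge0 // invr_ge0 pmulrn_lge0 // ltW.
move=> Hr.
have Iri : (fine I < e * r).
  move: Hr; rewrite mulrC ltr_pdivrMr ?pmulrn_lgt0 // => Hr.
  by rewrite (_ : e * r = e / 2 * (r *+ 2)) //; field.
have mI : measurable (`[p, q] : set X) by exact: measurable_itv.
have fpq : mu1.-integrable `[p, q] (EFin \o f) by exact: integrableS fi.
have cpq : mu1.-integrable `[p, q] (EFin \o cst (f t)).
  apply: integrable_cst_lty => //=.
  by rewrite lebesgue_measure_itv /= lte_fin pq -EFinB ltry.
have -> : (q - p)^-1 * (\int[mu1]_(s in `[p, q]) f s) - f t =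
    (q - p)^-1 * \int[mu1]_(s in `[p, q]) (f s - f t).
  rewrite RintegralB // Rintegral_cst //= lebesgue_measure_itv /= lte_fin pq -EFinB /=.
  by field; lra.
have qp0 : 0 < q - p by rewrite subr_gt0.
rewrite normrM normfV (gtr0_norm qp0) mulrC ltr_pdivrMr //.
apply: (@le_lt_trans _ _ (fine I)); last by nra.
rewrite -lee_fin fineK // EFin_normr_Rintegral //; last exact: (integrableB mI fpq cpq).
apply: (@le_trans _ _ (\int[mu1]_(s in `[p, q]) `|(f s - f t)%:E|)%E).
  apply: le_abse_integral => //.
  by apply/measurable_EFinP/measurable_funB => //; exact: measurable_funTS.
apply: ge0_subset_integral => //=.
- exact: measurable_ball.
- apply/measurable_EFinP; apply: measurableT_comp => //.
  by apply: measurable_funB => //; exact: measurable_funTS.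
- move=> s /=; rewrite in_itv /= => /andP[ps sq].
  by rewrite /ball /= ltr_norml; lra.
Qed.

Definition ravg m (p q : 'rV[R]_m) (f : 'rV[R]_m -> R) : R :=
  (\prod_i (q ord0 i - p ord0 i))^-1 * \int[mu m]_(x in rect p q) f x.

Definition rat_vec m (p : 'rV[rat]_m) : 'rV[R]_m := map_mx ratr p.

Definition rect_near m (y : 'rV[R]_m) (e : R) (p q : 'rV[R]_m) :=
  forall i, p ord0 i < y ord0 i < q ord0 i /\ q ord0 i - p ord0 i < e.

(** One interval serves both functions, so that products of averages can be
    compared; rational endpoints leave countably many intervals, hence
    countably many exceptional null sets. *)
Lemma ae_lebesgue_pt_itv (f g : R -> R) :
  mu1.-integrable setT (EFin \o f) -> mu1.-integrable setT (EFin \o g) ->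
  {ae mu1, forall t : X, forall e : R, 0 < e -> exists p q : rat,
    [/\ (ratr p : R) < t < ratr q, (ratr q : R) - ratr p < e,
      `|(ratr q - ratr p)^-1 * (\int[mu1]_(s in `[ratr p, ratr q]) f s) - f t| < e &
      `|(ratr q - ratr p)^-1 * (\int[mu1]_(s in `[ratr p, ratr q]) g s) - g t| < e]}.
Proof.
move=> fi gi.
have Lf : {ae mu1, forall t : X, lebesgue_pt f t} :=
  lebesgue_differentiation (open_integrable_locally openT fi).
have Lg : {ae mu1, forall t : X, lebesgue_pt g t} :=
  lebesgue_differentiation (open_integrable_locally openT gi).
move: Lf Lg; apply: aeS2 => t Lf Lg e e0.
have [r1 r10 H1] := lebesgue_pt_itv fi Lf e0.
have [r2 r20 H2] := lebesgue_pt_itv gi Lg e0.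
pose r := Num.min (e / 4) (Num.min r1 r2) / 2.
have r0 : 0 < r by rewrite divr_gt0 // !lt_min r10 r20 divr_gt0.
have re : r <= e / 8 by rewrite ler_pdivrMr // ge_min; apply/orP; left; lra.
have rr1 : r < r1.
  by rewrite ltr_pdivrMr // gt_min; apply/orP; right; rewrite gt_min; apply/orP; left; lra.
have rr2 : r < r2.
  by rewrite ltr_pdivrMr // gt_min; apply/orP; right; rewrite gt_min; apply/orP; right; lra.
have [p /[!in_itv]/= Hp] : exists p : rat, ratr p \in `]t - r, t - r / 2[.
  by apply: rat_in_itvoo; lra.
have [q /[!in_itv]/= Hq] : exists q : rat, ratr q \in `]t + r / 2, t + r[.
  by apply: rat_in_itvoo; lra.
exists p, q; split.
- by move: Hp Hq => /andP[? ?] /andP[? ?]; apply/andP; split; lra.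
- by move: Hp Hq => /andP[? ?] /andP[? ?]; lra.
- by apply: (H1 r) => //; rewrite r0.
- by apply: (H2 r) => //; rewrite r0.
Qed.

End lebesgue_differentiation_rect.

Section integrable_fine.
Context d (T : measurableType d) (R : realType) (m : {measure set T -> \bar R}).
Variables (D : set T) (g : T -> \bar R).
Hypotheses (mD : measurable D) (gi : m.-integrable D g).

Let ae_fine : ae_eq m D g (fun x => (fine (g x))%:E).
Proof. by have := integrable_ae mD gi; apply: aeS => x H /H /fineK. Qed.

Let mg : measurable_fun D g. Proof. by case/integrableP: gi. Qed.

Let mfine : measurable_fun D (fun x => (fine (g x))%:E).
Proof.
by apply/measurable_EFinP; apply: measurableT_comp => //; exact: fine_measurable.
Qed.

Lemma integral_fine : (\int[m]_(x in D) (fine (g x))%:E = \int[m]_(x in D) g x)%E.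
Proof. exact/esym/ae_eq_integral. Qed.

(** In an iterated real-valued integral the inner integral is replaced by 0
    when it is infinite, which happens on a null set only. *)
Lemma integrable_fine : m.-integrable D (fun x => (fine (g x))%:E).
Proof.
apply/integrableP; split => //; case/integrableP: gi => _.
rewrite (ae_eq_integral (fun x => `|(fine (g x))%:E|%E)) //.
- exact: measurableT_comp.
- exact: measurableT_comp.
- by move: ae_fine; apply: aeS => x H /H <-.
Qed.

End integrable_fine.

Section Rfubini.
Context {R : realType}.
Local Notation X := (measurableTypeR R).
Local Notation mu1 := (@lebesgue_measure R).
Local Notation mu := (@lebesgue_rV R).
Lemma Rfubini_slice m (j : 'I_m.+1) (f : 'rV[R]_m.+1 -> R) : (mu m.+1).-integrable setT (EFin \o f) ->
  \int[mu m.+1]_x f x = \int[mu1]_t \int[mu m]_y f (insert_coord j t y).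
Proof.
move=> fi; rewrite {1}/Rintegral (fubini_slice j fi) {1}/Rintegral.
by congr fine; rewrite -[LHS]integral_fine //; exact: integrable_slice.
Qed.

Lemma Rfubini_coord m (j : 'I_m.+1) (f : 'rV[R]_m.+1 -> R) : (mu m.+1).-integrable setT (EFin \o f) ->
  \int[mu m.+1]_x f x = \int[mu m]_y \int[mu1]_t f (insert_coord j t y).
Proof.
move=> fi; rewrite {1}/Rintegral (fubini_coord j fi) {1}/Rintegral.
by congr fine; rewrite -[LHS]integral_fine //; exact: integrable_coord.
Qed.

Variables (m : nat) (j : 'I_m.+1) (f : 'rV[R]_m.+1 -> R).
Variables (a b : 'rV[R]_m.+1).
Hypothesis fi : (mu m.+1).-integrable (rect a b) (EFin \o f).

Let fi0 : (mu m.+1).-integrable setT (EFin \o (f \_ (rect a b))).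
Proof.
rewrite -restrict_EFin; apply: (integrable_mkcond _ _).1 => //.
exact: measurable_rect.
Qed.

Let slice_patch t : `[a ord0 j, b ord0 j]%classic t ->
  \int[mu m]_y (f \_ (rect a b)) (insert_coord j t y) =
  \int[mu m]_(y in rect (col' j a) (col' j b)) f (insert_coord j t y).
Proof.
move=> tI; rewrite [RHS]Rintegral_mkcond; apply: eq_Rintegral => y _.
by rewrite /patch; congr (if _ then _ else _); apply/idP/idP;
   rewrite !inE rect_insE; tauto.
Qed.

Lemma Rfubini_rect_slice : \int[mu m.+1]_(x in rect a b) f x =
  \int[mu1]_(t in `[a ord0 j, b ord0 j])
     \int[mu m]_(y in rect (col' j a) (col' j b)) f (insert_coord j t y).
Proof.
rewrite Rintegral_mkcond (Rfubini_slice j) // [RHS]Rintegral_mkcond.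
apply: eq_Rintegral => t _; rewrite patchE; case: ifPn => [/set_mem tI|tI].
  exact: slice_patch.
rewrite (_ : (fun y => _) = cst 0) ?Rintegral_cst ?mul0r //.
apply/funext => y; rewrite patchE; case: ifPn => // /set_mem/rect_insE[Ht _].
by case/negP: tI; rewrite inE.
Qed.

Lemma integrable_rect_slice : mu1.-integrable `[a ord0 j, b ord0 j]
  (fun t => (\int[mu m]_(y in rect (col' j a) (col' j b)) f (insert_coord j t y))%:E).
Proof.
have mI : measurable (`[a ord0 j, b ord0 j] : set X) by exact: measurable_itv.
have H := integrable_fine measurableT (integrable_slice j fi0).
have /(eq_integrable mI) : {in `[a ord0 j, b ord0 j]%classic, (fun t =>
   (\int[mu m]_y (f \_ (rect a b)) (insert_coord j t y))%:E) =1 (fun t =>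
   (\int[mu m]_(y in rect (col' j a) (col' j b)) f (insert_coord j t y))%:E)}.
  by move=> t /set_mem tI; rewrite slice_patch.
by apply; exact: integrableS H.
Qed.

End Rfubini.

Section rect_differentiation.
Context {R : realType}.
Local Notation X := (measurableTypeR R).
Local Notation mu1 := (@lebesgue_measure R).
Local Notation mu := (@lebesgue_rV R).

Let good m (f g : 'rV[R]_m -> R) (e : R) (p q : 'rV[rat]_m) : set 'rV[R]_m :=
  [set y | [/\ rect_near y e (rat_vec p) (rat_vec q),
    `|ravg (rat_vec p) (rat_vec q) f - f y| < e &
    `|ravg (rat_vec p) (rat_vec q) g - g y| < e]].

Let measurable_good m f g e p q : measurable_fun setT f -> measurable_fun setT g ->
  measurable (@good m f g e p q).
Proof.
move=> mf mg.
have mlt (h : 'rV[R]_m -> R) (c : R) : measurable_fun setT h -> measurable [set y | `|c - h y| < e].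
  move=> mh; rewrite (_ : [set y | _] = (fun y => `|c - h y|) @^-1` `]-oo, e[).
    rewrite -[X in measurable X]setTI.
    have : measurable_fun [set: 'rV[R]_m] (fun y => `|c - h y|).
      by apply: measurableT_comp => //; exact: measurable_funB.
    by apply => //; exact: measurable_itv.
  by apply/seteqP; split => y /=; rewrite in_itv.
pose N i := [set y : 'rV[R]_m | rat_vec p ord0 i < y ord0 i < rat_vec q ord0 i /\
  rat_vec q ord0 i - rat_vec p ord0 i < e].
have mN i : measurable (N i).
  have [pq|pq] := boolP (rat_vec q ord0 i - rat_vec p ord0 i < e); last first.
    have -> : N i = set0 by apply/seteqP; split => y //= -[_]; rewrite (negbTE pq).
    exact: measurable0.
  have -> : N i = setT `&` (fun y : 'rV[R]_m => y ord0 i : X) @^-1`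
      `]rat_vec p ord0 i, rat_vec q ord0 i[.
    by apply/seteqP; split => y /=; rewrite in_itv /N /=; [case|case].
  by apply: measurable_coord => //; exact: measurable_itv.
have -> : good f g e p q = \bigcap_(i in [set: 'I_m]) N i `&`
    ([set y | `|ravg (rat_vec p) (rat_vec q) f - f y| < e] `&`
     [set y | `|ravg (rat_vec p) (rat_vec q) g - g y| < e]).
  apply/seteqP; split => y /=.
    by case=> H1 H2 H3; split => // i _; exact: H1.
  by case=> H1 [H2 H3]; split => // i; exact: H1.
apply: measurableI; last by apply: measurableI; exact: mlt.
exact: fin_bigcap_measurable.
Qed.

Let slab_integral m (p q : 'rV[R]_m) (f : 'rV[R]_m.+1 -> R) t :=
  ravg p q (fun y => f (insert_coord ord0 t y)).

Let integrable_slab m (p q : 'rV[R]_m) (f : 'rV[R]_m.+1 -> R) :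
  (mu m.+1).-integrable setT (EFin \o f) ->
  mu1.-integrable setT (EFin \o slab_integral p q f).
Proof.
move=> fi.
pose S := [set x : 'rV[R]_m.+1 | rect p q (col' ord0 x)].
have mS : measurable S.
  rewrite -[X in measurable X]setTI.
  exact: (measurable_col' ord0 measurableT (measurable_rect p q)).
have hi : (mu m.+1).-integrable setT (EFin \o (f \_ S)).
  by rewrite -restrict_EFin; apply: (integrable_mkcond _ _).1 => //; exact: integrableS fi.
have := integrable_fine measurableT (integrable_slice ord0 hi).
move=> /(integrableZl measurableT (\prod_i (q ord0 i - p ord0 i))^-1).
apply: eq_integrable => // t _ /=.
rewrite -EFinM; congr (_ * _)%:E; rewrite [RHS]Rintegral_mkcond.
apply: eq_Rintegral => y _; rewrite /patch.
by congr (if _ then _ else _); apply/idP/idP; rewrite !inE /S /= col'_insert_coord.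
Qed.

Let rat_vec_ins m (p0 : rat) (p : 'rV[rat]_m) :
  rat_vec (@insert_coord rat m.+1 ord0 p0 p) =
  @insert_coord R m.+1 ord0 (ratr p0) (rat_vec p).
Proof. by apply/rowP => i; rewrite !mxE; case: unlift => //= k; rewrite mxE. Qed.

Let ravg_ins m (p0 q0 : R) (p q : 'rV[R]_m) (f : 'rV[R]_m.+1 -> R) :
  (mu m.+1).-integrable setT (EFin \o f) ->
  ravg (insert_coord ord0 p0 p) (insert_coord ord0 q0 q) f =
  (q0 - p0)^-1 * \int[mu1]_(t in `[p0, q0]) slab_integral p q f t.
Proof.
move=> fi; rewrite /ravg (Rfubini_rect_slice ord0); last first.
  by apply: integrableS fi => //; exact: measurable_rect.
rewrite !insert_coordE !col'_insert_coord big_ord_recl !insert_coordE.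
under eq_bigr do rewrite !insert_coord_lift.
rewrite invfM -mulrA; congr (_ * _); rewrite -RintegralZl //.
have := @integrable_rect_slice R m ord0 f
   (insert_coord ord0 p0 p) (insert_coord ord0 q0 q).
rewrite !insert_coordE !col'_insert_coord; apply.
by apply: integrableS fi => //; exact: measurable_rect.
Qed.

(** Averages over all rectangles containing a point need not converge for an
    integrable function, but here one small rectangle of each size is enough,
    and it is built one coordinate at a time: for almost every [t], the slice
    at [t] is differentiated by induction, while the one-dimensional theorem
    at [t] is applied to the integrals of the slices over each of the
    countably many rational rectangles. *)
Lemma rect_differentiation m (f g : 'rV[R]_m -> R) :
  (mu m).-integrable setT (EFin \o f) -> (mu m).-integrable setT (EFin \o g) ->
  {ae mu m, forall y, forall e : R, 0 < e -> exists p q : 'rV[rat]_m,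
    [/\ rect_near y e (rat_vec p) (rat_vec q),
      `|ravg (rat_vec p) (rat_vec q) f - f y| < e &
      `|ravg (rat_vec p) (rat_vec q) g - g y| < e]}.
Proof.
elim: m f g => [|m IH] f g fi gi.
  apply: nearW => y e e0; exists 0, 0.
  have H (h : 'rV[R]_0 -> R) : (mu 0).-integrable setT (EFin \o h) ->
      ravg (rat_vec 0) (rat_vec 0) h - h y = 0.
    case/integrableP => mh _; rewrite /ravg big_ord0 invr1 mul1r (_ : rect _ _ = setT); last first.
      by apply/seteqP; split => // z _; rewrite /rect /= => -[].
    rewrite /Rintegral integral_dirac //.
    by rewrite diracT mul1e /= (_ : 0 = y) ?subrr //; apply/rowP => -[].
  by split; rewrite ?H ?normr0 //; case.
have mf : measurable_fun setT f by apply/measurable_EFinP; case/integrableP: fi.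
have mg : measurable_fun setT g by apply/measurable_EFinP; case/integrableP: gi.
pose A := \bigcap_(k : nat) \bigcup_(pq : 'rV[rat]_m.+1 * 'rV[rat]_m.+1)
  good f g k.+1%:R^-1 pq.1 pq.2.
have mA : measurable A.
  apply: bigcapT_measurable => k; apply: countable_bigcupT_measurable.
    exact: countableP.
  by move=> pq; exact: measurable_good.
suff : {ae mu m.+1, forall y, A y}.
  apply: aeS => y Ay e e0.
  have [[p q] _ [/= H1 H2 H3]] := Ay (Num.bound e^-1) Logic.I.
  have He : (Num.bound e^-1).+1%:R^-1 <= e.
    rewrite -[leRHS]invrK lef_pV2 ?posrE ?ltr0n ?invr_gt0 //.
    apply: ltW; apply: (lt_le_trans (archi_boundP _)); first by rewrite invr_ge0 ltW.
    by rewrite ler_nat.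
  exists p, q; split => //.
  - by move=> i; have [? ?] := H1 i; split => //; exact: lt_le_trans He.
  - exact: lt_le_trans He.
  - exact: lt_le_trans He.
apply: (ae_of_slice (j := ord0)) => //.
have H3 (h : 'rV[R]_m.+1 -> R) : (mu m.+1).-integrable setT (EFin \o h) ->
    {ae mu1, forall t : X, (mu m).-integrable setT
       (fun y => (h (insert_coord ord0 t y))%:E)}.
  exact: ae_integrable_slice.
have H4 : {ae mu1, forall t : X, forall pq : 'rV[rat]_m * 'rV[rat]_m,
    forall e : R, 0 < e -> exists p q : rat,
    [/\ (ratr p : R) < t < ratr q, (ratr q : R) - ratr p < e,
      `|(ratr q - ratr p)^-1 * (\int[mu1]_(s in `[ratr p, ratr q])
         slab_integral (rat_vec pq.1) (rat_vec pq.2) f s) -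
         slab_integral (rat_vec pq.1) (rat_vec pq.2) f t| < e &
      `|(ratr q - ratr p)^-1 * (\int[mu1]_(s in `[ratr p, ratr q])
         slab_integral (rat_vec pq.1) (rat_vec pq.2) g s) -
         slab_integral (rat_vec pq.1) (rat_vec pq.2) g t| < e]}.
  apply: ae_countable => pq.
  by apply: ae_lebesgue_pt_itv; exact: integrable_slab.
move: (aeS2 (fun t H H' => conj H H') (H3 f fi) (H3 g gi)) H4.
apply: aeS2 => t [fti gti] H4.
have := IH _ _ fti gti; apply: aeS => y Hy k _.
have e2 : 0 < k.+1%:R^-1 / 2 :> R by rewrite divr_gt0 // invr_gt0.
have [p [q [Hpq Hf Hg]]] := Hy _ e2.
have [p0 [q0 [Htpq Hpq0 Hf0 Hg0]]] := H4 (p, q) _ e2.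
exists (insert_coord ord0 p0 p, insert_coord ord0 q0 q) => //=.
have hh : k.+1%:R^-1 / 2 < k.+1%:R^-1 :> R.
  by rewrite ltr_pdivrMr // ltr_pMr ?invr_gt0 // ltr1n.
have tri (a b c : R) : `|a - b| < k.+1%:R^-1 / 2 -> `|b - c| < k.+1%:R^-1 / 2 ->
    `|a - c| < k.+1%:R^-1 :> R.
  move=> ab bc; rewrite (_ : a - c = (a - b) + (b - c)); last by ring.
  by rewrite (le_lt_trans (ler_normD _ _)) // [ltRHS]splitr ltrD.
rewrite /good /=; split.
- move=> i; rewrite !rat_vec_ins; case: (unliftP ord0 i) => [l|] ->.
    rewrite !insert_coord_lift; have [? ?] := Hpq l; split => //.
    exact: lt_trans hh.
  by rewrite !insert_coordE; split => //; exact: lt_trans hh.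
- by rewrite !rat_vec_ins ravg_ins //; exact: tri Hf0 Hf.
- by rewrite !rat_vec_ins ravg_ins //; exact: tri Hg0 Hg.
Qed.

End rect_differentiation.

Lemma mul_gt_near (R : realFieldType) (F G K : R) : K < F * G ->
  exists2 e, 0 < e & forall A B, `|A - F| < e -> `|B - G| < e -> K < A * B.
Proof.
move=> KFG; pose d := (`|F| + `|G| + 1) * 2.
have d0 : 0 < d by rewrite mulr_gt0 // ltr_wpDl // addr_ge0.
pose e := Num.min 1 ((F * G - K) / d).
have e0 : 0 < e by rewrite lt_min ltr01 divr_gt0 // subr_gt0.
exists e => // A B HA HB.
have e_1 : e <= 1 by rewrite /e ge_min lexx.
have e_2 : e * d <= F * G - K by rewrite -ler_pdivlMr // /e ge_min lexx orbT.
have : F * G - A * B <= `|A - F| * `|B| + `|F| * `|B - G|.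
  rewrite -!normrM; apply: (le_trans _ (ler_normD _ _)).
  rewrite -normrN; apply: (le_trans _ (ler_norm _)).
  by rewrite le_eqVlt; apply/orP; left; apply/eqP; ring.
have HB' : `|B| <= e + `|G|.
  rewrite -[B in `|B|](subrK G); apply: (le_trans (ler_normD _ _)).
  by rewrite lerD2r ltW.
have T1 : `|A - F| * `|B| <= e * (1 + `|G|).
  apply: ler_pM => //; first exact: ltW.
  by apply: le_trans HB' _; rewrite lerD2r.
have T2 : `|F| * `|B - G| <= `|F| * e by rewrite ler_wpM2l // ltW.
move: T1 T2 e_2 KFG; rewrite /d.
move: (`|A - F| * `|B|) (`|F| * `|B - G|) (A * B) (F * G) => c1 c2 c3 c4.
move: `|F| `|G| => f g; clear; move=> *; lra.
Qed.

Section differentiation_consequences.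
Context {R : realType}.
Local Notation X := (measurableTypeR R).
Local Notation mu1 := (@lebesgue_measure R).
Local Notation mu := (@lebesgue_rV R).

Definition strictly_inside m (a b p q : 'rV[R]_m) :=
  forall i, [/\ a ord0 i < p ord0 i, p ord0 i < q ord0 i & q ord0 i < b ord0 i].

Lemma strictly_inside_rect m (a b p q : 'rV[R]_m) :
  strictly_inside a b p q -> rect p q `<=` rect a b.
Proof.
move=> H x xpq i; have [? ? ?] := H i; have /andP[? ?] := xpq i.
by apply/andP; split; lra.
Qed.

Lemma ae_strict_rect m (a b : 'rV[R]_m) :
  {ae mu m, forall y, rect a b y -> forall i, a ord0 i < y ord0 i < b ord0 i}.
Proof.
have H (c : 'rV[R]_m) : {ae mu m, forall y : 'rV[R]_m, forall i, y ord0 i <> c ord0 i}.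
  apply: ae_countable => i; exists [set y : 'rV[R]_m | y ord0 i = c ord0 i]; split.
  - rewrite -[X in measurable X]setTI.
    exact: (measurable_coord i measurableT (measurable_set1 (c ord0 i))).
  - exact: lebesgue_rV_hyperplane.
  - by move=> y /= /contrapT.
move: (H a) (H b); apply: aeS2 => y Ha Hb yab i.
have /andP[] := yab i; rewrite !le_eqVlt => /orP[/eqP/esym/Ha //|->].
by move=> /orP[/eqP/Hb //|->].
Qed.

Lemma pos_family m (f : 'I_m -> R) : (forall i, 0 < f i) ->
  exists2 e, 0 < e & forall i, e <= f i.
Proof.
move=> f0; exists (\big[Num.min/1]_i f i); first by apply/lt_bigmin.
by move=> i; exact: bigmin_le_cond.
Qed.

Variables (m : nat) (a b : 'rV[R]_m).

Let near_inside (y : 'rV[R]_m) : (forall i, a ord0 i < y ord0 i < b ord0 i) ->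
  exists2 e, 0 < e & forall p q, rect_near y e p q -> strictly_inside a b p q.
Proof.
move=> yab.
have [e e0 He] := @pos_family m
  (fun i => Num.min (y ord0 i - a ord0 i) (b ord0 i - y ord0 i))
  (fun i => ltac:(by rewrite lt_min !subr_gt0; exact: yab)).
exists e => // p q Hpq i; have [/andP[? ?] ?] := Hpq i.
by have := He i; rewrite le_min => /andP[? ?]; split; lra.
Qed.

Let restr (F : 'rV[R]_m -> R) : (mu m).-integrable (rect a b) (EFin \o F) ->
  (mu m).-integrable setT (EFin \o (F \_ (rect a b))).
Proof.
move=> Fi; rewrite -restrict_EFin; apply: (integrable_mkcond _ _).1 => //.
exact: measurable_rect.
Qed.

Let ravg_restr F p q : strictly_inside a b p q ->
  ravg p q (F \_ (rect a b)) = ravg p q F.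
Proof.
move=> H; congr (_ * _); apply: eq_Rintegral => x /set_mem xpq.
by rewrite patchE mem_set //; exact: strictly_inside_rect H _ xpq.
Qed.

(** How a bound of A_2 type passes from rectangles to points: divide by the
    square of the volume and differentiate both factors along the same
    rectangles. *)
Lemma ae_mul_le_of_rect (F G : 'rV[R]_m -> R) (K : R) :
  (mu m).-integrable (rect a b) (EFin \o F) ->
  (mu m).-integrable (rect a b) (EFin \o G) ->
  (forall p q, strictly_inside a b p q ->
    (\int[mu m]_(x in rect p q) F x) * (\int[mu m]_(x in rect p q) G x) <=
    K * (\prod_i (q ord0 i - p ord0 i)) ^+ 2) ->
  {ae mu m, forall y, rect a b y -> F y * G y <= K}.
Proof.
move=> Fi Gi FG.
have FG' p q : strictly_inside a b p q -> ravg p q F * ravg p q G <= K.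
  move=> H; rewrite /ravg; set v := \prod_i _.
  have v0 : 0 < v by apply: prodr_gt0 => i _; rewrite subr_gt0; have [] := H i.
  rewrite mulrACA -expr2 exprVn mulrC ler_pdivrMr ?exprn_gt0 //.
  exact: FG.
have H1 := rect_differentiation (restr Fi) (restr Gi).
move: H1 (ae_strict_rect a b); apply: aeS2 => y Hy yab /[dup] yr /yab {}yab.
rewrite leNgt; apply/negP => /mul_gt_near[e0 e00 He0].
have [e1 e10 He1] := near_inside yab.
have [|p [q [Hpq]]] := Hy (Num.min e0 e1); first by rewrite lt_min e00.
have Hin : strictly_inside a b (rat_vec p) (rat_vec q).
  apply: He1 => i; have [? He] := Hpq i; split => //.
  by apply: lt_le_trans He _; rewrite ge_min lexx orbT.
rewrite !ravg_restr // !patchE mem_set // !lt_min => /andP[HA _] /andP[HB _].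
by have := FG' _ _ Hin; rewrite leNgt He0.
Qed.

Lemma ae_eq0_of_rect (F : 'rV[R]_m -> R) :
  (mu m).-integrable (rect a b) (EFin \o F) ->
  (forall p q, strictly_inside a b p q -> \int[mu m]_(x in rect p q) F x = 0) ->
  {ae mu m, forall y, rect a b y -> F y = 0}.
Proof.
move=> Fi F0.
have H1 := rect_differentiation (restr Fi) (restr Fi).
move: H1 (ae_strict_rect a b); apply: aeS2 => y Hy yab /[dup] yr /yab {}yab.
apply/eqP; rewrite -normr_le0; apply/ler_addgt0Pr => e e0; rewrite add0r.
have [e1 e10 He1] := near_inside yab.
have [|p [q [Hpq + _]]] := Hy (Num.min e e1); first by rewrite lt_min e0.
have Hin : strictly_inside a b (rat_vec p) (rat_vec q).
  apply: He1 => i; have [? He] := Hpq i; split => //.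
  by apply: lt_le_trans He _; rewrite ge_min lexx orbT.
rewrite ravg_restr // patchE mem_set // /ravg F0 // mulr0 sub0r normrN.
by rewrite lt_min => /andP[/ltW].
Qed.

End differentiation_consequences.

(** * Weighted Cauchy-Schwarz and averages *)

Section toolkit.
Context d (T : measurableType d) (R : realType) (m : {measure set T -> \bar R}).
Local Open Scope ereal_scope.

(** For [x >= 0], zero included, [x^-1] is the real power of [x] with exponent
    [-1]. *)
Lemma measurable_funV (D : set T) (f : T -> R) : (forall x, 0 <= f x)%R ->
  measurable_fun D f -> measurable_fun D (fun x => (f x)^-1%R).
Proof.
move=> f0 mf; rewrite (_ : (fun x => _) = (fun x => f x `^ (-1))%R).
  by apply: (measurableT_comp (measurable_powR (-1)%R)).
by apply/funext => x; rewrite powR_inv1.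
Qed.

Lemma ge0_integral_eq0_ae (D : set T) (f : T -> \bar R) : measurable D ->
  measurable_fun D f -> (forall x, D x -> 0 <= f x) ->
  \int[m]_(x in D) f x = 0 -> {ae m, forall x, D x -> f x = 0}.
Proof.
move=> mD mf f0 I0; apply: ((ae_eq_integral_abs m mD mf).1 _).
by rewrite -[RHS]I0; apply: eq_integral => x /set_mem Dx; rewrite gee0_abs // f0.
Qed.

Lemma integral_gt0 (D : set T) (f : T -> \bar R) : measurable D ->
  measurable_fun D f -> (forall x, D x -> 0 <= f x) ->
  {ae m, forall x, D x -> 0 < f x} -> m D != 0 -> 0 < \int[m]_(x in D) f x.
Proof.
move=> mD mf f0 fpos D0; rewrite lt0e integral_ge0 // andbT.
apply: contra_neqN D0 => /eqP/(ge0_integral_eq0_ae mD mf f0) H.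
have {fpos}H : {ae m, forall x, ~ D x}.
  move: H fpos; apply: aeS2 => x H1 H2 Dx.
  by have := H2 Dx; rewrite H1 // ltxx.
apply/(negligibleP m mD); apply: negligibleS H => x Dx /=; exact.
Qed.

Variables (D : set T) (f W : T -> R).
Hypotheses (mD : measurable D) (mf : measurable_fun D f) (mW : measurable_fun D W).
Hypotheses (W0 : forall x, (0 <= W x)%R) (Wpos : {ae m, forall x, D x -> (0 < W x)%R}).

(** Integrate [2 * |f| <= l * f^2 * W + (l * W)^-1] and optimize in [l]: this
    needs no square root and makes sense for infinite integrals. *)
Lemma cauchy_schwarz_weight (s : R) : (0 < s)%R ->
  \int[m]_(x in D) ((W x)^-1)%:E = s%:E ->
  (\int[m]_(x in D) `|f x|%:E) * (\int[m]_(x in D) `|f x|%:E) <=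
  (\int[m]_(x in D) (f x ^+ 2 * W x)%:E) * s%:E.
Proof.
move=> s0 Ws.
have mf2 : measurable_fun D (fun x => (f x ^+ 2 * W x)%:E).
  apply/measurable_EFinP; apply: measurable_funM => //; exact: measurable_funX.
have mV : measurable_fun D (fun x => ((W x)^-1)%:E).
  by apply/measurable_EFinP; exact: measurable_funV.
have f20 x : 0 <= (f x ^+ 2 * W x)%:E by rewrite lee_fin mulr_ge0 // sqr_ge0.
have V0 x : 0 <= ((W x)^-1)%:E by rewrite lee_fin invr_ge0.
have key (l : R) : (0 < l)%R ->
    \int[m]_(x in D) `|f x|%:E <=
    (l / 2)%:E * (\int[m]_(x in D) (f x ^+ 2 * W x)%:E) + (l^-1 / 2)%:E * s%:E.
  move=> l0; rewrite -Ws -!ge0_integralZl_EFin //; last 2 first.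
  - by rewrite divr_ge0 // invr_ge0 ltW.
  - by rewrite divr_ge0 // ltW.
  rewrite -ge0_integralD //; last 4 first.
  - by move=> x _; rewrite mule_ge0 // lee_fin divr_ge0 // ltW.
  - exact: measurable_funeM.
  - by move=> x _; rewrite mule_ge0 // lee_fin divr_ge0 // invr_ge0 ltW.
  - exact: measurable_funeM.
  apply: ae_ge0_le_integral => //.
  - by apply/measurable_EFinP; exact: measurableT_comp.
  - move=> x _; rewrite adde_ge0 // mule_ge0 // lee_fin divr_ge0 //.
    + exact: ltW.
    + by rewrite invr_ge0 ltW.
  - by apply: emeasurable_funD; exact: measurable_funeM.
  move: Wpos; apply: aeS => x Wx Dx; have {}Wx := Wx Dx.
  rewrite -!EFinM -EFinD lee_fin.
  have lw : (0 < l * W x)%R by rewrite mulr_gt0.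
  have -> : (l / 2 * (f x ^+ 2 * W x) + l^-1 / 2 * (W x)^-1 =
     (`|f x| ^+ 2 * (l * W x) ^+ 2 + 1) / (2 * (l * W x)))%R.
    by rewrite real_normK ?num_real //; field; rewrite !gt_eqF.
  rewrite ler_pdivlMr ?mulr_gt0 // -subr_ge0.
  by have := sqr_ge0 (`|f x| * (l * W x) - 1)%R; nra.
have I0 : 0 <= \int[m]_(x in D) `|f x|%:E by apply: integral_ge0 => x _; rewrite lee_fin.
have Q0 : 0 <= \int[m]_(x in D) (f x ^+ 2 * W x)%:E by apply: integral_ge0.
move: key I0 Q0.
case: (\int[m]_(x in D) (f x ^+ 2 * W x)%:E) => [q| |//]; last first.
  by move=> _ _ _; rewrite mulyr gtr0_sg // mul1e leey.
case: (\int[m]_(x in D) `|f x|%:E) => [i| |//] key; last first.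
  by have := key 1%R ltr01; rewrite -!EFinM -EFinD leye_eq.
rewrite !lee_fin => i0 q0.
have {}key (l : R) : (0 < l)%R -> (2 * l * i <= l ^+ 2 * q + s)%R.
  move=> l0; have := key l l0; rewrite -!EFinM -EFinD lee_fin.
  rewrite -(ler_pM2l (mulr_gt0 (ltr0n _ 2) l0)).
  set x := (X in (_ <= X)%R -> _); suff -> : x = (l ^+ 2 * q + s)%R by [].
  by rewrite /x; field; rewrite gt_eqF.
have [i00|ipos] := leP i 0%R.
  have -> : i = 0%R by apply/eqP; rewrite eq_le i00.
  by rewrite mul0r mulr_ge0 // ltW.
(* the minimizer in [l] when the inequality to be proved is an equality *)
have := key (s / i)%R (divr_gt0 s0 ipos).
have -> : (2 * (s / i) * i = 2 * s)%R by field; rewrite gt_eqF.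
rewrite expr_div_n => H; have {}H : (s <= s ^+ 2 / i ^+ 2 * q)%R by lra.
have i2 : (0 < i ^+ 2)%R by rewrite exprn_gt0.
move: H; rewrite mulrAC ler_pdivlMr // => H.
by rewrite -(ler_pM2l s0); lra.
Qed.

(** By Cauchy-Schwarz the average of [f] is at most its norm in L^2(W) times
    the square root of the integral of [W^-1], divided by [v]; A_2 is exactly
    what compensates for the integral of [W]. *)
Lemma average_bound (v o s A : R) : (0 < v)%R -> (0 < s)%R ->
  \int[m]_(x in D) (W x)%:E = o%:E ->
  \int[m]_(x in D) ((W x)^-1)%:E = s%:E -> (o * s <= A * v ^+ 2)%R ->
  \int[m]_(x in D) (((\int[m]_(y in D) f y)%R / v) ^+ 2 * W x)%:E <=
  A%:E * \int[m]_(x in D) (f x ^+ 2 * W x)%:E.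
Proof.
move=> v0 s0 Wo Ws osA.
have CS := cauchy_schwarz_weight s0 Ws.
under eq_integral do rewrite EFinM.
rewrite ge0_integralZl_EFin ?sqr_ge0 //; last 2 first.
- by move=> x _; rewrite lee_fin.
- exact/measurable_EFinP.
rewrite Wo -EFinM.
have o0 : (0 <= o)%R by rewrite -lee_fin -Wo; apply: integral_ge0 => x _; rewrite lee_fin.
have Q0 : 0 <= \int[m]_(x in D) (f x ^+ 2 * W x)%:E.
  by apply: integral_ge0 => x _; rewrite lee_fin mulr_ge0 // sqr_ge0.
have A0 : (0 <= A)%R.
  have : (0 <= A * v ^+ 2)%R by apply: le_trans osA; rewrite mulr_ge0 // ltW.
  by rewrite pmulr_lge0 // exprn_gt0.
have I0 : 0 <= \int[m]_(x in D) `|f x|%:E by apply: integral_ge0 => x _; rewrite lee_fin.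
have le_fine : `|(\int[m]_(y in D) f y)%R|%:E <= \int[m]_(x in D) `|f x|%:E.
  have le1 : `|\int[m]_(x in D) (f x)%:E| <= \int[m]_(x in D) `|f x|%:E.
    by apply: le_abse_integral => //; exact/measurable_EFinP.
  apply: le_trans le1; rewrite /Rintegral.
  by case: (\int[m]_(x in D) (f x)%:E) => //=; rewrite normr0 leey.
move: CS Q0 I0 le_fine.
case: (\int[m]_(x in D) (f x ^+ 2 * W x)%:E) => [q| |//]; last first.
  move=> _ _ _ _; move: A0; rewrite le_eqVlt => /orP[/eqP A0|A0]; last first.
    by rewrite mulry gtr0_sg // mul1e leey.
  have -> : o = 0%R.
    apply/eqP; rewrite eq_le o0 andbT -(pmulr_lle0 _ s0).
    by rewrite (le_trans osA) // -A0 mul0r.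
  by rewrite mulr0 -A0 mul0e.
case: (\int[m]_(x in D) `|f x|%:E) => [i| |//]; last first.
  by rewrite mulyy -EFinM leye_eq.
rewrite -!EFinM !lee_fin; set r := (\int[m]_(y in D) f y)%R.
move=> iq q0 i0 ri.
have r2 : (r ^+ 2 <= q * s)%R.
  by rewrite -real_normK ?num_real // (le_trans _ iq) // expr2 ler_pM.
rewrite expr_div_n mulrAC ler_pdivrMr ?exprn_gt0 //.
apply: (@le_trans _ _ (q * s * o)%R); first by rewrite ler_wpM2r.
have -> : (q * s * o = o * s * q)%R by ring.
have -> : (A * q * v ^+ 2 = A * v ^+ 2 * q)%R by ring.
by rewrite ler_wpM2r.
Qed.

End toolkit.

(** * Strong A_2 weights *)

Section weight.
Context {R : realType} {n : nat}.
Local Notation X := (measurableTypeR R).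
Local Notation mu := (@lebesgue_rV R).
Local Open Scope ereal_scope.

Implicit Types a b : 'rV[R]_n.

Lemma compact_rect (a b : 'rV[R]_n) : compact (rect a b).
Proof.
rewrite (_ : rect a b =
    [set v : 'rV[R]_n | forall i, `[a ord0 i, b ord0 i]%classic (v ord0 i)]).
  apply: (rV_compact (A := fun i => `[a ord0 i, b ord0 i]%classic)) => i.
  exact: segment_compact.
by apply/seteqP; split => v H i; have := H i; rewrite /= in_itv.
Qed.

Lemma cover_rect (P : 'rV[R]_n -> Prop) :
  (forall k : nat, {ae mu n, forall x,
     rect (const_mx (- k.+1%:R)%R) (const_mx k.+1%:R) x -> P x}) ->
  {ae mu n, forall x, P x}.
Proof.
move=> H; have : {ae mu n, forall x, forall k : nat,
     rect (const_mx (- k.+1%:R)%R) (const_mx k.+1%:R) x -> P x}.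
  exact: ae_countable.
apply: aeS => x Hx.
have : [set: 'rV[R]_n] x by [].
rewrite -(cover_box (R := R) n) => -[k _ /= Hk]; apply: (Hx k) => i.
have := Hk i; rewrite !mxE /= in_itv /= => /andP[H1 H2].
have kk : (k%:R <= k.+1%:R :> R)%R by rewrite ler_nat.
by apply/andP; split; [apply: le_trans H1; rewrite lerN2|exact: le_trans kk].
Qed.

Definition volume (a b : 'rV[R]_n) : R := (\prod_i (b ord0 i - a ord0 i))%R.

Lemma volume_gt0 a b : (forall i, a ord0 i < b ord0 i)%R -> (0 < volume a b)%R.
Proof. by move=> ab; apply: prodr_gt0 => i _; rewrite subr_gt0. Qed.

Lemma rect_measureE a b : (forall i, a ord0 i < b ord0 i)%R ->
  mu n (rect a b) = (volume a b)%:E.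
Proof. by move=> ab; rewrite lebesgue_rV_rect // => i; exact: ltW. Qed.

Variable w : 'rV[R]_n -> R.
Hypothesis hw : strong_A2 w.

Lemma weight_ge0 x : (0 <= w x)%R. Proof. by case: hw. Qed.

Lemma measurable_weight : measurable_fun setT w.
Proof. by case: hw => _ []. Qed.

Definition A2const : R := fine (strong_A2_const w).

Let mw D : measurable D -> measurable_fun D (fun x => (w x)%:E).
Proof.
by move=> mD; apply/measurable_EFinP; exact: measurable_funTS measurable_weight.
Qed.

Lemma integrable_weight a b : (mu n).-integrable (rect a b) (EFin \o w).
Proof.
have mr := @measurable_rect R n a b.
apply/integrableP; split; first exact: mw.
case: hw => _ [_ /(_ (rect a b))] H _ _.
by apply: H => //; exact: compact_rect.
Qed.

Let avg_le a b : (forall i, a ord0 i < b ord0 i)%R ->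
  (\int[mu n]_(x in rect a b) (w x)%:E) *
  (\int[mu n]_(x in rect a b) (w x)%:E^-1) <=
  (A2const * volume a b ^+ 2)%:E.
Proof.
move=> ab; have v0 := volume_gt0 ab.
case: hw => _ _ _ hA.
have : rect_average a b (EFin \o w) * rect_average a b (fun x => (w x)%:E^-1) <=
    strong_A2_const w.
  by apply: ereal_sup_ubound; exists (a, b).
rewrite /rect_average rect_measureE // inver gt_eqF //.
set I := \int[mu n]_(x in _) _; set J := \int[mu n]_(x in _) _ => H.
have I0 : 0 <= I by apply: integral_ge0 => x _; rewrite lee_fin weight_ge0.
have J0 : 0 <= J by apply: integral_ge0 => x _; rewrite inve_ge0 lee_fin weight_ge0.
have V0 : 0 <= (volume a b)^-1%:E by rewrite lee_fin invr_ge0 ltW.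
have Afin : strong_A2_const w \is a fin_num.
  rewrite ge0_fin_numE //; apply: le_trans H.
  by rewrite !mule_ge0.
have -> : I * J = I * (volume a b)^-1%:E * (J * (volume a b)^-1%:E) *
    (volume a b ^+ 2)%:E.
  rewrite muleACA -[RHS]muleA -!EFinM.
  rewrite (_ : ((volume a b)^-1 * (volume a b)^-1 * volume a b ^+ 2)%R = 1%R) ?mule1 //.
  by field; rewrite gt_eqF.
rewrite [leRHS]EFinM /A2const fineK // lee_pmul2r //.
by rewrite lte_fin exprn_gt0.
Qed.

Lemma A2const_ge0 : (0 <= A2const)%R.
Proof.
apply: fine_ge0; apply: le_trans (ereal_sup_ubound _); last first.
  exists (const_mx 0%R, const_mx 1%R) => //= i; rewrite !mxE; exact: ltr01.
rewrite /rect_average rect_measureE; last by move=> i; rewrite !mxE ltr01.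
rewrite inver gt_eqF; last by apply: volume_gt0 => i; rewrite !mxE ltr01.
rewrite !mule_ge0 //; try by rewrite lee_fin invr_ge0 ltW // volume_gt0 // => i; rewrite !mxE ltr01.
  by apply: integral_ge0 => x _; rewrite lee_fin weight_ge0.
by apply: integral_ge0 => x _; rewrite inve_ge0 lee_fin weight_ge0.
Qed.

Let N : set 'rV[R]_n := [set x | w x = 0%R].

Let mN : measurable N.
Proof.
rewrite -[X in measurable X]setTI.
exact: (measurable_weight measurableT (measurable_set1 0%R)).
Qed.

Let invE x : (w x)%:E^-1 = if x \in N then +oo else ((w x)^-1)%:E.
Proof.
rewrite inver; congr (if _ then _ else _); apply/eqP/idP; rewrite inE //.
Qed.

Let minv D : measurable D -> measurable_fun D (fun x => (w x)%:E^-1).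
Proof.
move=> mD; apply: measurable_funTS.
rewrite (_ : (fun x => _) = (fun x => if x \in N then +oo else ((w x)^-1)%:E)); last first.
  by apply/funext => x; exact: invE.
apply: measurable_fun_ifT => //.
  by apply: (measurable_fun_bool true); rewrite setTI; rewrite (_ : _ @^-1` _ = N) //;
     apply/seteqP; split => x; [exact: set_mem|exact: mem_set].
apply/measurable_EFinP; apply: measurable_funV; [exact: weight_ge0|exact: measurable_weight].
Qed.

(** If [w] vanished on a set of positive measure, the average of [w^-1] over
    each large rectangle would be infinite. As the product of the two averages
    is finite, [w] would have average zero on all these rectangles, so it
    would vanish almost everywhere. *)
Lemma weight_gt0 : {ae mu n, forall x, (0 < w x)%R}.
Proof.
suff : {ae mu n, forall x, ~ N x}.
  by apply: aeS => x Nx; rewrite lt_neqAle weight_ge0 andbT eq_sym; apply/eqP.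
pose r k := rect (const_mx (- k.+1%:R)%R) (const_mx k.+1%:R) : set 'rV[R]_n.
have rlt k : (forall i : 'I_n, (const_mx (- k.+1%:R) : 'rV[R]_n) ord0 i <
    (const_mx k.+1%:R : 'rV[R]_n) ord0 i)%R.
  by move=> i; rewrite !mxE; have : (0 < k.+1%:R :> R)%R by []; lra.
have mr k : measurable (r k) by exact: measurable_rect.
apply: cover_rect => k; apply: contrapT => Hk.
have Nk : mu n (N `&` r k) != 0.
  apply/eqP => H0; apply: Hk; exists (N `&` r k); split => //.
    exact: measurableI.
  by move=> x /= /not_implyP[? /contrapT].
case: hw => _ _ + _; apply; apply: cover_rect => l.
pose K := maxn k l.
have rkK : r k `<=` r K.
  move=> x Hx i; have := Hx i; rewrite !mxE => /andP[H1 H2].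
  have kk : (k.+1%:R <= K.+1%:R :> R)%R by rewrite ler_nat ltnS leq_maxl.
  by apply/andP; split; [apply: le_trans H1; rewrite lerN2|exact: le_trans kk].
have rlK : r l `<=` r K.
  move=> x Hx i; have := Hx i; rewrite !mxE => /andP[H1 H2].
  have kk : (l.+1%:R <= K.+1%:R :> R)%R by rewrite ler_nat ltnS leq_maxr.
  by apply/andP; split; [apply: le_trans H1; rewrite lerN2|exact: le_trans kk].
have J : \int[mu n]_(x in r K) (w x)%:E^-1 = +oo.
  apply/eqP; rewrite -leye_eq.
  apply: (@le_trans _ _ (\int[mu n]_(x in N `&` r k) (w x)%:E^-1)).
    rewrite (eq_integral (cst +oo)); last first.
      by move=> x /set_mem[Nx _]; rewrite invE mem_set.
    by rewrite integral_cst ?mulyr //; [rewrite gt0_mulye // lt0e Nk measure_ge0|exact: measurableI].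
  apply: ge0_subset_integral => //.
  - exact: measurableI.
  - exact: minv.
  - by move=> x _; rewrite inve_ge0 lee_fin weight_ge0.
  - by move=> x [_ /rkK].
have := avg_le (rlt K); rewrite -/(r K) J => H.
have I0 : \int[mu n]_(x in r K) (w x)%:E = 0.
  apply/eqP/negPn/negP => I0; move: H; rewrite gt0_muley.
    by rewrite leye_eq.
  by rewrite lt0e I0 integral_ge0 // => x _; rewrite lee_fin weight_ge0.
have := ge0_integral_eq0_ae (mr K) (mw (mr K)) (fun x _ => _) I0.
move=> /(_ (fun x => ltac:(by rewrite lee_fin weight_ge0))).
by apply: aeS => x Hx /rlK/Hx [].
Qed.

Lemma measurable_weightV : measurable_fun setT (fun x => (w x)^-1%R).
Proof. apply: measurable_funV; [exact: weight_ge0|exact: measurable_weight]. Qed.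

(** The A_2 condition with the inverse taken in the real numbers: it differs
    from the extended one only where [w = 0], a null set. The integral of [w]
    being positive, that of [w^-1] is finite. *)
Lemma A2_rect a b : (forall i, a ord0 i < b ord0 i)%R ->
  (mu n).-integrable (rect a b) (fun x => ((w x)^-1)%:E) /\
  ((\int[mu n]_(x in rect a b) w x) * (\int[mu n]_(x in rect a b) (w x)^-1) <=
   A2const * volume a b ^+ 2)%R.
Proof.
move=> ab.
have mr := @measurable_rect R n a b.
have mV : measurable_fun (rect a b) (fun x => ((w x)^-1)%:E).
  by apply/measurable_EFinP; exact: measurable_funTS measurable_weightV.
have E : \int[mu n]_(x in rect a b) (w x)%:E^-1 =
    \int[mu n]_(x in rect a b) ((w x)^-1)%:E.
  apply: ae_eq_integral => //; first exact: minv.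
  by move: weight_gt0; apply: aeS => x Wx _; rewrite inver gt_eqF.
have := avg_le ab; rewrite E.
have Ifin : \int[mu n]_(x in rect a b) (w x)%:E \is a fin_num.
  exact: (integrable_fin_num mr (integrable_weight a b)).
have Ipos : 0 < \int[mu n]_(x in rect a b) (w x)%:E.
  apply: integral_gt0 => //.
  - exact: mw.
  - by move=> x _; rewrite lee_fin weight_ge0.
  - by move: weight_gt0; apply: aeS => x; rewrite lte_fin.
  - apply/eqP => H0; have := rect_measureE ab; rewrite [LHS]H0 => -[v0].
    by have := volume_gt0 ab; rewrite -v0 ltxx.
have J0 : 0 <= \int[mu n]_(x in rect a b) ((w x)^-1)%:E.
  by apply: integral_ge0 => x _; rewrite lee_fin invr_ge0 weight_ge0.
rewrite /Rintegral.
move: Ifin Ipos; case: (\int[mu n]_(x in rect a b) (w x)%:E) => // p _ p0 H.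
have Jfin : \int[mu n]_(x in rect a b) ((w x)^-1)%:E \is a fin_num.
  rewrite ge0_fin_numE // ltey; apply/negP => /eqP JE.
  by move: H; rewrite JE gt0_muley // leye_eq.
split.
  apply/integrableP; split => //; rewrite -ge0_fin_numE; last exact: integral_ge0.
  rewrite (eq_integral (fun x => ((w x)^-1)%:E)) // => x _.
  by rewrite gee0_abs // lee_fin invr_ge0 weight_ge0.
by move: H; rewrite -(fineK Jfin) -EFinM lee_fin.
Qed.

End weight.

(** * The A_2 condition on lines and slices *)

Section Rfubini_rect_coord.
Context {R : realType}.
Local Notation X := (measurableTypeR R).
Local Notation mu1 := (@lebesgue_measure R).
Local Notation mu := (@lebesgue_rV R).
Variables (m : nat) (j : 'I_m.+1) (f : 'rV[R]_m.+1 -> R) (a b : 'rV[R]_m.+1).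
Hypothesis fi : (mu m.+1).-integrable (rect a b) (EFin \o f).

Let fi0 : (mu m.+1).-integrable setT (EFin \o (f \_ (rect a b))).
Proof.
rewrite -restrict_EFin; apply: (integrable_mkcond _ _).1 => //.
exact: measurable_rect.
Qed.

Let coord_patch y : rect (col' j a) (col' j b) y ->
  \int[mu1]_t (f \_ (rect a b)) (insert_coord j t y) =
  \int[mu1]_(t in `[a ord0 j, b ord0 j]) f (insert_coord j t y).
Proof.
move=> yI; rewrite [RHS]Rintegral_mkcond; apply: eq_Rintegral => t _.
by rewrite /patch; congr (if _ then _ else _); apply/idP/idP;
   rewrite !inE rect_insE; tauto.
Qed.

Lemma Rfubini_rect_coord : \int[mu m.+1]_(x in rect a b) f x =
  \int[mu m]_(y in rect (col' j a) (col' j b))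
     \int[mu1]_(t in `[a ord0 j, b ord0 j]) f (insert_coord j t y).
Proof.
rewrite Rintegral_mkcond (Rfubini_coord j) // [RHS]Rintegral_mkcond.
apply: eq_Rintegral => y _; rewrite patchE; case: ifPn => [/set_mem yI|yI].
  exact: coord_patch.
rewrite (_ : (fun t => _) = cst 0) ?Rintegral_cst ?mul0r //.
apply/funext => t; rewrite patchE; case: ifPn => // /set_mem/rect_insE[_ Hy].
by case/negP: yI; rewrite inE.
Qed.

Lemma integrable_rect_coord : (mu m).-integrable (rect (col' j a) (col' j b))
  (fun y => (\int[mu1]_(t in `[a ord0 j, b ord0 j]) f (insert_coord j t y))%:E).
Proof.
have mF := measurable_rect (col' j a) (col' j b).
have H := integrable_fine measurableT (integrable_coord j fi0).
have /(eq_integrable mF) : {in rect (col' j a) (col' j b), (fun y =>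
   (\int[mu1]_t (f \_ (rect a b)) (insert_coord j t y))%:E) =1 (fun y =>
   (\int[mu1]_(t in `[a ord0 j, b ord0 j]) f (insert_coord j t y))%:E)}.
  by move=> y /set_mem yI; rewrite coord_patch.
by apply; exact: integrableS H.
Qed.

Lemma ae_integrable_rect_coord : {ae mu m, forall y,
  rect (col' j a) (col' j b) y -> mu1.-integrable `[a ord0 j, b ord0 j]
    (fun t => (f (insert_coord j t y))%:E)}.
Proof.
have := ae_integrable_coord j fi0; apply: aeS => y H yF.
have mI : measurable (`[a ord0 j, b ord0 j] : set X) by exact: measurable_itv.
apply: (integrable_mkcond _ mI).2.
apply: eq_integrable H => // t _; rewrite /patch.
have -> : (insert_coord j t y \in rect a b) = (t \in `[a ord0 j, b ord0 j]%classic).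
  by apply/idP/idP; rewrite !inE rect_insE; tauto.
by case: ifP.
Qed.

Lemma ae_integrable_rect_slice : {ae mu1, forall t : X,
  `[a ord0 j, b ord0 j]%classic t -> (mu m).-integrable (rect (col' j a) (col' j b))
    (fun y => (f (insert_coord j t y))%:E)}.
Proof.
have := ae_integrable_slice j fi0; apply: aeS => t H tI.
have mF := measurable_rect (col' j a) (col' j b).
apply: (integrable_mkcond _ mF).2.
apply: eq_integrable H => // y _; rewrite /patch.
have -> : (insert_coord j t y \in rect a b) = (y \in rect (col' j a) (col' j b)).
  by apply/idP/idP; rewrite !inE rect_insE; tauto.
by case: ifP.
Qed.

End Rfubini_rect_coord.

Section A2_lines.
Context {R : realType}.
Local Notation X := (measurableTypeR R).
Local Notation mu1 := (@lebesgue_measure R).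
Local Notation mu := (@lebesgue_rV R).

(** The analogue of [ae_mul_le_of_rect] on the real line itself. *)
Lemma ae_mul_le_of_itv (a b : R) (F G : R -> R) (K : R) :
  mu1.-integrable `[a, b] (EFin \o F) -> mu1.-integrable `[a, b] (EFin \o G) ->
  (forall p q, a < p -> p < q -> q < b ->
    (\int[mu1]_(x in `[p, q]) F x) * (\int[mu1]_(x in `[p, q]) G x) <=
    K * (q - p) ^+ 2) ->
  {ae mu1, forall t : X, `[a, b]%classic t -> F t * G t <= K}.
Proof.
move=> Fi Gi FG.
have restr (H : R -> R) : mu1.-integrable `[a, b] (EFin \o H) ->
    mu1.-integrable setT (EFin \o (H \_ `[a, b])).
  have mI : measurable (`[a, b] : set X) by exact: measurable_itv.
  by move=> Hi; rewrite -restrict_EFin; apply: (integrable_mkcond _ mI).1.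
have ne (c : R) : {ae mu1, forall t : X, t <> c}.
  exists [set c]; split => //; last by move=> t /= /contrapT.
  exact: lebesgue_measure_set1.
have := aeS2 (fun t H1 H2 => conj H1 H2) (ne a) (ne b).
apply: aeS2 (ae_lebesgue_pt_itv (restr _ Fi) (restr _ Gi)) => t Ht [ta tb] tI.
have /andP[at_ tb_] : a < t < b.
  move: tI; rewrite /= in_itv /= !le_eqVlt => /andP[/orP[/eqP/esym/ta //|->]].
  by move=> /orP[/eqP/tb //|->].
rewrite leNgt; apply/negP => /mul_gt_near[e e0 He].
have [|p [q [/andP[pt tq] Hpq]]] := Ht (Num.min e (Num.min (t - a) (b - t))).
  by rewrite !lt_min e0 !subr_gt0 at_.
move: Hpq; rewrite !lt_min => /and3P[_ h1 h2].
have ap : a < ratr p by lra.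
have qb : ratr q < b by lra.
have pq : (ratr p : R) < ratr q by lra.
have E H : \int[mu1]_(s in `[ratr p, ratr q]) (H \_ `[a, b]) s =
    \int[mu1]_(s in `[ratr p, ratr q]) H s.
  apply: eq_Rintegral => s /set_mem; rewrite /= in_itv /= => /andP[s1 s2].
  by rewrite patchE mem_set //= in_itv /=; apply/andP; split; lra.
rewrite !E !patchE mem_set // => /andP[HA _] /andP[HB _].
have := FG _ _ ap pq qb.
have := He _ _ HA HB; rewrite mulrACA -expr2 exprVn mulrC ltr_pdivlMr.
  by move=> /lt_le_trans H /H; rewrite ltxx.
by rewrite exprn_gt0 // subr_gt0.
Qed.

Variables (m : nat) (w : 'rV[R]_m.+1 -> R).
Hypothesis hw : strong_A2 w.
Variable j : 'I_m.+1.

Lemma volume_ins (s t : R) (p q : 'rV[R]_m) :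
  volume (@insert_coord R m.+1 j s p) (@insert_coord R m.+1 j t q) =
  (t - s) * volume p q.
Proof.
rewrite /volume (bigD1_ord j) //= !insert_coordE; congr (_ * _).
by apply: eq_bigr => k _; rewrite !insert_coord_lift.
Qed.

Lemma insert_coord_lt (s t : R) (p q : 'rV[R]_m) : s < t ->
  (forall i, p ord0 i < q ord0 i) ->
  forall i, @insert_coord R m.+1 j s p ord0 i < @insert_coord R m.+1 j t q ord0 i.
Proof.
move=> st pq i; case: (unliftP j i) => [k|] ->; first by rewrite !insert_coord_lift.
by rewrite !insert_coordE.
Qed.

(** The A_2 condition on the product of [[s, t]] with a rectangle compares the
    integrals over this rectangle of the line integrals of [w] and [w^-1] with
    the square of its volume; let it shrink to [y]. *)
Lemma A2_line (a b : 'rV[R]_m) (s t : R) : (forall i, a ord0 i < b ord0 i) -> s < t ->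
  {ae mu m, forall y, rect a b y ->
    (\int[mu1]_(r in `[s, t]) w (insert_coord j r y)) *
    (\int[mu1]_(r in `[s, t]) (w (insert_coord j r y))^-1) <=
    A2const w * (t - s) ^+ 2}.
Proof.
move=> ab st.
have intw p q := integrable_weight hw (insert_coord j s p) (insert_coord j t q).
have HA2 (p q : 'rV[R]_m) (pq : forall i, p ord0 i < q ord0 i) :=
  A2_rect hw (insert_coord_lt st pq).
have Fi := integrable_rect_coord j (intw a b).
have Gi := integrable_rect_coord j (f := fun x => (w x)^-1) (HA2 _ _ ab).1.
rewrite !insert_coordE !col'_insert_coord in Fi Gi.
apply: (ae_mul_le_of_rect Fi Gi) => p q Hpq.
have pq i : p ord0 i < q ord0 i by have [] := Hpq i.
have [Vi] := HA2 _ _ pq.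
rewrite (Rfubini_rect_coord j (intw p q)).
rewrite (Rfubini_rect_coord j (f := fun x => (w x)^-1) Vi).
by rewrite !insert_coordE !col'_insert_coord volume_ins exprMn mulrA.
Qed.

(** The same argument for the product of [[a, b]] with an interval that
    shrinks to [r]. *)
Lemma A2_slice (a b : 'rV[R]_m) (s t : R) : (forall i, a ord0 i < b ord0 i) -> s < t ->
  {ae mu1, forall r : X, `[s, t]%classic r ->
    (\int[mu m]_(y in rect a b) w (insert_coord j r y)) *
    (\int[mu m]_(y in rect a b) (w (insert_coord j r y))^-1) <=
    A2const w * volume a b ^+ 2}.
Proof.
move=> ab st.
have intw p q := integrable_weight hw (insert_coord j p a) (insert_coord j q b).
have HA2 (p q : R) (pq : p < q) := A2_rect hw (insert_coord_lt pq ab).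
have Fi := integrable_rect_slice j (intw s t).
have Gi := integrable_rect_slice j (f := fun x => (w x)^-1) (HA2 _ _ st).1.
rewrite !insert_coordE !col'_insert_coord in Fi Gi.
apply: (ae_mul_le_of_itv Fi Gi) => p q _ pq _.
have [Vi] := HA2 _ _ pq.
rewrite (Rfubini_rect_slice j (intw p q)).
rewrite (Rfubini_rect_slice j (f := fun x => (w x)^-1) Vi).
by rewrite !insert_coordE !col'_insert_coord volume_ins exprMn mulrA mulrAC.
Qed.

End A2_lines.

(** * A Hardy inequality along a chain of sets *)

(** Hardy's inequality for weights that decay at the rate [1 - K^-1]. *)
Lemma discrete_hardy (R : realFieldType) (K : R) (w a F : nat -> R) : 1 <= K ->
  (forall k, 0 <= w k) -> (forall k, 0 <= F k) ->
  (forall k, K * w k.+1 <= (K - 1) * w k) ->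
  (forall k, a k ^+ 2 * w k <= K * F k) ->
  forall n, \sum_(l < n) w l * (\sum_(k < l.+1) a k) ^+ 2 <=
            4 * K ^+ 3 * \sum_(l < n) F l.
Proof.
move=> K1 w0 F0 hw ha n.
pose S l := \sum_(k < l.+1) a k.
have K0 : 0 <= K by apply: le_trans K1.
have step l : (2 * K - 1) * (a l ^+ 2 * w l) * (2 * K) <= 4 * K ^+ 3 * F l.
  have H1 : (2 * K - 1) * (a l ^+ 2 * w l) <= 2 * K * (K * F l).
    apply: ler_pM; [lra| by rewrite mulr_ge0 // sqr_ge0 |lra|exact: ha].
  have -> : 4 * K ^+ 3 * F l = (2 * K * (K * F l)) * (2 * K) by ring.
  by rewrite ler_wpM2r // mulr_ge0.
case: n => [|n]; first by rewrite !big_ord0 mulr0.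
(* the extra term pays for the cross term of [S n.+1 ^+ 2] in the induction *)
suff H : \sum_(l < n.+1) w l * S l ^+ 2 + (2 * K - 2) * (w n * S n ^+ 2) <=
    4 * K ^+ 3 * \sum_(l < n.+1) F l.
  apply: le_trans H; rewrite lerDl mulr_ge0 //; first lra.
  by rewrite mulr_ge0 // sqr_ge0.
elim: n => [|n IH].
  rewrite !big_ord1 /S big_ord1.
  have := step 0%N; have := F0 0%N; have : 0 <= a 0%N ^+ 2 * w 0%N.
    by rewrite mulr_ge0 // sqr_ge0.
  move=> c0 _; apply: le_trans.
  have -> : w 0%N * a 0%N ^+ 2 + (2 * K - 2) * (w 0%N * a 0%N ^+ 2) =
    (2 * K - 1) * (a 0%N ^+ 2 * w 0%N) by ring.
  by apply: ler_peMr; [apply: mulr_ge0 => //; lra|lra].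
rewrite big_ord_recr /= [X in _ <= _ * X]big_ord_recr /= mulrDr.
have SE : S n.+1 = S n + a n.+1 by rewrite /S big_ord_recr.
have st := step n.+1.
have h1 : 2 * (K * w n.+1 * S n ^+ 2) <= 2 * ((K - 1) * w n * S n ^+ 2).
  by rewrite ler_pM2l // ler_wpM2r // sqr_ge0.
(* Young's inequality for the cross term *)
have h2 : 0 <= w n.+1 * (S n - (2 * K - 1) * a n.+1) ^+ 2.
  by rewrite mulr_ge0 // sqr_ge0.
rewrite SE; move: IH st h1 h2.
move: (\sum_(l < n.+1) F l) (\sum_(l < n.+1) _) => f s.
move: (S n) (a n.+1) (w n) (w n.+1) (F n.+1) => x y p q g.
move: (K ^+ 3) => K3; clear.
move=> *; lra.
Qed.

Section chain.
Context d (T : measurableType d) (R : realType) (m : {measure set T -> \bar R}).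
Variables (J E : nat -> set T) (l : nat -> R) (A : R) (W v z dist : T -> R).
Hypotheses (mJ : forall k, measurable (J k)) (mE : forall k, measurable (E k)).
Hypotheses (EJ : forall k, E k `<=` J k) (JD : forall k, J k.+1 = J k `\` E k).
Hypotheses (l0 : forall k, 0 < l k) (mEl : forall k, m (E k) = (l k / 2)%:E).
Hypotheses (mW : measurable_fun setT W) (mv : measurable_fun setT v).
Hypotheses (mz : measurable_fun setT z) (md : measurable_fun setT dist).
Hypotheses (W0 : forall x, 0 <= W x) (Wpos : {ae m, forall x, J 0 x -> 0 < W x}).
Hypotheses (Wi : m.-integrable (J 0%N) (EFin \o W)).
Hypotheses (Vi : m.-integrable (J 0%N) (fun x => ((W x)^-1)%:E)).
Hypothesis (A2 : forall k, (\int[m]_(x in J k) W x) * (\int[m]_(x in J k) (W x)^-1) <=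
  A * l k ^+ 2).
Hypothesis (dist_ge : forall k x, E k x -> l k / 2 <= dist x).
Hypothesis (zv : forall k, {ae m, forall x, E k x ->
  ((`|z x|)%:E <= \sum_(i < k.+1) \int[m]_(y in E i) `|v y|%:E)%E}).

Let JS k : J k `<=` J 0%N.
Proof. by elim: k => // k IH; rewrite JD => x [/IH]. Qed.

Let ES k : E k `<=` J 0%N. Proof. by move=> x /EJ /JS. Qed.

Let om k := \int[m]_(x in J k) W x.
Let si k := \int[m]_(x in J k) (W x)^-1.
Let oe k := \int[m]_(x in E k) W x.

Let Wifin D : measurable D -> D `<=` J 0%N ->
  (\int[m]_(x in D) (W x)%:E)%E = (\int[m]_(x in D) W x)%:E.
Proof.
move=> mD DJ; rewrite fineK //; apply: integrable_fin_num => //.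
exact: integrableS Wi.
Qed.

Let Vifin D : measurable D -> D `<=` J 0%N ->
  (\int[m]_(x in D) ((W x)^-1)%:E)%E = (\int[m]_(x in D) (W x)^-1)%:E.
Proof.
move=> mD DJ; rewrite fineK //; apply: integrable_fin_num => //.
exact: integrableS Vi.
Qed.

Let mV : measurable_fun setT (fun x => (W x)^-1).
Proof. exact: measurable_funV. Qed.

Let WposS D : D `<=` J 0%N -> {ae m, forall x, D x -> 0 < W x}.
Proof. by move=> DJ; move: Wpos; apply: aeS => x H /DJ /H. Qed.

Let pos_int D (f : T -> R) : measurable D -> D `<=` J 0%N -> m D != 0%E ->
  measurable_fun setT f -> (forall x, 0 <= f x) -> (forall x, 0 < W x -> 0 < f x) ->
  (\int[m]_(x in D) (f x)%:E)%E = (\int[m]_(x in D) f x)%:E ->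
  0 < \int[m]_(x in D) f x.
Proof.
move=> mD DJ mD0 mf f0 fpos fE; rewrite -lte_fin -fE; apply: integral_gt0 => //.
- by apply/measurable_EFinP; exact: measurable_funTS.
- by move=> x _; rewrite lee_fin.
- by move: (WposS DJ); apply: aeS => x H /H /fpos; rewrite lte_fin.
Qed.

Let mE0 k : m (E k) != 0%E.
Proof. by rewrite mEl eqe gt_eqF // divr_gt0. Qed.

Let mJ0 k : m (J k) != 0%E.
Proof.
have := mE0 k; apply: contra_neq => H.
apply/eqP; rewrite -measure_le0 -H; apply: le_measure; rewrite ?inE //.
Qed.

Let om_gt0 k : 0 < om k. Proof. by apply: pos_int => //; exact: Wifin. Qed.

Let si_gt0 k : 0 < si k.
Proof.
apply: pos_int => //; last exact: Vifin; first by move=> x; rewrite invr_ge0.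
by move=> x; rewrite invr_gt0.
Qed.

Let siE_gt0 k : 0 < \int[m]_(x in E k) (W x)^-1.
Proof.
apply: pos_int => //; last exact: Vifin; first by move=> x; rewrite invr_ge0.
by move=> x; rewrite invr_gt0.
Qed.

Let siE k : \int[m]_(x in E k) (W x)^-1 <= si k.
Proof.
rewrite -lee_fin -!Vifin //; apply: ge0_subset_integral => //.
- by apply/measurable_EFinP; exact: measurable_funTS.
- by move=> x _; rewrite lee_fin invr_ge0.
Qed.

Let CS k (f : T -> R) : measurable_fun setT f ->
  ((\int[m]_(x in E k) `|f x|%:E) * (\int[m]_(x in E k) `|f x|%:E) <=
   (\int[m]_(x in E k) (f x ^+ 2 * W x)%:E) * (si k)%:E)%E.
Proof.
move=> mf.
apply: (@le_trans _ _ ((\int[m]_(x in E k) (f x ^+ 2 * W x)%:E) *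
   (\int[m]_(x in E k) (W x)^-1)%:E)%E).
  apply: cauchy_schwarz_weight => //.
  - exact: measurable_funTS.
  - exact: measurable_funTS.
  - exact: WposS.
  - exact: Vifin.
rewrite lee_wpmul2l ?lee_fin //.
by apply: integral_ge0 => x _; rewrite lee_fin mulr_ge0 // sqr_ge0.
Qed.

Let A_gt0 : 0 < A.
Proof.
have := lt_le_trans (mulr_gt0 (om_gt0 0%N) (si_gt0 0%N)) (A2 0%N).
by rewrite pmulr_lgt0 // exprn_gt0.
Qed.

(** By Cauchy-Schwarz for the constant 1 on [E k], whose measure is half of [l
    k], A_2 forces [E k] to carry a fixed part of the weight of [J k]. So the
    weight of what remains decays geometrically. *)
Let oe_ge k : om k <= 4 * A * oe k.
Proof.
have := CS k (@measurable_cst _ _ _ _ setT (1 : R)).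
under eq_integral do rewrite normr1.
under [X in (_ <= X * _)%E -> _]eq_integral do rewrite expr1n mul1r.
rewrite integral_cst // mul1e mEl Wifin // -!EFinM lee_fin -/(oe k) => H.
have := A2 k; rewrite -/(om k) -/(si k) => H2.
have s0 := si_gt0 k; have lk := l0 k.
have H3 : om k * (l k / 2 * (l k / 2)) <= om k * (oe k * si k).
  by rewrite ler_wpM2l // ltW.
have oe0 : 0 <= oe k by apply: Rintegral_ge0.
have H4 : oe k * (om k * si k) <= oe k * (A * l k ^+ 2) by rewrite ler_wpM2l.
have l2 : 0 < l k ^+ 2 by rewrite exprn_gt0.
rewrite -(ler_pM2r l2); lra.
Qed.

Let omS k : om k.+1 = om k - oe k.
Proof.
apply/eqP; rewrite eq_sym subr_eq; apply/eqP.
rewrite /om JD addrC -Rintegral_setU //.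
- by rewrite setDUK.
- exact: measurableD.
- by rewrite setDUK //; apply: integrableS Wi.
- by apply/disj_setPS => x [? []].
Qed.

Let K := 4 * A.

Let decay k : K * om k.+1 <= (K - 1) * om k.
Proof. by rewrite omS; have := oe_ge k; rewrite /K; lra. Qed.

Let K1 : 1 <= K.
Proof.
have := decay 0%N; have := om_gt0 0%N; have : 0 <= K * om 1.
  by rewrite mulr_ge0 // ?ltW // /K mulr_gt0.
by move=> h1 h2 h3; rewrite -subr_ge0 -(pmulr_lge0 _ h2); apply: le_trans h3.
Qed.

Let Q := (\int[m]_(x in \bigcup_k E k) ((dist x * v x) ^+ 2 * W x)%:E)%E.

Let mdv D : measurable D ->
  measurable_fun D (fun x => ((dist x * v x) ^+ 2 * W x)%:E).
Proof.
move=> mD; apply: measurable_funTS; apply/measurable_EFinP.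
by apply: measurable_funM => //; apply: measurable_funX; exact: measurable_funM.
Qed.

Let dv0 x : (0 <= ((dist x * v x) ^+ 2 * W x)%:E)%E.
Proof. by rewrite lee_fin mulr_ge0 // sqr_ge0. Qed.

Let mzW D : measurable D -> measurable_fun D (fun x => (z x ^+ 2 * W x)%:E).
Proof.
move=> mD; apply: measurable_funTS; apply/measurable_EFinP.
by apply: measurable_funM => //; exact: measurable_funX.
Qed.

Let zW0 x : (0 <= (z x ^+ 2 * W x)%:E)%E.
Proof. by rewrite lee_fin mulr_ge0 // sqr_ge0. Qed.

Let mbigE : measurable (\bigcup_k E k). Proof. exact: bigcupT_measurable. Qed.

Lemma chain_trivIset : trivIset setT E.
Proof.
have H i j : (i < j)%N -> E i `&` E j = set0.
  move=> ij; apply/seteqP; split => // x [Ei Ej].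
  have : J j `<=` ~` E i.
    elim: j ij {Ej} => // j IH; rewrite ltnS leq_eqVlt => /orP[/eqP <-|/IH H].
      by rewrite JD => y [].
    by rewrite JD => y [/H].
  by move=> /(_ x (EJ Ej)).
apply/trivIsetP => i j _ _; rewrite neq_ltn => /orP[/H //|/H].
by rewrite setIC.
Qed.

Let trivE := chain_trivIset.

Let F k := \int[m]_(x in E k) ((dist x * v x) ^+ 2 * W x).
Let a k := \int[m]_(x in E k) `|v x|.

Section finite.
Hypothesis Qoo : (Q < +oo)%E.

Let FE k : (\int[m]_(x in E k) ((dist x * v x) ^+ 2 * W x)%:E)%E = (F k)%:E.
Proof.
rewrite fineK // ge0_fin_numE; last exact: integral_ge0.
apply: le_lt_trans Qoo; apply: ge0_subset_integral => //.
- exact: mdv.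
- exact: bigcup_sup.
Qed.

Let vW k : (\int[m]_(x in E k) (v x ^+ 2 * W x)%:E <= (4 / l k ^+ 2 * F k)%:E)%E.
Proof.
rewrite EFinM -FE -ge0_integralZl_EFin //; last 2 first.
- exact: mdv.
- by rewrite divr_ge0 // exprn_ge0 // ltW.
apply: ge0_le_integral => //.
- by move=> x _; rewrite lee_fin mulr_ge0 // sqr_ge0.
- apply: measurable_funTS; apply/measurable_EFinP.
  by apply: measurable_funM => //; exact: measurable_funX.
- exact/measurable_funeM/mdv.
move=> x Ex; rewrite -EFinM lee_fin mulrA; apply: ler_wpM2r => //.
have lk := l0 k; have dl := dist_ge Ex.
rewrite exprMn mulrA; apply: ler_peMl; first exact: sqr_ge0.
rewrite mulrAC ler_pdivlMr ?exprn_gt0 // mul1r.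
by have : (l k / 2) ^+ 2 <= dist x ^+ 2; [rewrite lerXn2r // nnegrE; lra|lra].
Qed.

Let aE k : (\int[m]_(x in E k) `|v x|%:E)%E = (a k)%:E /\ a k ^+ 2 * om k <= K * F k.
Proof.
have := CS k mv.
have : (\int[m]_(x in E k) (v x ^+ 2 * W x)%:E * (si k)%:E <=
   (4 / l k ^+ 2 * F k * si k)%:E)%E.
  by rewrite EFinM; apply: lee_wpmul2r; [rewrite lee_fin ltW|exact: vW].
move=> h1 /le_trans /(_ h1) {h1}.
have I0 : (0 <= \int[m]_(x in E k) `|v x|%:E)%E by exact: integral_ge0.
have afin : (\int[m]_(x in E k) `|v x|%:E * \int[m]_(x in E k) `|v x|%:E <=
   (4 / l k ^+ 2 * F k * si k)%:E)%E -> (\int[m]_(x in E k) `|v x|%:E)%E = (a k)%:E.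
  rewrite /a /Rintegral => H; rewrite fineK // ge0_fin_numE // ltey.
  by apply/negP => /eqP aoo; move: H; rewrite aoo mulyy leye_eq.
move=> /[dup] /afin aE; rewrite aE -EFinM lee_fin => h; split=> //.
have F0 : 0 <= F k by rewrite -lee_fin -FE; exact: integral_ge0.
have h2 : a k * a k * om k <= 4 / l k ^+ 2 * F k * si k * om k.
  by rewrite ler_wpM2r // ltW.
apply: le_trans h2 _.
have -> : 4 / l k ^+ 2 * F k * si k * om k = 4 * F k * (om k * si k / l k ^+ 2).
  by ring.
have -> : K * F k = 4 * F k * A by rewrite /K; ring.
apply: ler_wpM2l; first by rewrite mulr_ge0.
by rewrite ler_pdivrMr ?exprn_gt0 //; exact: A2.
Qed.

Let z_le k : (\int[m]_(x in E k) (z x ^+ 2 * W x)%:E <=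
  (om k * (\sum_(i < k.+1) a i) ^+ 2)%:E)%E.
Proof.
set S := \sum_(i < _) _.
have S0 : 0 <= S by apply: sumr_ge0 => i _; exact: Rintegral_ge0.
apply: (@le_trans _ _ (\int[m]_(x in E k) (S ^+ 2 * W x)%:E)%E).
  apply: ae_ge0_le_integral => //.
  - exact: mzW.
  - by move=> x _; rewrite lee_fin mulr_ge0 // sqr_ge0.
  - apply: measurable_funTS; apply/measurable_EFinP; exact: measurable_funM.
  move: (zv k); apply: aeS => x H Ex; have := H Ex.
  under eq_bigr do rewrite (aE _).1.
  rewrite sumEFin !lee_fin -/S => zS; apply: ler_wpM2r => //.
  by rewrite -[z x ^+ 2]real_normK ?num_real //; apply: lerXn2r; rewrite ?nnegrE.
under eq_integral do rewrite EFinM.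
rewrite ge0_integralZl_EFin ?sqr_ge0 //; last 2 first.
- by move=> x _; rewrite lee_fin.
- by apply: measurable_funTS; apply/measurable_EFinP.
rewrite Wifin // -EFinM lee_fin mulrC; apply: ler_wpM2r; first exact: sqr_ge0.
by rewrite -lee_fin -!Wifin //; apply: ge0_subset_integral => //;
  [apply: measurable_funTS; apply/measurable_EFinP|move=> x _; rewrite lee_fin].
Qed.

(** The pieces [E k] are cut off one after the other from [J 0]. On [E k], [z]
    is bounded by the integral of [|v|] over the first pieces, each of which
    is bounded through A_2 by [dist * v] on this piece; the discrete Hardy
    inequality sums the bounds. *)
Lemma chain_inequality_fin : (\int[m]_(x in \bigcup_k E k) (z x ^+ 2 * W x)%:E <=
  (4 * K ^+ 3)%:E * Q)%E.
Proof.
rewrite ge0_integral_bigcup //; last first.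
  exact: mzW.
apply: lime_le; first by apply: is_cvg_nneseries => n _ _; exact: integral_ge0.
apply: nearW => n.
apply: (@le_trans _ _ (4 * K ^+ 3 * \sum_(k < n) F k)%:E).
  rewrite big_mkord; apply: (@le_trans _ _ (\sum_(k < n) om k * (\sum_(i < k.+1) a i) ^+ 2)%:E).
    by rewrite -sumEFin; apply: lee_sum => k _; exact: z_le.
  rewrite lee_fin; apply: discrete_hardy => //.
  - by move=> k; exact: ltW.
  - by move=> k; rewrite -lee_fin -FE; exact: integral_ge0.
  - by move=> k; have [] := aE k.
rewrite EFinM; apply: lee_wpmul2l.
  by rewrite lee_fin mulr_ge0 // exprn_ge0 // (le_trans ler01).
rewrite /Q ge0_integral_bigcup //; last exact: mdv.
apply: le_trans (nneseries_lim_ge n _); last first.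
  by move=> *; apply: integral_ge0 => x _; exact: dv0.
by rewrite big_mkord -sumEFin; apply: lee_sum => k _; rewrite FE.
Qed.

End finite.

Lemma chain_const_gt0 : 0 < 4 * K ^+ 3.
Proof. by rewrite mulr_gt0 // exprn_gt0 // (lt_le_trans ltr01). Qed.

Lemma chain_inequality : (\int[m]_(x in \bigcup_k E k) (z x ^+ 2 * W x)%:E <=
  (4 * K ^+ 3)%:E * Q)%E.
Proof.
have [Qoo|] := ltP Q +oo%E; first exact: chain_inequality_fin.
rewrite leye_eq => /eqP ->; rewrite mulry gtr0_sg ?mul1e ?leey //.
exact: chain_const_gt0.
Qed.

End chain.

(** * The weighted Poincare inequality on an interval *)

Section sub_average.
Context d (T : measurableType d) (R : realType) (m : {measure set T -> \bar R}).
Local Open Scope ereal_scope.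
Variables (D : set T) (f W : T -> R).
Hypotheses (mD : measurable D) (mf : measurable_fun setT f) (mW : measurable_fun setT W).
Hypotheses (W0 : forall x, (0 <= W x)%R) (Wpos : {ae m, forall x, D x -> (0 < W x)%R}).

Lemma integral_sqrB_le (g1 g2 : T -> R) : measurable_fun setT g1 ->
  measurable_fun setT g2 ->
  \int[m]_(x in D) ((g1 x - g2 x) ^+ 2 * W x)%:E <=
  2%:E * \int[m]_(x in D) (g1 x ^+ 2 * W x)%:E +
  2%:E * \int[m]_(x in D) (g2 x ^+ 2 * W x)%:E.
Proof.
move=> m1 m2.
have mg (g : T -> R) : measurable_fun setT g ->
    measurable_fun D (fun x => (g x ^+ 2 * W x)%:E).
  move=> mg; apply: measurable_funTS; apply/measurable_EFinP.
  by apply: measurable_funM => //; exact: measurable_funX.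
have g0 (g : T -> R) x : 0 <= (g x ^+ 2 * W x)%:E.
  by rewrite lee_fin mulr_ge0 // sqr_ge0.
have mg1 := mg _ m1; have mg2 := mg _ m2.
rewrite -!ge0_integralZl_EFin // -ge0_integralD //; last 4 first.
- by move=> x _; rewrite mule_ge0 // lee_fin.
- exact: measurable_funeM.
- by move=> x _; rewrite mule_ge0 // lee_fin.
- exact: measurable_funeM.
apply: ge0_le_integral => //.
- by move=> x _; exact: (g0 (fun x => g1 x - g2 x)%R).
- by apply: (mg (fun x => g1 x - g2 x)%R); exact: measurable_funB.
- by apply: emeasurable_funD; exact: measurable_funeM.
move=> x _; rewrite -!EFinM -EFinD lee_fin !mulrA -mulrDl ler_wpM2r //.
by have := sqr_ge0 (g1 x + g2 x)%R; lra.
Qed.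

(** The average is a nearly optimal constant: [f - avg f = (f - c) - avg (f -
    c)]. *)
Lemma sub_average_bound (v o s A c : R) : (0 < v)%R -> (0 < s)%R ->
  m D = v%:E -> m.-integrable D (EFin \o f) ->
  \int[m]_(x in D) (W x)%:E = o%:E ->
  \int[m]_(x in D) ((W x)^-1)%:E = s%:E -> (o * s <= A * v ^+ 2)%R -> (0 <= A)%R ->
  \int[m]_(x in D) ((f x - (\int[m]_(y in D) f y)%R / v) ^+ 2 * W x)%:E <=
  (2 + 2 * A)%:E * \int[m]_(x in D) ((f x - c) ^+ 2 * W x)%:E.
Proof.
move=> v0 s0 mDv fi Wo Ws osA A0.
have mfc : measurable_fun setT (fun x => f x - c)%R by exact: measurable_funB.
have := @average_bound _ _ _ m D (fun x => f x - c)%R W mD _ _ W0 Wpos v o s A v0 s0 Wo Ws osA.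
move=> /(_ (measurable_funTS mfc) (measurable_funTS mW)).
have ci : m.-integrable D (EFin \o cst c).
  by apply: integrable_cst_lty; rewrite ?mDv ?ltry.
have E : (\int[m]_(y in D) (f y - c) / v = (\int[m]_(y in D) f y)%R / v - c)%R.
  rewrite RintegralB // Rintegral_cst // mDv /=; field; exact: lt0r_neq0.
rewrite E => H.
apply: (@le_trans _ _ (\int[m]_(x in D) ((f x - c - ((\int[m]_(y in D) f y)%R / v - c)) ^+ 2 * W x)%:E)).
  by rewrite le_eqVlt; apply/orP; left; apply/eqP; apply: eq_integral => x _;
     congr (_ ^+ 2 * _)%:E; ring.
apply: (le_trans (integral_sqrB_le mfc (measurable_cst _))).
have Q0 : 0 <= \int[m]_(x in D) ((f x - c) ^+ 2 * W x)%:E.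
  by apply: integral_ge0 => x _; rewrite lee_fin mulr_ge0 // sqr_ge0.
rewrite [X in _ <= X * _]EFinD [leRHS]ge0_muleDl ?lee_fin // ?mulr_ge0 //.
by apply: leeD => //; rewrite EFinM -muleA; apply: lee_wpmul2l => //; rewrite lee_fin.
Qed.

End sub_average.

Section line.
Context {R : realType}.
Local Notation X := (measurableTypeR R).
Local Notation mu1 := (@lebesgue_measure R).

Lemma Rintegral_itv_split (f : R -> R) (p q r : R) : p <= q -> q <= r ->
  mu1.-integrable `[p, r] (EFin \o f) ->
  \int[mu1]_(t in `[p, r]) f t =
  \int[mu1]_(t in `[p, q]) f t + \int[mu1]_(t in `[q, r]) f t.
Proof.
move=> pq qr fi.
have := @Rintegral_itvB _ f (BLeft p) (BRight r) q fi.
rewrite !bnd_simp => /(_ pq qr) /eqP; rewrite subr_eq => /eqP ->; rewrite addrC.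
congr (_ + _); apply: Rintegral_itv_obnd_cbnd; apply: integrableS fi => //.
by move=> x /=; rewrite !in_itv /= => /andP[qx ->]; rewrite (le_trans pq) // ltW.
Qed.

(** [u] agrees, outside a null set, with a function that is locally absolutely
    continuous on the open interval and whose derivative is [v]; neither
    function is controlled at the endpoints. *)
Definition ac_line (a b : R) (u v : R -> R) :=
  (forall s t, a < s -> t < b -> mu1.-integrable `[s, t] (EFin \o v)) /\
  exists2 N : set X, mu1.-negligible N &
    forall s t, ~ N s -> ~ N t -> a < s -> s < t -> t < b ->
      u t - u s = \int[mu1]_(r in `[s, t]) v r.

Lemma ae_notin (N : set X) : mu1.-negligible N -> {ae mu1, forall t : X, ~ N t}.
Proof. by apply: negligibleS => t /= /contrapT. Qed.

Lemma exists_notin (N : set X) (p q : R) : p < q -> mu1.-negligible N ->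
  exists2 s, p < s < q & ~ N s.
Proof.
move=> pq N0; apply: contrapT => H.
have : mu1 `]p, q[ = 0%E.
  apply/negligibleP; first exact: measurable_itv.
  apply: negligibleS N0 => s /=; rewrite in_itv /= => spq.
  by apply: contrapT => Ns; apply: H; exists s.
by rewrite lebesgue_measure_itv /= lte_fin pq -EFinB => -[/eqP]; rewrite subr_eq0 gt_eqF.
Qed.

(** [c] is the value at [m] of the continuous representative of [u]. As [m]
    may belong to the exceptional set, this value is computed from a nearby
    point [s]. *)
Lemma ac_line_midpoint (a b m : R) (u v : R -> R) : a < m -> m < b ->
  ac_line a b u v ->
  exists c, {ae mu1, forall t : X, a < t < b ->
    `|u t - c| <= if m <= t then \int[mu1]_(r in `[m, t]) `|v r|
                  else \int[mu1]_(r in `[t, m]) `|v r|}.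
Proof.
move=> am mb [vi [N N0 H]].
have [s /andP[ms sb] Ns] := exists_notin mb N0.
pose I p q := \int[mu1]_(r in `[p, q]) v r.
have split p q r : a < p -> p <= q -> q <= r -> r < b -> I p r = I p q + I q r.
  by move=> ap pq qr rb; apply: Rintegral_itv_split => //; exact: vi.
have le_norm p q : a < p -> q < b -> `|I p q| <= \int[mu1]_(r in `[p, q]) `|v r|.
  by move=> ap qb; apply: le_normr_Rintegral => //; exact: vi.
exists (u s - I m s).
move: (ae_notin N0); apply: aeS => t Nt /andP[at_ tb].
have as_ : a < s by exact: lt_trans ms.
case: ifPn => [mt|]; last rewrite -ltNge => tm.
- suff -> : u t - (u s - I m s) = I m t by exact: le_norm.
  case: (ltgtP s t) => [st|ts|<-].
  + by rewrite (split m s t) // ?(ltW ms) ?(ltW st) // /I -(H s t) //; ring.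
  + rewrite (split m t s) // ?(ltW ts) //.
    by have := H t s Nt Ns at_ ts sb; rewrite -/(I t s) => <-; ring.
  + by ring.
- have ts : t < s by exact: lt_trans ms.
  suff -> : u t - (u s - I m s) = - I t m by rewrite normrN; exact: le_norm.
  have := H t s Nt Ns at_ ts sb; rewrite -/(I t s) (split t m s) // ?(ltW tm) ?(ltW ms) //.
  move=> E; have us : u s = u t + (I t m + I m s) by rewrite -E; ring.
  by rewrite us; ring.
Qed.

Local Open Scope ereal_scope.

Section poincare.
Variables (a b A : R) (W u v : R -> R).
Hypotheses (ab : (a < b)%R) (mW : measurable_fun setT (W : X -> R)).
Hypotheses (mu_ : measurable_fun setT (u : X -> R)) (mv : measurable_fun setT (v : X -> R)).
Hypotheses (W0 : forall x, (0 <= W x)%R).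
Hypothesis Wpos : {ae mu1, forall t : X, `[a, b]%classic t -> (0 < W t)%R}.
Hypothesis Wi : mu1.-integrable `[a, b] (EFin \o W).
Hypothesis Vi : mu1.-integrable `[a, b] (fun t => ((W t)^-1)%:E).

Let h (k : nat) : R := ((b - a) / 2 * 2^-1 ^+ k)%R.
Let m := ((a + b) / 2)%R.

Hypothesis A2l : forall k, ((\int[mu1]_(t in `[a, a + h k]) W t) *
  (\int[mu1]_(t in `[a, (a + h k)]) (W t)^-1) <= A * h k ^+ 2)%R.
Hypothesis A2r : forall k, ((\int[mu1]_(t in `[(b - h k), b]) W t) *
  (\int[mu1]_(t in `[b - h k, b]) (W t)^-1) <= A * h k ^+ 2)%R.
Hypothesis uv : ac_line a b u v.

Let dist t := Num.min (b - t)%R (t - a)%R.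

Let h0 k : (0 < h k)%R.
Proof. by rewrite mulr_gt0 ?exprn_gt0 ?invr_gt0 // divr_gt0 // subr_gt0. Qed.

Let hS k : h k.+1 = (h k / 2)%R. Proof. by rewrite /h exprSr mulrA. Qed.

Let h0E : h 0 = ((b - a) / 2)%R. Proof. by rewrite /h expr0 mulr1. Qed.

Let h_le k : (h k <= (b - a) / 2)%R.
Proof. by elim: k => [|k IH]; [rewrite h0E|rewrite hS; have := h0 k; lra]. Qed.

Let h_lt (t : R) : (0 < t)%R -> exists k, (h k < t)%R.
Proof.
move=> t0.
have /cvgrPdist_lt/(_ t t0) : (geometric ((b - a) / 2) (2^-1 : R))%R @ \oo --> (0:R)%R.
  by apply: cvg_geometric; rewrite ger0_norm ?invr_ge0 // invf_lt1 // ltr1n.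
move=> [k _ /(_ k (leqnn k))] /=; rewrite sub0r normrN ger0_norm; first by exists k.
exact/ltW/h0.
Qed.

Let md : measurable_fun setT (dist : X -> R).
Proof.
by apply: measurable_minr; apply: measurable_funB.
Qed.

(** Both halves of [[a, b]] are instances: [S t] is the interval between the
    midpoint and [t], and [J k] the dyadic interval of length [h k] that ends
    at [a] or [b]. *)
Let half (J E : nat -> set X) (S : R -> set X) (c : R) :
  (forall k, measurable (J k)) -> (forall k, measurable (E k)) ->
  (forall k, E k `<=` J k) -> (forall k, J k.+1 = J k `\` E k) ->
  (forall k, mu1 (E k) = (h k / 2)%:E) -> J 0%N `<=` `[a, b]%classic ->
  (forall k, ((\int[mu1]_(t in J k) W t) * (\int[mu1]_(t in J k) (W t)^-1) <=
     A * h k ^+ 2)%R) ->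
  (forall k t, E k t -> (h k / 2 <= dist t)%R) ->
  (forall k t, E k t -> S t `<=` \bigcup_(i < k.+1) E i) -> (forall t, measurable (S t)) ->
  (forall k, {ae mu1, forall t : X, E k t -> (`|u t - c|)%:E <=
     \int[mu1]_(r in S t) `|v r|%:E}) ->
  \int[mu1]_(t in \bigcup_k E k) ((u t - c) ^+ 2 * W t)%:E <=
  (4 * (4 * A) ^+ 3)%:E * \int[mu1]_(t in `[a, b]) ((dist t * v t) ^+ 2 * W t)%:E.
Proof.
move=> mJ mE EJ JD mEl J0 A2 dE SE mS uS.
have EJ0 k : E k `<=` J 0%N.
  by move=> x /EJ; elim: k => // k IH; rewrite JD => -[/IH].
have E00 : mu1 (E 0%N) != 0 by rewrite mEl eqe gt_eqF // divr_gt0.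
have WJ : {ae mu1, forall t : X, J 0%N t -> (0 < W t)%R}.
  by move: Wpos; apply: aeS => t Ht /J0.
have WiJ : mu1.-integrable (J 0%N) (EFin \o W) by exact: integrableS Wi.
have ViJ : mu1.-integrable (J 0%N) (fun t => ((W t)^-1)%:E) by exact: integrableS Vi.
have mabs (D : set X) : measurable D -> measurable_fun D (fun t => `|v t|%:E).
  move=> mD; apply: measurable_funTS; apply/measurable_EFinP.
  exact: measurableT_comp.
apply: le_trans (@chain_inequality _ _ _ mu1 J E h A W v (fun t => u t - c)%R dist
  mJ mE EJ JD h0 mEl mW mv _ md W0 WJ WiJ ViJ A2 dE _) _.
- exact: measurable_funB.
- move=> k; move: (uS k); apply: aeS => t Ht Et.
  apply: (le_trans (Ht Et)).
  rewrite -(big_mkord xpredT (fun i => \int[mu1]_(y in E i) `|v y|%:E)).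
  rewrite -ge0_integral_bigsetU //; last 3 first.
  - exact: iota_uniq.
  - exact: sub_trivIset (chain_trivIset EJ JD).
  - by apply: mabs; exact: bigsetU_measurable.
  apply: ge0_subset_integral => //.
  - exact: bigsetU_measurable.
  - by apply: mabs; exact: bigsetU_measurable.
  - by rewrite big_mkord -bigcup_mkord; exact: SE.
apply: lee_wpmul2l.
  rewrite lee_fin ltW //.
  exact: (chain_const_gt0 mJ mE EJ JD h0 mEl mW W0 WJ WiJ ViJ A2).
apply: ge0_subset_integral => //.
- exact: bigcupT_measurable.
- apply: measurable_funTS; apply/measurable_EFinP.
  by apply: measurable_funM => //; apply: measurable_funX; exact: measurable_funM.
- by move=> t _; rewrite lee_fin mulr_ge0 // sqr_ge0.
- by apply: bigcup_sub => k _ t /EJ0/J0.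
Qed.

Let am : (a < m)%R. Proof. by have ab' := ab; rewrite /m; lra. Qed.
Let mb : (m < b)%R. Proof. by have ab' := ab; rewrite /m; lra. Qed.
Let amE : (a + h 0 = m)%R. Proof. by rewrite h0E /m; field. Qed.
Let bmE : (b - h 0 = m)%R. Proof. by rewrite h0E /m; field. Qed.

Let Er k := (`[(b - h k)%R, (b - h k.+1)%R[%classic : set X).
Let El k := (`](a + h k.+1)%R, (a + h k)%R]%classic : set X).

Let Er_cover k (r : R) : (m <= r)%R -> (r < b - h k.+1)%R ->
  (\bigcup_(i < k.+1) Er i) r.
Proof.
move=> mr; elim: k => [|k IH] hr.
  by exists 0%N => [//|]; rewrite /Er /= in_itv /= bmE mr.
have [/IH[i /= ik Hi]|kr] := ltP r (b - h k.+1)%R.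
  by exists i => //=; exact: ltnW.
by exists k.+1 => [/=|]; rewrite ?ltnSn // /Er /= in_itv /= kr.
Qed.

Let El_cover k (r : R) : (r <= m)%R -> (a + h k.+1 < r)%R ->
  (\bigcup_(i < k.+1) El i) r.
Proof.
move=> mr; elim: k => [|k IH] hr.
  by exists 0%N => [//|]; rewrite /El /= in_itv /= amE mr andbT.
have [/IH[i /= ik Hi]|kr] := ltP (a + h k.+1)%R r.
  by exists i => //=; exact: ltnW.
by exists k.+1 => [/=|]; rewrite ?ltnSn // /El /= in_itv /= kr andbT.
Qed.

Let Er_sub k r : Er k r -> [/\ (m <= r)%R, (r < b)%R & (h k / 2 <= b - r)%R].
Proof.
rewrite /Er /= in_itv /= => /andP[h1 h2]; have := h_le k; have := h0 k.+1.
by move: h2; rewrite hS -bmE h0E => h2 h3 h4; split; lra.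
Qed.

Let El_sub k r : El k r -> [/\ (a < r)%R, (r <= m)%R & (h k / 2 <= r - a)%R].
Proof.
rewrite /El /= in_itv /= => /andP[h1 h2]; have := h_le k; have := h0 k.+1.
by move: h1; rewrite hS -amE h0E => h1 h3 h4; split; lra.
Qed.

Let bigcup_Er : \bigcup_k Er k = `[m, b[%classic.
Proof.
apply/seteqP; split => [t [k _ /Er_sub[h1 h2 _]]|t] /=.
  by rewrite in_itv /= h1.
rewrite in_itv /= => /andP[mt tb].
have [k hk] := h_lt (ltac:(by rewrite subr_gt0) : (0 < b - t)%R).
have [|i _ Hi] := @Er_cover k t mt; last by exists i.
by rewrite hS; have := h0 k; lra.
Qed.

Let bigcup_El : \bigcup_k El k = `]a, m]%classic.
Proof.
apply/seteqP; split => [t [k _ /El_sub[h1 h2 _]]|t] /=.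
  by rewrite in_itv /= h1.
rewrite in_itv /= => /andP[at_ tm].
have [k hk] := h_lt (ltac:(by rewrite subr_gt0) : (0 < t - a)%R).
have [|i _ Hi] := @El_cover k t tm; last by exists i.
by rewrite hS; have := h0 k; lra.
Qed.

Let midpoint_bound (c : R) := {ae mu1, forall t : X, (a < t < b)%R ->
    (`|u t - c| <= if m <= t then \int[mu1]_(r in `[m, t]) `|v r|
                  else \int[mu1]_(r in `[t, m]) `|v r|)%R}.

Let RintE p q : (a < p)%R -> (q < b)%R ->
  (\int[mu1]_(r in `[p, q]) `|v r|)%R%:E = \int[mu1]_(r in `[p, q]) `|v r|%:E.
Proof.
move=> ap qb; rewrite fineK //; apply: integrable_fin_num => //.
by have := uv.1 p q ap qb => /integrable_norm.
Qed.

Let right_bound c : midpoint_bound c ->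
  \int[mu1]_(t in `[m, b[) ((u t - c) ^+ 2 * W t)%:E <=
  (4 * (4 * A) ^+ 3)%:E * \int[mu1]_(t in `[a, b]) ((dist t * v t) ^+ 2 * W t)%:E.
Proof.
move=> H; rewrite -bigcup_Er.
apply: (@half (fun k => `[(b - h k)%R, b]%classic) Er (fun t => `[m, t]%classic)) => //.
- by move=> k; exact: measurable_itv.
- by move=> k t; rewrite /Er /= !in_itv /= => /andP[-> h2]; have := h0 k.+1; lra.
- move=> k; apply/seteqP; split => t; rewrite /Er /= !in_itv /=; last first.
    by move=> [/andP[h1 ->] /negP]; rewrite h1 /= -leNgt => ->.
  move=> /andP[h1 ->]; have := h0 k; have := h1; rewrite hS => h2 h3.
  split; first by rewrite andbT; lra.
  by apply/negP; rewrite negb_and -leNgt -hS h1 orbT.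
- move=> k; rewrite lebesgue_measure_itv /= lte_fin hS.
  have h1 := h0 k; rewrite ifT; last by lra.
  by rewrite -EFinB; congr (_%:E); field.
- move=> t /=; rewrite !in_itv /= bmE => /andP[h1 ->]; rewrite andbT.
  by rewrite (le_trans _ h1) // ltW.
- move=> k t /Er_sub[h1 h2 h3]; rewrite /dist le_min h3 /=.
  by have := h_le k; rewrite -h0E => h4; have h5 := h0 k; move: h1; rewrite -amE; lra.
- move=> k t; rewrite {1}/Er /= in_itv /= => /andP[_ tk] r /=.
  by rewrite in_itv /= => /andP[mr rt]; apply: Er_cover => //; exact: le_lt_trans tk.
- move=> k; move: H; apply: aeS => t Ht /Er_sub[mt tb _].
  rewrite -RintE // lee_fin.
  by have := Ht; rewrite mt tb (lt_le_trans am mt); apply.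
Qed.

Let left_bound c : midpoint_bound c ->
  \int[mu1]_(t in `]a, m]) ((u t - c) ^+ 2 * W t)%:E <=
  (4 * (4 * A) ^+ 3)%:E * \int[mu1]_(t in `[a, b]) ((dist t * v t) ^+ 2 * W t)%:E.
Proof.
move=> H; rewrite -bigcup_El.
have ne : {ae mu1, forall t : X, t <> m}.
  exists [set m]; split => //; last by move=> t /= /contrapT.
  exact: lebesgue_measure_set1.
apply: (@half (fun k => `[a, (a + h k)%R]%classic) El (fun t => `[t, m]%classic)) => //.
- by move=> k; exact: measurable_itv.
- by move=> k t; rewrite /El /= !in_itv /= => /andP[h1 ->]; have := h0 k.+1; lra.
- move=> k; apply/seteqP; split => t; rewrite /El /= !in_itv /=; last first.
    by move=> [/andP[-> h1] /negP]; rewrite h1 andbT -leNgt => ->.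
  move=> /andP[-> h1]; have := h0 k; have := h1; rewrite hS => h2 h3.
  split; first by lra.
  by apply/negP; rewrite negb_and -leNgt -hS h1.
- move=> k; rewrite lebesgue_measure_itv /= lte_fin hS.
  have h1 := h0 k; rewrite ifT; last by lra.
  by rewrite -EFinB; congr (_%:E); field.
- move=> t /=; rewrite !in_itv /= amE => /andP[-> h1] /=.
  by rewrite (le_trans h1) // ltW.
- move=> k t /El_sub[h1 h2 h3]; rewrite /dist le_min h3 andbT.
  by have := h_le k; rewrite -h0E => h4; have h5 := h0 k; move: h2; rewrite -bmE; lra.
- move=> k t; rewrite {1}/El /= in_itv /= => /andP[tk _] r /=.
  by rewrite in_itv /= => /andP[tr rm]; apply: El_cover => //; exact: lt_le_trans tr.
- move=> k; move: ne H; apply: aeS2 => t tm Ht /El_sub[at_ mt _].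
  have {tm}mt : (t < m)%R by rewrite lt_neqAle mt andbT; exact/eqP.
  rewrite -RintE // lee_fin.
  by have := Ht; rewrite at_ (lt_trans mt mb) (lt_geF mt); apply.
Qed.

Let mg (g : X -> R) (D : set X) : measurable D -> measurable_fun setT g ->
  measurable_fun D (fun t => (g t ^+ 2 * W t)%:E).
Proof.
move=> mD mg; apply: measurable_funTS; apply/measurable_EFinP.
by apply: measurable_funM => //; exact: measurable_funX.
Qed.

Let g0 (g : X -> R) t : 0 <= (g t ^+ 2 * W t)%:E.
Proof. by rewrite lee_fin mulr_ge0 // sqr_ge0. Qed.

Hypothesis A0 : (0 <= A)%R.

Let exists_center : exists c,
  \int[mu1]_(t in `[a, b]) ((u t - c) ^+ 2 * W t)%:E <=
  (2 * (4 * (4 * A) ^+ 3))%:E * \int[mu1]_(t in `[a, b]) ((dist t * v t) ^+ 2 * W t)%:E.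
Proof.
have [c Hc] := ac_line_midpoint am mb uv; exists c.
have muc : measurable_fun setT (fun t : X => u t - c)%R by exact: measurable_funB.
rewrite -(integral_itv_bndo_bndc); last exact: (mg _ muc).
rewrite -(integral_itv_obnd_cbnd); last exact: (mg _ muc).
have -> : `]a, b[%classic = `]a, m]%classic `|` `]m, b[%classic :> set X.
  have := am; have := mb => h1 h2.
  apply/seteqP; split => t /=; rewrite !in_itv /=.
    by move=> /andP[-> ->]; case: (leP t m) => _; [left|right].
  by case=> /andP[h3 h4]; apply/andP; split=> //; [exact: le_lt_trans h1|exact: lt_trans h3].
have mU : measurable_fun (`]a, m]%classic `|` `]m, b[%classic : set X)
    (fun t => ((u t - c) ^+ 2 * W t)%:E).
  by apply: (mg _ muc); apply: measurableU; exact: measurable_itv.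
have disj : [disjoint (`]a, m]%classic : set X) & `]m, b[%classic].
  apply/disj_setPS => t []; rewrite /= !in_itv /= => /andP[_ h1] /andP[h2 _].
  by move: (le_lt_trans h1 h2); rewrite ltxx.
rewrite (ge0_integral_setU mu1 (measurable_itv _) (measurable_itv _) mU _ disj); last first.
  by move=> t _; exact: (g0 (fun t => u t - c)%R).
have -> : (2 * (4 * (4 * A) ^+ 3))%:E = (4 * (4 * A) ^+ 3)%:E + (4 * (4 * A) ^+ 3)%:E :> \bar R.
  by rewrite -EFinD; congr (_%:E); ring.
have C0 : (0 <= 4 * (4 * A) ^+ 3)%R by rewrite mulr_ge0 // exprn_ge0 // mulr_ge0.
rewrite ge0_muleDl ?lee_fin //.
apply: leeD; first exact: left_bound.
apply: le_trans (right_bound Hc); apply: ge0_subset_integral => //.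
- by apply: (mg _ muc); exact: measurable_itv.
- by move=> t _; exact: (g0 (fun t => u t - c)%R).
- by move=> t /=; rewrite !in_itv /= => /andP[/ltW -> ->].
Qed.

Hypothesis A2ab : ((\int[mu1]_(t in `[a, b]) W t) *
  (\int[mu1]_(t in `[a, b]) (W t)^-1) <= A * (b - a) ^+ 2)%R.
Hypothesis ui : mu1.-integrable `[a, b] (EFin \o u).

(** Besides [[a, b]], only the dyadic intervals adjacent to an endpoint need
    to satisfy the A_2 condition. There are countably many of them, so the
    lemma applies to almost every line. *)
Lemma line_poincare :
  \int[mu1]_(t in `[a, b]) ((u t - (\int[mu1]_(r in `[a, b]) u r)%R / (b - a)) ^+ 2 * W t)%:E <=
  ((2 + 2 * A) * (2 * (4 * (4 * A) ^+ 3)))%:E *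
  \int[mu1]_(t in `[a, b]) ((dist t * v t) ^+ 2 * W t)%:E.
Proof.
have [c Hc] := exists_center.
have ba : (0 < b - a)%R by rewrite subr_gt0.
have mI : measurable (`[a, b] : set X) by exact: measurable_itv.
have mIE : mu1 `[a, b] = (b - a)%:E.
  by rewrite lebesgue_measure_itv /= lte_fin ab -EFinB.
have sE : \int[mu1]_(t in `[a, b]) ((W t)^-1)%:E = (\int[mu1]_(t in `[a, b]) (W t)^-1)%R%:E.
  by rewrite fineK //; exact: integrable_fin_num Vi.
have oE : \int[mu1]_(t in `[a, b]) (W t)%:E = (\int[mu1]_(t in `[a, b]) W t)%R%:E.
  by rewrite fineK //; exact: integrable_fin_num Wi.
have s0 : (0 < \int[mu1]_(t in `[a, b]) (W t)^-1)%R.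
  rewrite -lte_fin -sE; apply: integral_gt0 => //.
  - apply: measurable_funTS; apply/measurable_EFinP.
    by apply: measurable_funV.
  - by move=> t _; rewrite lee_fin invr_ge0.
  - by move: Wpos; apply: aeS => t H /H; rewrite lte_fin invr_gt0.
  - apply/eqP => H; move: mIE; rewrite [LHS]H => -[/esym/eqP].
    by rewrite gt_eqF.
have := sub_average_bound mI mu_ mW W0 Wpos c ba s0 mIE ui oE sE A2ab A0.
move=> /le_trans; apply; rewrite EFinM -muleA.
by apply: lee_wpmul2l => //; rewrite lee_fin addr_ge0 // mulr_ge0.
Qed.

End poincare.

End line.

(** * Smooth functions on the line *)

Section smooth_functions.
Context {R : realType}.
Implicit Types (f g : R -> R).

(** The derivatives are named rather than iterated, so that each closure
    property is a plain induction on the number of derivatives. *)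
Fixpoint smoothN (n : nat) f : Prop :=
  if n is k.+1 then exists2 f', (forall x : R, is_derive x (1 : R) f (f' x)) & smoothN k f'
  else True.

Definition smooth1 f := forall n, smoothN n f.

Lemma smoothNS n f : smoothN n.+1 f -> smoothN n f.
Proof. by elim: n f => [//|n IH] f [f' df /IH]; exists f'. Qed.

Lemma smoothN_cst n c : smoothN n (fun=> c).
Proof.
elim: n c => [//|n IH] c; exists (fun=> 0) => [x|]; last exact: IH.
exact: is_derive_cst.
Qed.

Lemma smoothN_add n f g : smoothN n f -> smoothN n g -> smoothN n (fun x => f x + g x).
Proof.
elim: n f g => [//|n IH] f g [f' df hf] [g' dg hg].
by exists (fun x => f' x + g' x) => [x|]; [exact: is_deriveD|exact: IH].
Qed.

Lemma smoothN_mul n f g : smoothN n f -> smoothN n g -> smoothN n (fun x => f x * g x).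
Proof.
elim: n f g => [//|n IH] f g hf hg; have /smoothNS hfn := hf; have /smoothNS hgn := hg.
move: hf hg => [f' df hf] [g' dg hg].
exists (fun x => f x * g' x + g x * f' x) => [x|].
  exact: (is_deriveM (df x) (dg x)).
by apply: smoothN_add; exact: IH.
Qed.

Lemma smoothN_affine n f c d : smoothN n f -> smoothN n (fun x => f (c * x + d)).
Proof.
elim: n f => [//|n IH] f [f' df hf].
exists (fun x => f' (c * x + d) * c) => [x|]; last first.
  by apply: smoothN_mul; [exact: IH|exact: smoothN_cst].
have da : is_derive x 1 (fun x : R => c * x + d) c.
  have := is_deriveD (is_deriveZ c (is_derive_id x (1:R))) (is_derive_cst d x (1:R)).
  by move/is_derive_eq; apply; rewrite addr0 /GRing.scale /= mulr1.
exact: (is_derive1_comp (df _) da).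
Qed.

Lemma smooth1_derivative f : smooth1 f -> forall x : R, is_derive x (1 : R) f ((derive1 f) x).
Proof.
move=> sf x; have [f' df _] := sf 1%N.
rewrite derive1E; apply: DeriveDef => //; exact: (@ex_derive _ _ _ _ _ _ _ (df x)).
Qed.

Lemma smooth1_derive1 f : smooth1 f -> smooth1 (derive1 f).
Proof.
move=> sf n; have [f' df hf] := sf n.+1.
suff -> : (derive1 f) = f' by [].
by apply/funext => x; rewrite derive1E; apply: derive_val.
Qed.

Lemma smooth1_derive1n f k : smooth1 f -> smooth1 (derive1n k f).
Proof. by elim: k f => [//|k IH] f sf; rewrite derive1Sn; apply/IH/smooth1_derive1. Qed.

Lemma smooth1_continuous f : smooth1 f -> continuous f.
Proof.
move=> sf x; apply: differentiable_continuous; apply/derivable1_diffP.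
exact: (@ex_derive _ _ _ _ _ _ _ (smooth1_derivative sf x)).
Qed.

(** The functions [P(1/t) * exp(-1/t)] extended by 0 to [t <= 0]. Letting [P]
    vary makes the family stable under derivation, so one computation at 0
    gives smoothness. *)
Definition flat (P : {poly R}) (t : R) : R :=
  if 0 < t then P.[t^-1] * expR (- t^-1) else 0.

(** [exp y >= y^k / k!] at [y = 1/t] beats every power of [1/t]. *)
Lemma flat_bound P : exists2 C, 0 <= C & forall t, `|flat P t| <= C * `|t|.
Proof.
exists (\sum_(i < size P) `|P`_i| * i.+1`!%:R).
  by apply: sumr_ge0 => i _; rewrite mulr_ge0.
move=> t; rewrite /flat; case: ifPn => [t0|_]; last first.
  by rewrite normr0 mulr_ge0 // sumr_ge0 // => i _; rewrite mulr_ge0.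
rewrite horner_coef mulr_suml mulr_suml.
apply: (le_trans (ler_norm_sum _ _ _)); apply: ler_sum => i _.
rewrite normrM normrM -!mulrA; apply: ler_wpM2l => //.
have y0 : 0 < t^-1 by rewrite invr_gt0.
rewrite (gtr0_norm t0) (gtr0_norm (expR_gt0 _)) ger0_norm; last by rewrite exprn_ge0 // ltW.
have := expR_ge1Dxn i (ltW y0); rewrite expRN => H.
rewrite ler_pdivrMr ?expR_gt0 //.
have h1 : t^-1 ^+ i.+1 / i.+1`!%:R <= expR t^-1 by lra.
have f0 : 0 < i.+1`!%:R :> R by rewrite ltr0n fact_gt0.
move: h1; rewrite ler_pdivrMr // => h1.
have -> : t^-1 ^+ i = t * t^-1 ^+ i.+1 by rewrite exprS mulrA divff ?mul1r // gt_eqF.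
by rewrite -mulrA mulrCA; apply: ler_wpM2l; [exact: ltW|rewrite mulrC].
Qed.

(** In terms of [y = 1/t], the chain rule gives the factor [y^2]. *)
Lemma is_derive_flat P (t : R) :
  is_derive t (1 : R) (flat P) (flat ('X^2 * (P - P^`())) t).
Proof.
have [t0|t0|<-] := ltgtP 0 t.
- pose g := (fun y => P.[y] * expR (- y)).
  have dg (y : R) : is_derive y 1 g (P^`().[y] * expR (- y) - P.[y] * expR (- y)).
    have d1 : is_derive y 1 (fun y : R => expR (- y)) (expR (- y) * (-1)).
      by apply: (@is_derive1_comp _ expR (-%R)).
    have := is_deriveM (is_derive_poly P y) d1.
    by move/is_derive_eq; apply; rewrite /GRing.scale /=; ring.
  have di : is_derive t 1 (fun y : R => y^-1) (- t ^- 2).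
    have := @is_deriveV R id t 1 1 (lt0r_neq0 t0) (is_derive_id _ _).
    by move/is_derive_eq; apply; rewrite /GRing.scale /= mulr1.
  apply: near_eq_is_derive (is_derive_eq (is_derive1_comp (dg _) di) _).
    near=> y; rewrite /flat ifT //=.
    by near: y; exact: lt_nbhsr.
  rewrite /flat t0 !hornerE /=; rewrite exprVn; ring.
- rewrite /flat ltNge ltW //=; apply: near_eq_is_derive (is_derive_cst 0 t 1).
  near=> y; rewrite /flat ifF //; apply/negbTE; rewrite -leNgt ltW //.
  by near: y; exact: lt_nbhsl.
- have [C C0 HC] := flat_bound ('X * P).
  have H : (fun h : R => h^-1 *: ((flat P \o shift 0) (h *: 1) - flat P 0)) @ 0^' --> (0 : R).
    apply/cvgr0Pnorm_le => e e0; near=> h.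
    rewrite /= {2}/flat ltxx subr0 addr0 /GRing.scale /= mulr1.
    have -> : h^-1 * flat P h = flat ('X * P) h.
      by rewrite /flat; case: ifP => _; rewrite ?mulr0 // hornerM hornerX mulrA.
    apply: (le_trans (HC h)).
    have hd : `|h| <= e / (C + 1).
      by near: h; apply: dnbhs0_le; rewrite divr_gt0 // ltr_wpDl.
    apply: (@le_trans _ _ (C * (e / (C + 1)))); first exact: ler_wpM2l.
    rewrite mulrCA ger_pMr // ler_pdivrMr ?mul1r ?ltr_wpDl //; lra.
  apply: DeriveDef; first by apply: cvgP; exact: H.
  rewrite /flat ltxx; exact: cvg_lim H.
Unshelve. all: by end_near. Qed.

Lemma smooth_flat P : smooth1 (flat P).
Proof.
move=> n; elim: n P => [//|n IH] P; exists (flat ('X^2 * (P - P^`()))) => //.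
exact: is_derive_flat.
Qed.

End smooth_functions.

Section real_integrals.
Context d (T : measurableType d) (R : realType) (m : {measure set T -> \bar R}).
Variables (D : set T).
Hypothesis mD : measurable D.
Implicit Types F h : T -> R.

Lemma integrable_bddM F h (M : R) : m.-integrable D (EFin \o F) ->
  measurable_fun D h -> (forall x, D x -> `|h x| <= M) ->
  m.-integrable D (EFin \o (fun x => F x * h x)).
Proof.
move=> Fi mh hM; have mF : measurable_fun D F by apply/measurable_EFinP; case/integrableP: Fi.
apply: le_integrable (integrableZl mD M Fi) => //.
  by apply/measurable_EFinP; exact: measurable_funM.
move=> x Dx; rewrite -!EFinM /= lee_fin normrM mulrC normrM ler_wpM2r //.
exact: le_trans (hM _ Dx) (ler_norm _).
Qed.

(** Dominated convergence: if [F] is orthogonal to functions that tend to the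
    indicator of [E], its integral over [E] vanishes. *)
Lemma integral_cutoff_limit F (h : nat -> T -> R) (E : set T) :
  m.-integrable D (EFin \o F) -> (forall k, measurable_fun D (h k)) ->
  (forall k x, `|h k x| <= 1) -> measurable E -> E `<=` D ->
  {ae m, forall x, h ^~ x @ \oo --> (\1_E x : R)} ->
  (forall k, \int[m]_(x in D) (F x * h k x) = 0) -> \int[m]_(x in E) F x = 0.
Proof.
move=> Fi mh h1 mE ED hE h0.
have mF : measurable_fun D F by apply/measurable_EFinP; case/integrableP: Fi.
have fi : m.-integrable D (abse \o (EFin \o F)) by exact: integrable_abse.
have mE1 : measurable_fun D (\1_E : T -> R) by exact: measurable_indic.
have mf_ k : measurable_fun D (fun x => (F x * h k x)%:E).
  by apply/measurable_EFinP; exact: measurable_funM.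
have mf : measurable_fun D (fun x => (F x * \1_E x)%:E).
  by apply/measurable_EFinP; exact: measurable_funM.
have f_f : {ae m, forall x, D x ->
    (fun k => (F x * h k x)%:E) @ \oo --> (F x * \1_E x)%:E}.
  move: hE; apply: aeS => x Hx _; apply: cvg_EFin; first exact: nearW.
  by apply: cvgM => //; exact: cvg_cst.
have f_g : {ae m, forall x k, D x -> (`|(F x * h k x)%:E| <= `|(F x)%:E|)%E}.
  apply: nearW => x k _; rewrite lee_fin normrM.
  exact: ler_piMr.
have [_ _] := dominated_convergence mD mf_ mf f_f fi f_g.
have -> : [sequence (\int[m]_(x in D) (F x * h n x)%:E)%E]_n = (fun=> 0%E).
  apply/funext => k; have := h0 k; rewrite /Rintegral => H.
  rewrite -[LHS]fineK ?H //; apply: integrable_fin_num => //.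
  by apply: (integrable_bddM (M := 1)).
move=> /(cvg_unique (@ereal_hausdorff R) (cvg_cst 0%E)) H.
rewrite (_ : \int[m]_(x in E) F x = \int[m]_(x in D) (F x * \1_E x)).
  by rewrite /Rintegral -H.
rewrite -[in LHS](setIidr ED) Rintegral_mkcondr; apply: eq_Rintegral => x _.
by rewrite patchE indicE; case: (x \in E); rewrite ?mulr1 ?mulr0.
Qed.

End real_integrals.

Section bumps.
Context {R : realType}.
Local Notation X := (measurableTypeR R).
Local Notation mu1 := (@lebesgue_measure R).

Lemma itv_measure_lty (p q : R) : (mu1 `[p, q] < +oo)%E.
Proof. by rewrite lebesgue_measure_itv; case: ifP; rewrite ?ltry // -EFinB ltry. Qed.

(** Tends to the indicator of the open interval from [p] to [q] as [k] grows;
    the factors [k.+1] push the arguments of [flat] to infinity. *)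
Definition cutoff (p q : R) (k : nat) (t : R) : R :=
  flat 1 (k.+1%:R * t + - (k.+1%:R * p)) * flat 1 (- k.+1%:R * t + k.+1%:R * q).

Lemma smooth_cutoff p q k : smooth1 (cutoff p q k).
Proof. by move=> n; apply: smoothN_mul; apply: smoothN_affine; exact: smooth_flat. Qed.

Let flat1E (t : R) : 0 < t -> flat 1 t = expR (- t^-1).
Proof. by move=> t0; rewrite /flat t0 hornerE mul1r. Qed.

Let flat1_ge0 (t : R) : 0 <= flat 1 t.
Proof. by have [t0|t0] := ltP 0 t; [rewrite flat1E ?expR_ge0|rewrite /flat ltNge t0]. Qed.

Let flat1_le1 (t : R) : flat 1 t <= 1.
Proof.
have [t0|t0] := ltP 0 t; last by rewrite /flat ltNge t0.
by rewrite flat1E // -expR0 ler_expR oppr_le0 invr_ge0 ltW.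
Qed.

Lemma cutoff_ge0 p q k t : 0 <= cutoff p q k t. Proof. exact: mulr_ge0. Qed.

Lemma cutoff_norm_le1 p q k t : `|cutoff p q k t| <= 1.
Proof. by rewrite ger0_norm ?cutoff_ge0 //; apply: mulr_ile1. Qed.

Lemma cutoff_eq0 p q k t : t <= p \/ q <= t -> cutoff p q k t = 0.
Proof.
have k0 : 0 <= k.+1%:R :> R by [].
case=> h; rewrite /cutoff.
  by rewrite {1}/flat ifF ?mul0r //; apply/negbTE; rewrite -leNgt subr_le0 ler_wpM2l.
rewrite mulrC {1}/flat ifF ?mul0r //; apply/negbTE; rewrite -leNgt mulNr addrC.
by rewrite subr_le0 ler_wpM2l.
Qed.

Lemma cutoff_gt0 p q k t : p < t -> t < q -> 0 < cutoff p q k t.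
Proof.
move=> pt tq; have k0 : 0 < k.+1%:R :> R by [].
have h1 : 0 < k.+1%:R * t + - (k.+1%:R * p) by rewrite subr_gt0 ltr_pM2l.
have h2 : 0 < - k.+1%:R * t + k.+1%:R * q by rewrite mulNr addrC subr_gt0 ltr_pM2l.
by rewrite /cutoff !flat1E // mulr_gt0 ?expR_gt0.
Qed.

Let flat1_cvg (x : R) : 0 < x -> (fun k : nat => flat 1 (k.+1%:R * x)) @ \oo --> (1 : R).
Proof.
move=> x0.
have -> : (fun k : nat => flat 1 (k.+1%:R * x)) = (fun k => expR (- (x^-1 * k.+1%:R^-1))).
  by apply/funext => k; rewrite flat1E ?mulr_gt0 // invfM mulrC.
rewrite -[X in _ --> X]expR0 -[in X in _ --> X]oppr0 -(mulr0 x^-1).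
apply: continuous_cvg; first exact: continuous_expR.
apply: cvgN; apply: cvgMr; exact: cvg_harmonic.
Qed.

Lemma cutoff_cvg p q t : (fun k => cutoff p q k t) @ \oo --> (\1_(`]p, q[%classic) t : R).
Proof.
rewrite indicE; case: (boolP (t \in _)) => [/set_mem|/negP ht].
  rewrite /= in_itv /= => /andP[pt tq].
  rewrite -[X in _ --> X](mulr1 1) /cutoff; apply: cvgM.
    rewrite (_ : (fun k : nat => _) = (fun k : nat => flat 1 (k.+1%:R * (t - p)))).
      by apply: flat1_cvg; rewrite subr_gt0.
    by apply/funext => k; rewrite mulrBr.
  rewrite (_ : (fun k : nat => _) = (fun k : nat => flat 1 (k.+1%:R * (q - t)))).
    by apply: flat1_cvg; rewrite subr_gt0.
  by apply/funext => k; rewrite mulrBr mulNr addrC.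
rewrite (_ : (fun k => _) = cst 0); first exact: cvg_cst.
apply/funext => k; apply: cutoff_eq0.
have [tp|pt] := leP t p; first by left.
right; rewrite leNgt; apply/negP => tq; apply: ht; apply/mem_set.
by rewrite /= in_itv /= pt.
Qed.

Lemma measurable_smooth (g : R -> R) : smooth1 g -> measurable_fun setT (g : X -> R).
Proof. by move=> sg; apply: continuous_measurable_fun; exact: smooth1_continuous. Qed.

Definition supp_in (p q : R) (g : R -> R) := forall t, t <= p \/ q <= t -> g t = 0.

Lemma supp_in_bounded p q g : smooth1 g -> supp_in p q g ->
  exists2 M, 0 <= M & forall t, `|g t| <= M.
Proof.
move=> sg pq.
have cg : {within `[p, q], continuous g}.
  by apply: continuous_subspaceT; exact: smooth1_continuous.
have /compact_bounded[M [_ HM]] := continuous_compact cg (@segment_compact R p q).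
have M1 : 0 <= `|M| + 1 by rewrite addr_ge0.
exists (`|M| + 1) => // t.
have [tpq|] := boolP (t \in `[p, q]).
  apply: (HM (`|M| + 1)); last by exists t.
  by rewrite (le_lt_trans (ler_norm _)) // ltrDl.
rewrite in_itv /= negb_and -!ltNge => /orP[tp|qt].
  by rewrite pq ?normr0 //; left; exact: ltW.
by rewrite pq ?normr0 //; right; exact: ltW.
Qed.

Lemma supp_in_integrable p q g : smooth1 g -> supp_in p q g ->
  mu1.-integrable setT (EFin \o g).
Proof.
move=> sg pq; have [M M0 HM] := supp_in_bounded sg pq.
have mg := measurable_smooth sg.
have mI : measurable (`[p, q] : set X) by exact: measurable_itv.
have H : mu1.-integrable `[p, q] (EFin \o g).
  have ci : mu1.-integrable `[p, q] (fun=> (M%:E : \bar R)).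
    apply: integrable_cst_lty => //.
    exact: itv_measure_lty.
  apply: le_integrable ci => //.
    by apply/measurable_EFinP; exact: measurable_funTS.
  by move=> t _ /=; rewrite lee_fin (le_trans (HM t)) // ler_norm.
have := (@integrable_mkcond _ X R mu1 `[p, q]%classic (EFin \o g) mI).1 H; apply: eq_integrable => // t _.
rewrite patchE; case: ifPn => //= /negP ht; rewrite pq //.
have [tp|pt] := leP t p; [by left|right; rewrite leNgt; apply/negP => tq].
by apply: ht; apply/mem_set; rewrite /= in_itv /= (ltW pt) ltW.
Qed.

Definition prim (g : R -> R) (t : R) : R := \int[mu1]_(s in `]-oo, t]) g s.

Lemma is_derive_prim p q g : smooth1 g -> supp_in p q g ->
  forall t : R, is_derive t (1 : R) (prim g) (g t).
Proof.
move=> sg pq t.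
have gi : mu1.-integrable [set` Interval -oo%O (BRight (t + 1))] (EFin \o g).
  by apply: integrableS (supp_in_integrable sg pq).
have tt : t < t + 1 by rewrite ltrDl.
have [|d1 d2] := continuous_FTC1 tt gi _ (smooth1_continuous sg (x := t)).
  by rewrite ltNyr.
by apply: DeriveDef => //; rewrite -derive1E.
Qed.

Lemma smooth_prim p q g : smooth1 g -> supp_in p q g -> smooth1 (prim g).
Proof. by move=> sg pq [//|n]; exists g => // t; exact: is_derive_prim pq t. Qed.

Lemma supp_in_prim p q g : smooth1 g -> supp_in p q g -> \int[mu1]_t g t = 0 ->
  supp_in p q (prim g).
Proof.
move=> sg pq g0 t [tp|qt]; rewrite /prim.
  rewrite Rintegral_mkcond (_ : _ \_ _ = cst 0) ?Rintegral_cst ?mul0r //.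
  apply/funext => s; rewrite patchE; case: ifPn => // /set_mem.
  by rewrite /= in_itv /= => st; apply: pq; left; exact: le_trans tp.
rewrite -[RHS]g0 Rintegral_mkcond; apply: eq_Rintegral => s _.
rewrite patchE; case: ifPn => // /negP hs; rewrite pq //; right.
by rewrite leNgt; apply/negP => sq; apply: hs; apply/mem_set; rewrite /= in_itv /= ltW // (lt_le_trans sq).
Qed.

(** [phi] minus the multiple of the unit bump [psi] that makes the integral
    vanish: the primitive of the result then has compact support and is a test
    function. *)
Definition corr (psi phi : R -> R) (t : R) : R := phi t - (\int[mu1]_s phi s) * psi t.

Lemma smooth_corr psi phi : smooth1 psi -> smooth1 phi -> smooth1 (corr psi phi).
Proof.
move=> s1 s2 n.
rewrite (_ : corr psi phi = fun t => phi t + (- \int[mu1]_s phi s) * psi t); last first.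
  by apply/funext => t; rewrite /corr mulNr.
by apply: smoothN_add => //; apply: smoothN_mul => //; exact: smoothN_cst.
Qed.

Lemma supp_in_corr p q psi phi : supp_in p q psi -> supp_in p q phi ->
  supp_in p q (corr psi phi).
Proof. by move=> h1 h2 t ht; rewrite /corr h1 // h2 // mulr0 subr0. Qed.

Lemma integral_corr p q psi phi : smooth1 psi -> smooth1 phi -> supp_in p q psi ->
  supp_in p q phi -> \int[mu1]_t psi t = 1 -> \int[mu1]_t corr psi phi t = 0.
Proof.
move=> s1 s2 h1 h2 psi1.
have i1 := supp_in_integrable s1 h1; have i2 := supp_in_integrable s2 h2.
rewrite RintegralB //; last first.
  exact: (integrableZl measurableT (\int[mu1]_s phi s) i1).
by rewrite RintegralZl // psi1 mulr1 subrr.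
Qed.

Lemma exists_unit_cutoff (p q : R) : p < q ->
  exists psi, [/\ smooth1 psi, supp_in p q psi & \int[mu1]_t psi t = 1].
Proof.
move=> pq; pose I := \int[mu1]_t cutoff p q 0 t.
have sb : supp_in p q (cutoff p q 0) by move=> t; exact: cutoff_eq0.
have bi := supp_in_integrable (smooth_cutoff p q 0) sb.
have I0 : 0 < I.
  rewrite /I -lte_fin fineK; last exact: integrable_fin_num bi.
  have mb : measurable_fun setT (fun t : X => (cutoff p q 0 t)%:E).
    by apply/measurable_EFinP; apply: measurable_smooth; exact: smooth_cutoff.
  apply: (@lt_le_trans _ _ (\int[mu1]_(t in `]p, q[) (cutoff p q 0 t)%:E)%E).
    apply: integral_gt0 => //.
    - exact: measurable_funTS.
    - by move=> t _; rewrite lee_fin cutoff_ge0.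
    - by apply: nearW => t /=; rewrite in_itv /= => /andP[? ?]; rewrite lte_fin cutoff_gt0.
    - apply/eqP => H; have := lebesgue_measure_itv `]p, q[.
      by rewrite [LHS]H /= lte_fin pq -EFinB => -[/esym/eqP]; rewrite subr_eq0 gt_eqF.
  apply: ge0_subset_integral => // t _; rewrite lee_fin cutoff_ge0 //.
exists (fun t => I^-1 * cutoff p q 0 t); split.
- by move=> n; apply: smoothN_mul; [exact: smoothN_cst|exact: smooth_cutoff].
- by move=> t ht; rewrite sb // mulr0.
- by rewrite RintegralZl // mulVf // gt_eqF.
Qed.

End bumps.

(** * Integrating a weak derivative on the line *)

Section volterra.
Context {R : realType}.
Local Notation X := (measurableTypeR R).
Local Notation mu1 := (@lebesgue_measure R).
Variables (g v : X -> R).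
Hypotheses (gi : mu1.-integrable setT (EFin \o g)) (vi : mu1.-integrable setT (EFin \o v)).

Let S : set (X * X) := [set z | z.1 <= z.2].

Let mS : measurable S.
Proof.
have mf : measurable_fun [set: X * X] (fun z : X * X => (z.1 : X)) by exact: measurable_fst.
have mg : measurable_fun [set: X * X] (fun z : X * X => (z.2 : X)) by exact: measurable_snd.
have := measurable_fun_ler mf mg => /(_ measurableT [set true]) H.
by have := H Logic.I; rewrite setTI.
Qed.

Let K (z : X * X) : \bar R := (g z.1 * v z.2 * \1_S z)%:E.

Let mg : measurable_fun setT g. Proof. by apply/measurable_EFinP; case/integrableP: gi. Qed.
Let mv : measurable_fun setT v. Proof. by apply/measurable_EFinP; case/integrableP: vi. Qed.

Let mK : measurable_fun setT K.
Proof.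
apply/measurable_EFinP; apply: measurable_funM; last exact: measurable_indic.
by apply: measurable_funM; apply: measurableT_comp.
Qed.

Let Ki : (mu1 \x mu1)%E.-integrable setT K.
Proof.
apply: (integrable12ltyP mu1 mu1 mK).2.
have vfin : (\int[mu1]_t `|(v t)%:E| < +oo)%E by case/integrableP: vi.
have v0 : (0 <= \int[mu1]_t `|(v t)%:E|)%E by exact: integral_ge0.
have gfin : (\int[mu1]_s `|(g s)%:E| < +oo)%E by case/integrableP: gi.
apply: (@le_lt_trans _ _ (\int[mu1]_s (`|(g s)%:E| * \int[mu1]_t `|(v t)%:E|))%E).
  apply: ge0_le_integral => //.
  - by move=> s _; apply: integral_ge0.
  - have mA : measurable_fun setT (fun z => `|K z|%E) by exact: measurableT_comp.
    exact: (measurable_fun_fubini_tonelli_F _ mA).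
  - apply: emeasurable_funM => //.
    by apply: measurableT_comp => //; exact/measurable_EFinP.
  - move=> s _; rewrite -ge0_integralZl //; last first.
      by apply: measurableT_comp => //; exact/measurable_EFinP.
    apply: ge0_le_integral => //.
    + by apply: measurableT_comp => //; exact: (measurableT_comp mK (measurable_pair1 s)).
    + apply: emeasurable_funM => //.
      by apply: measurableT_comp => //; exact/measurable_EFinP.
    + move=> t _; rewrite /K /= -EFinM lee_fin !normrM; apply: ler_piMr; first exact: mulr_ge0.
      by rewrite indicE; case: (_ \in _); rewrite ?normr1 ?normr0.
rewrite ge0_integralZr //; last by apply: measurableT_comp => //; exact/measurable_EFinP.
rewrite lte_mul_pinfty // ?integral_ge0 // ge0_fin_numE // integral_ge0 //.
Qed.

Let tail (s : R) := \int[mu1]_(t in `[s, +oo[) v t.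
Let head (t : R) := \int[mu1]_(s in `]-oo, t]) g s.

Let KtailE s : (\int[mu1]_t K (s, t))%E = (g s * tail s)%:E.
Proof.
have E t : K (s, t) = ((g s)%:E * ((EFin \o v) \_ `[s, +oo[) t)%E.
  rewrite /K /= patchE indicE.
  have -> : ((s, t) \in S) = (t \in `[s, +oo[%classic).
    by apply/idP/idP; rewrite !inE /S /= in_itv /= andbT.
  by case: ifP => _; rewrite ?mulr1 ?mulr0 ?mule0 // EFinM.
under eq_integral do rewrite E.
have mI : measurable (`[s, +oo[ : set X) by exact: measurable_itv.
have vI : mu1.-integrable `[s, +oo[ (EFin \o v) by exact: integrableS vi.
rewrite integralZl //; last exact: (integrable_mkcond _ mI).1.
rewrite -integral_mkcond EFinM; congr (_ * _)%E.
by rewrite /tail /Rintegral fineK //; exact: integrable_fin_num vI.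
Qed.

Let KheadE t : (\int[mu1]_s K (s, t))%E = (v t * head t)%:E.
Proof.
have E s : K (s, t) = ((v t)%:E * ((EFin \o g) \_ `]-oo, t]) s)%E.
  rewrite /K /= patchE indicE.
  have -> : ((s, t) \in S) = (s \in `]-oo, t]%classic).
    by apply/idP/idP; rewrite !inE /S /= ?in_itv.
  by case: ifP => _; rewrite ?mulr1 ?mulr0 ?mule0 // mulrC EFinM.
under eq_integral do rewrite E.
have mI : measurable (`]-oo, t] : set X) by exact: measurable_itv.
have gI : mu1.-integrable `]-oo, t] (EFin \o g) by exact: integrableS gi.
rewrite integralZl //; last exact: (integrable_mkcond _ mI).1.
rewrite -integral_mkcond EFinM; congr (_ * _)%E.
by rewrite /head /Rintegral fineK //; exact: integrable_fin_num gI.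
Qed.

(** Fubini on the triangle [s <= t]. This integration by parts needs no
    continuity of [v]. *)
Lemma volterra : \int[mu1]_t (v t * \int[mu1]_(s in `]-oo, t]) g s) =
                 \int[mu1]_s (g s * \int[mu1]_(t in `[s, +oo[) v t).
Proof.
rewrite /Rintegral; congr fine.
rewrite -(eq_integral _ _ (fun t _ => KheadE t)) -[RHS](eq_integral _ _ (fun s _ => KtailE s)).
by rewrite -(Fubini Ki).
Qed.

Lemma integrable_volterra : mu1.-integrable setT
  (fun s => (g s * \int[mu1]_(t in `[s, +oo[) v t)%:E).
Proof.
by apply: eq_integrable (integrable_fubini_F Ki) => // s _; rewrite -KtailE.
Qed.

End volterra.

Section ac_of_weak.
Context {R : realType}.
Local Notation X := (measurableTypeR R).
Local Notation mu1 := (@lebesgue_measure R).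

Lemma ae_eq0_of_itv (a b : R) (F : R -> R) : mu1.-integrable `[a, b] (EFin \o F) ->
  (forall p q : rat, a < ratr p -> (ratr p : R) < ratr q -> ratr q < b ->
     \int[mu1]_(x in `[ratr p, ratr q]) F x = 0) ->
  {ae mu1, forall t : X, `[a, b]%classic t -> F t = 0}.
Proof.
move=> Fi F0.
have mI : measurable (`[a, b] : set X) by exact: measurable_itv.
have Fi' : mu1.-integrable setT (EFin \o (F \_ `[a, b])).
  by rewrite -restrict_EFin; apply: (integrable_mkcond _ mI).1.
have ne (c : R) : {ae mu1, forall t : X, t <> c}.
  exists [set c]; split => //; last by move=> t /= /contrapT.
  exact: lebesgue_measure_set1.
have := aeS2 (fun t H1 H2 => conj H1 H2) (ne a) (ne b).
apply: aeS2 (ae_lebesgue_pt_itv Fi' Fi') => t Ht [ta tb] tI.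
have /andP[at_ tb_] : a < t < b.
  move: tI; rewrite /= in_itv /= !le_eqVlt => /andP[/orP[/eqP/esym/ta //|->]].
  by move=> /orP[/eqP/tb //|->].
apply/eqP; rewrite -normr_le0; apply/ler_addgt0Pr => e e0; rewrite add0r.
have [|p [q [/andP[pt tq] Hpq + _]]] := Ht (Num.min e (Num.min (t - a) (b - t))).
  by rewrite !lt_min e0 !subr_gt0 at_.
move: Hpq; rewrite !lt_min => /and3P[_ h1 h2].
have ap : a < ratr p by lra.
have qb : ratr q < b by lra.
have pq : (ratr p : R) < ratr q by lra.
have E : \int[mu1]_(s in `[ratr p, ratr q]) (F \_ `[a, b]) s =
    \int[mu1]_(s in `[ratr p, ratr q]) F s.
  apply: eq_Rintegral => s /set_mem; rewrite /= in_itv /= => /andP[s1 s2].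
  by rewrite patchE mem_set //= in_itv /=; apply/andP; split; lra.
rewrite E F0 // patchE mem_set // mulr0 sub0r normrN.
by move=> /andP[/ltW].
Qed.

Section core.
Variables (p q : R) (u v psi : R -> R).
Hypotheses (pq : p < q) (ui : mu1.-integrable `[p, q] (EFin \o u)).
Hypotheses (vi : mu1.-integrable `[p, q] (EFin \o v)).
Hypotheses (spsi : smooth1 psi) (psipq : supp_in p q psi) (psi1 : \int[mu1]_t psi t = 1).
Hypothesis weak : forall (al be : rat) (k : nat), p < ratr al ->
  (ratr al : R) < ratr be -> ratr be < q ->
  \int[mu1]_(t in `[p, q]) (u t * corr psi (cutoff (ratr al) (ratr be) k) t +
     v t * prim (corr psi (cutoff (ratr al) (ratr be) k)) t) = 0.

Let I : set X := `[p, q]%classic.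
Let mI : measurable I. Proof. exact: measurable_itv. Qed.

Let v0 : X -> R := v \_ I.
Let v0i : mu1.-integrable setT (EFin \o v0).
Proof. by rewrite -restrict_EFin; apply: (integrable_mkcond _ mI).1. Qed.

Let tail (s : R) := \int[mu1]_(t in `[s, +oo[) v0 t.

Let tailE s : I s -> tail s = \int[mu1]_(t in `[s, q]) v t.
Proof.
rewrite /I /= in_itv /= => /andP[ps sq].
rewrite /tail -Rintegral_mkcondr; congr (Rintegral _ _ _).
apply/seteqP; split => t /=; rewrite /I /= !in_itv /= ?andbT.
  by move=> [-> /andP[_ ->]].
by move=> /andP[st tq]; split => //; rewrite tq (le_trans ps).
Qed.

Let taili : mu1.-integrable I (EFin \o tail).
Proof.
have oi : mu1.-integrable setT (EFin \o (\1_I : X -> R)).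
  rewrite (_ : EFin \o _ = (fun=> 1%:E) \_ I).
    apply: (integrable_mkcond _ mI).1; apply: integrable_cst_lty => //.
    exact: itv_measure_lty.
  by apply/funext => t /=; rewrite patchE indicE; case: ifP.
have := integrableS measurableT mI (@subsetT _ _) (integrable_volterra oi v0i).
by apply: eq_integrable => // s sI; rewrite /= indicE sI mul1r.
Qed.

Let h (s : X) := u s + tail s.
Let hi : mu1.-integrable I (EFin \o h).
Proof. exact: (integrableD mI ui taili). Qed.

Let supp_int (g : R -> R) (f : R -> R) : supp_in p q g ->
  \int[mu1]_(t in I) (f t * g t) = \int[mu1]_t (f t * g t).
Proof.
move=> hg; rewrite Rintegral_mkcond; apply: eq_Rintegral => t _.
rewrite patchE; case: ifPn => // /negP ht; rewrite hg ?mulr0 //.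
have [tp|pt] := leP t p; [by left|right; rewrite leNgt; apply/negP => tq].
by apply: ht; apply/mem_set; rewrite /I /= in_itv /= (ltW pt) ltW.
Qed.

Let h_orth (g : R -> R) : smooth1 g -> supp_in p q g ->
  \int[mu1]_(t in I) (u t * g t + v t * prim g t) = 0 ->
  \int[mu1]_t g t = 0 ->
  \int[mu1]_(t in I) (h t * g t) = 0.
Proof.
move=> sg hg w0 g0.
have [M M0 HM] := supp_in_bounded sg hg.
have mg := measurable_smooth sg.
have sG := smooth_prim sg hg; have hG := supp_in_prim sg hg g0.
have [M' M'0 HM'] := supp_in_bounded sG hG.
have mG := measurable_smooth sG.
have ugi : mu1.-integrable I (fun t => (u t * g t)%:E).
  by apply: (integrable_bddM mI ui _ (fun t _ => HM t)); exact: measurable_funTS.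
have vGi : mu1.-integrable I (fun t => (v t * prim g t)%:E).
  by apply: (integrable_bddM mI vi _ (fun t _ => HM' t)); exact: measurable_funTS.
have tgi : mu1.-integrable I (fun t => (tail t * g t)%:E).
  by apply: (integrable_bddM mI taili _ (fun t _ => HM t)); exact: measurable_funTS.
have E : \int[mu1]_(t in I) (v t * prim g t) = \int[mu1]_(t in I) (tail t * g t).
  rewrite supp_int // -supp_int //.
  have gi := supp_in_integrable sg hg.
  rewrite [RHS]supp_int //.
  under [RHS]eq_Rintegral do rewrite mulrC.
  rewrite -[RHS](volterra gi v0i) Rintegral_mkcond; apply: eq_Rintegral => t _.
  by rewrite !patchE /v0 patchE; case: ifP => _; rewrite ?mul0r.
rewrite /h; under eq_Rintegral do rewrite mulrDl.
by rewrite RintegralD // -E -RintegralD.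
Qed.

(** The lemma of du Bois-Reymond. Let [h t] be [u t] plus the integral of [v]
    over [[t, q]]. By [volterra] the weak equation says that [h] is orthogonal
    to all admissible [g] of integral zero. Taking for [g] the correction of a
    cutoff [phi] shows that [h - c] is orthogonal to [phi], where [c] is the
    integral of [h * psi]. *)
Lemma ac_core : exists c, {ae mu1, forall t : X, I t ->
  u t + \int[mu1]_(r in `[t, q]) v r = c}.
Proof.
(* [psi] has integral 1, so [c] is the only possible constant *)
pose c := \int[mu1]_(t in I) (h t * psi t); exists c.
have bdd (g : R -> R) (f : X -> R) : mu1.-integrable I (EFin \o f) -> smooth1 g ->
    supp_in p q g -> mu1.-integrable I (fun t => (f t * g t)%:E).
  move=> fi sg hg; have [M M0 HM] := supp_in_bounded sg hg.
  apply: (integrable_bddM mI fi _ (fun t _ => HM t)).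
  by apply: measurable_funTS; exact: measurable_smooth.
have ci : mu1.-integrable I (EFin \o cst c).
  by apply: integrable_cst_lty => //; exact: itv_measure_lty.
have hci : mu1.-integrable I (EFin \o (fun t => h t - c)) by exact: (integrableB mI hi ci).
suff H : {ae mu1, forall t : X, I t -> h t - c = 0}.
  move: H; apply: aeS => t H It; have /eqP := H It.
  by rewrite subr_eq0 => /eqP <-; rewrite /h tailE.
apply: (ae_eq0_of_itv hci) => al be pal albe beq.
have sub (A : set X) : measurable A -> A `<=` `[ratr al, ratr be]%classic ->
    mu1.-integrable A (EFin \o (fun t => h t - c)).
  move=> mA AI; apply: integrableS hci => // t /AI; rewrite /I /= !in_itv /=.
  by move=> /andP[h1 h2]; apply/andP; split; [exact/ltW/(lt_le_trans pal)|exact/ltW/(le_lt_trans h2)].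
rewrite -Rintegral_itv_obnd_cbnd; last first.
  by apply: sub => // t /=; rewrite !in_itv /= => /andP[/ltW -> ->].
rewrite -Rintegral_itv_bndo_bndc; last first.
  by apply: sub => // t /=; rewrite !in_itv /= => /andP[/ltW -> /ltW ->].
apply: (@integral_cutoff_limit _ _ _ mu1 I mI (fun t => h t - c)
  (fun k => cutoff (ratr al) (ratr be) k)) => //.
- by move=> k; apply: measurable_funTS; apply: measurable_smooth; exact: smooth_cutoff.
- by move=> k x; exact: cutoff_norm_le1.
- move=> t; rewrite /I /= !in_itv /= => /andP[h1 h2].
  by apply/andP; split; [exact/ltW/(lt_trans pal)|exact/ltW/(lt_trans h2)].
- by apply: nearW => t; exact: cutoff_cvg.
move=> k; set phi := cutoff _ _ k.
have sphi : smooth1 phi by exact: smooth_cutoff.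
have hphi : supp_in p q phi.
  move=> t [tp|qt]; apply: cutoff_eq0; [left|right].
    by rewrite (le_trans tp) // ltW.
  by rewrite (le_trans _ qt) // ltW.
have h0 := h_orth (smooth_corr spsi sphi) (supp_in_corr psipq hphi) (weak k pal albe beq)
  (integral_corr spsi sphi psipq hphi psi1).
set i := \int[mu1]_t phi t in h0 *.
have iE : \int[mu1]_(t in I) (cst c t * phi t) = c * i.
  by rewrite supp_int // RintegralZl //; exact: supp_in_integrable sphi hphi.
have hpsi := bdd _ _ hi spsi psipq; have hph := bdd _ _ hi sphi hphi.
have E : \int[mu1]_(t in I) (h t * corr psi phi t) =
    \int[mu1]_(t in I) (h t * phi t) - i * c.
  rewrite /c -RintegralZl // -RintegralB //.
    by apply: eq_Rintegral => t _; rewrite /corr -/i; ring.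
  exact: (integrableZl mI i hpsi).
move: h0; rewrite E => /eqP; rewrite subr_eq0 => /eqP E2.
have -> : \int[mu1]_(t in I) ((h t - c) * phi t) =
    \int[mu1]_(t in I) (h t * phi t) - \int[mu1]_(t in I) (cst c t * phi t).
  rewrite -RintegralB //; last exact: bdd ci sphi hphi.
  by apply: eq_Rintegral => t _; rewrite mulrBl.
by rewrite iE E2 mulrC subrr.
Qed.

End core.

Lemma approach_right (a p0 : R) : a < p0 -> exists p : nat -> R,
  (forall k, a < p k < p0) /\
  forall s, a < s -> exists K, forall k, (K <= k)%N -> p k < s.
Proof.
move=> ap; have d0 : 0 < p0 - a by rewrite subr_gt0.
exists (fun k => a + (p0 - a) / k.+2%:R); split=> [k|s as_].
  rewrite ltrDl divr_gt0 //= -ltrBrDl ltr_pdivrMr // ltr_pMr // ltr1n //.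
have e0 : 0 < (s - a) / (p0 - a) by rewrite divr_gt0 // subr_gt0.
exists (Num.bound ((s - a) / (p0 - a))^-1) => k Kk.
rewrite -ltrBrDl -ltr_pdivlMl // mulrC -[ltRHS]invrK ltf_pV2 ?posrE ?invr_gt0 //.
apply: (lt_trans (archi_boundP _)); first by rewrite invr_ge0 ltW.
by rewrite ltr_nat ltnS; exact: leqW.
Qed.

Lemma approach_left (b q0 : R) : q0 < b -> exists q : nat -> R,
  (forall k, q0 < q k < b) /\
  forall s, s < b -> exists K, forall k, (K <= k)%N -> s < q k.
Proof.
move=> qb; have [|p [pk plim]] := @approach_right (- b) (- q0); first by rewrite ltrN2.
exists (fun k => - p k); split=> [k|s sb].
  by have /andP[h1 h2] := pk k; rewrite ltrNr h2 ltrNl h1.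
have [|K HK] := plim (- s); first by rewrite ltrN2.
by exists K => k Kk; rewrite ltrNr; exact: HK.
Qed.

(** The weak equation is required for countably many test functions only,
    because each of them costs a null set of lines when the lemma is applied
    to almost every line. The integrability of [v] may fail at the endpoints,
    so [ac_core] is applied on an increasing sequence of intervals. *)
Lemma ac_line_of_weak (a b p0 q0 : R) (u v psi : R -> R) :
  a < p0 -> p0 < q0 -> q0 < b ->
  mu1.-integrable `[a, b] (EFin \o u) ->
  (forall s t, a < s -> t < b -> mu1.-integrable `[s, t] (EFin \o v)) ->
  smooth1 psi -> supp_in p0 q0 psi -> \int[mu1]_t psi t = 1 ->
  (forall (al be : rat) (k : nat), a < ratr al -> (ratr al : R) < ratr be -> ratr be < b ->
    \int[mu1]_(t in `[a, b]) (u t * corr psi (cutoff (ratr al) (ratr be) k) t +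
      v t * prim (corr psi (cutoff (ratr al) (ratr be) k)) t) = 0) ->
  ac_line a b u v.
Proof.
move=> ap pq qb ui vi spsi hpsi psi1 weak; split => //.
have [p [pk plim]] := approach_right ap.
have [q [qk qlim]] := approach_left qb.
have core k : exists c, {ae mu1, forall t : X, `[p k, q k]%classic t ->
    u t + \int[mu1]_(r in `[t, q k]) v r = c}.
  have /andP[h1 h2] := pk k; have /andP[h3 h4] := qk k.
  have hpsi' : supp_in (p k) (q k) psi.
    by move=> t [tp|qt]; apply: hpsi; [left|right]; lra.
  apply: (ac_core (psi := psi)) => //.
  - by apply: integrableS ui => // t /=; rewrite !in_itv /= => /andP[? ?]; apply/andP; split; lra.
  - exact: vi.
  - move=> al be l pal albe beq.
    have := weak al be l (lt_trans h1 pal) albe (lt_trans beq h4).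
    set phi := cutoff _ _ l.
    have sphi : smooth1 phi by exact: smooth_cutoff.
    have hphi : supp_in (p k) (q k) phi.
      by move=> t [tp|qt]; apply: cutoff_eq0; [left|right]; lra.
    have sg := smooth_corr spsi sphi; have hg := supp_in_corr hpsi' hphi.
    have hG := supp_in_prim sg hg (integral_corr spsi sphi hpsi' hphi psi1).
    rewrite Rintegral_mkcond [in X in _ -> X]Rintegral_mkcond => <-.
    apply: eq_Rintegral => t _; rewrite !patchE.
    case: ifPn => [/set_mem|/negP ht].
      rewrite /= in_itv /= => /andP[t1 t2]; rewrite mem_set //= in_itv /=.
      by apply/andP; split; lra.
    case: ifPn => // _; rewrite hg ?hG ?mulr0 ?addr0 //.
      have [tp|pt] := leP t (p k); [by left|right; rewrite leNgt; apply/negP => tq].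
      by apply: ht; apply/mem_set; rewrite /= in_itv /= (ltW pt) ltW.
    have [tp|pt] := leP t (p k); [by left|right; rewrite leNgt; apply/negP => tq].
    by apply: ht; apply/mem_set; rewrite /= in_itv /= (ltW pt) ltW.
have [c Hc] := choice core.
have Hall : {ae mu1, forall t : X, forall k, `[p k, q k]%classic t ->
    u t + \int[mu1]_(r in `[t, q k]) v r = c k} by exact: ae_countable.
exists (~` [set t : X | forall k, `[p k, q k]%classic t ->
    u t + \int[mu1]_(r in `[t, q k]) v r = c k]); first exact: Hall.
move=> s t /contrapT Hs /contrapT Ht as_ st tb.
have [K1 HK1] := plim s as_; have [K2 HK2] := qlim t tb.
pose k := maxn K1 K2.
have ks : p k < s by apply: HK1; exact: leq_maxl.
have kt : t < q k by apply: HK2; exact: leq_maxr.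
have /andP[h1 h2] := pk k; have /andP[h3 h4] := qk k.
have sI : `[p k, q k]%classic s.
  by rewrite /= in_itv /= (ltW ks) ltW // (lt_trans st).
have tI : `[p k, q k]%classic t.
  by rewrite /= in_itv /= (ltW kt) andbT ltW // (lt_trans ks).
have E := Rintegral_itv_split (ltW st) (ltW kt) (vi s (q k) as_ h4).
have H := Hs k sI; rewrite E -(Ht k tI) in H.
apply/eqP; rewrite subr_eq addrC; apply/eqP.
by apply: (addIr (\int[mu1]_(r in `[t, q k]) v r)); rewrite -H addrA.
Qed.

End ac_of_weak.

(** * Tensor product test functions *)

Section tensor.
Context {R : realType} {n : nat}.
Implicit Types (gam : 'I_n -> R -> R) (x : 'rV[R]_n).

Definition tens gam x : R := \prod_i gam i (x ord0 i).

Let upd gam (i : 'I_n) (f : R -> R) k := if k == i then f else gam k.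

Let tens_split gam i x :
  tens gam x = (\prod_(k | k != i) gam k (x ord0 k)) * gam i (x ord0 i).
Proof. by rewrite /tens (bigD1 i) //= mulrC. Qed.

Lemma is_derive_tens gam (i : 'I_n) x : (forall k, smooth1 (gam k)) ->
  is_derive x (delta_mx ord0 i : 'rV[R]_n) (tens gam)
    (tens (upd gam i (derive1 (gam i))) x).
Proof.
move=> sg; pose c := \prod_(k | k != i) gam k (x ord0 k).
have E (h : R) : h^-1 *: ((tens gam \o shift x) (h *: (delta_mx ord0 i : 'rV[R]_n)) - tens gam x) =
    c *: (h^-1 *: ((gam i \o shift (x ord0 i)) (h *: (1 : R)) - gam i (x ord0 i))).
  rewrite /= !(tens_split _ i).
  have -> : \prod_(k | k != i) gam k ((h *: (delta_mx ord0 i : 'rV[R]_n) + x) ord0 k) = c.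
    apply: eq_bigr => k ki; rewrite !mxE eqxx /= (negbTE ki).
    by rewrite mulr0 add0r.
  rewrite !mxE !eqxx /= mulr1 /GRing.scale /= mulr1 -/c; ring.
have d1 := smooth1_derivative (sg i) (x ord0 i).
have v1 : tens (upd gam i (derive1 (gam i))) x = c *: derive1 (gam i) (x ord0 i).
  rewrite (tens_split _ i) /upd eqxx; congr (_ * _).
  by apply: eq_bigr => k /negbTE ->.
have H : (fun h : R => h^-1 *: ((tens gam \o shift x) (h *: (delta_mx ord0 i : 'rV[R]_n)) - tens gam x))
   @ 0^' --> tens (upd gam i (derive1 (gam i))) x.
  under eq_fun do rewrite E.
  rewrite v1; apply: cvgZl_tmp.
  have d2 : derivable (gam i) (x ord0 i) 1 := @ex_derive _ _ _ _ _ _ _ d1.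
  rewrite derive1E; exact: d2.
by apply: DeriveDef; [exact: cvgP H|exact: cvg_lim H].
Qed.

Lemma partial_tens gam i : (forall k, smooth1 (gam k)) ->
  partial i (tens gam) = tens (upd gam i (derive1 (gam i))).
Proof.
by move=> sg; apply/funext => x; apply: derive_val; exact: is_derive_tens.
Qed.

Lemma foldr_partial_tens gam s : (forall k, smooth1 (gam k)) ->
  foldr partial (tens gam) s = tens (fun i => derive1n (count_mem i s) (gam i)).
Proof.
move=> sg; elim: s => [//|i s IH] /=; rewrite IH partial_tens; last first.
  by move=> k; exact: smooth1_derive1n.
apply/funext => x; apply: eq_bigr => k _; rewrite /upd eq_sym.
by case: eqP => [<-|_]; rewrite ?add1n ?derive1nS.
Qed.

Lemma continuous_prodf (I : Type) (s : seq I) (T : topologicalType) (f : I -> T -> R) :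
  (forall i, continuous (f i)) -> continuous (fun z : T => \prod_(i <- s) f i z).
Proof.
move=> cf; elim: s => [|i s IH] z.
  by under eq_fun do rewrite big_nil; exact: cvg_cst.
by under eq_fun do rewrite big_cons; apply: cvgM; [exact: cf|exact: IH].
Qed.

Lemma continuous_tens gam : (forall k, smooth1 (gam k)) -> continuous (tens gam).
Proof.
move=> sg; apply: continuous_prodf => i x.
apply: (@continuous_comp _ _ _ (fun x : 'rV[R]_n => x ord0 i) (gam i)).
  exact: coord_continuous.
exact: smooth1_continuous.
Qed.

Lemma smooth_tens gam : (forall k, smooth1 (gam k)) -> smooth (tens gam).
Proof.
move=> sg s; rewrite foldr_partial_tens //.
have sd k : smooth1 (derive1n (count_mem k s) (gam k)) by exact: smooth1_derive1n.
split; first exact: continuous_tens.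
by move=> i x; apply: ex_derive; exact: is_derive_tens.
Qed.

Lemma rect_interior (a b p q : 'rV[R]_n) :
  (forall i, a ord0 i < p ord0 i) -> (forall i, q ord0 i < b ord0 i) ->
  rect p q `<=` (rect a b)°.
Proof.
move=> ap qb x xpq.
have [e e0 He] := @pos_family R n
  (fun i => Num.min (p ord0 i - a ord0 i) (b ord0 i - q ord0 i))
  (fun i => ltac:(by rewrite lt_min !subr_gt0 ap qb)).
apply/nbhs_ballP; exists e => //= z [_ xz] i.
have := He i; rewrite le_min => /andP[h1 h2].
have := xz ord0 i; rewrite /ball /= ltr_norml => /andP[h3 h4].
by have /andP[h5 h6] := xpq i; apply/andP; split; lra.
Qed.

Lemma test_function_tens (a b p q : 'rV[R]_n) gam :
  (forall i, a ord0 i < p ord0 i) -> (forall i, q ord0 i < b ord0 i) ->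
  (forall k, smooth1 (gam k)) -> (forall k, supp_in (p ord0 k) (q ord0 k) (gam k)) ->
  test_function (rect a b)° (tens gam).
Proof.
move=> ap qb sg hg; split; first exact: smooth_tens.
exists (rect p q); split; first exact: compact_rect.
  exact: rect_interior.
move=> x Hx; have [k Hk] : exists k, ~~ (p ord0 k <= x ord0 k <= q ord0 k).
  by apply: contrapT => H; apply: Hx => i; apply: contrapT => /negP Hi; apply: H; exists i.
rewrite /tens (bigD1 k) //= hg ?mul0r //.
by move: Hk; rewrite negb_and -!ltNge => /orP[]/ltW; [left|right].
Qed.

End tensor.

(** * Absolute continuity on almost every line *)

Lemma cvg_prodf (R : realType) (I : Type) (s : seq I) (f : I -> nat -> R) (l : I -> R) :
  (forall i, f i @ \oo --> l i) -> (fun k => \prod_(i <- s) f i k) @ \oo --> \prod_(i <- s) l i.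
Proof.
move=> cf; elim: s => [|i s IH].
  by under eq_fun do rewrite big_nil; rewrite big_nil; exact: cvg_cst.
by under eq_fun do rewrite big_cons; rewrite big_cons; apply: cvgM; [exact: cf|exact: IH].
Qed.

Lemma ae_eq_Rintegral d (T : measurableType d) (R : realType) (m : {measure set T -> \bar R})
    (D : set T) (f g : T -> R) : measurable D ->
  measurable_fun D f -> measurable_fun D g -> {ae m, forall x, D x -> f x = g x} ->
  \int[m]_(x in D) f x = \int[m]_(x in D) g x.
Proof.
move=> mD mf mg H; congr fine; apply: ae_eq_integral => //.
- exact/measurable_EFinP.
- exact/measurable_EFinP.
- by move: H; apply: aeS => x Hx /Hx ->.
Qed.

Section weak_on_lines.
Context {R : realType} {m : nat}.
Local Notation X := (measurableTypeR R).
Local Notation mu1 := (@lebesgue_measure R).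
Local Notation mu := (@lebesgue_rV R).
Variables (j : 'I_m.+1) (a b : 'rV[R]_m.+1) (u v : 'rV[R]_m.+1 -> R).
Hypothesis ab : forall i, a ord0 i < b ord0 i.
Hypotheses (mu_ : measurable_fun setT u) (mv : measurable_fun setT v).
Hypothesis ui : (mu m.+1).-integrable (rect a b) (EFin \o u).
Hypothesis dvi : (mu m.+1).-integrable (rect a b)
  (EFin \o (fun x => dist_faces a b j x * v x)).
Hypothesis weak : forall phi, test_function (rect a b)° phi ->
  (\int[mu m.+1]_(x in rect a b) (u x * partial j phi x)%:E =
   - \int[mu m.+1]_(x in rect a b) (v x * phi x)%:E)%E.

Let a' := col' j a.
Let b' := col' j b.
Let mr := @measurable_rect R m.+1 a b.

Section fixed_test.
Variables (p q : R) (g : R -> R).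
Hypotheses (ap : a ord0 j < p) (pq : p < q) (qb : q < b ord0 j).
Hypotheses (sg : smooth1 g) (hg : supp_in p q g) (hG : supp_in p q (prim g)).

Let sG : smooth1 (prim g). Proof. exact: smooth_prim hg. Qed.

Let H (x : 'rV[R]_m.+1) := u x * g (x ord0 j) + v x * prim g (x ord0 j).

Let mcomp (f : R -> R) : smooth1 f ->
  measurable_fun setT (fun x : 'rV[R]_m.+1 => f (x ord0 j)).
Proof.
by move=> sf; exact: (measurableT_comp (measurable_smooth sf) (measurable_coord j)).
Qed.

Let ugi : (mu m.+1).-integrable (rect a b) (EFin \o (fun x => u x * g (x ord0 j))).
Proof.
have [M M0 HM] := supp_in_bounded sg hg.
apply: (integrable_bddM mr ui (M := M)) => //.
exact: measurable_funTS (mcomp sg).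
Qed.

Let mdist : measurable_fun setT (dist_faces a b j : 'rV[R]_m.+1 -> R).
Proof.
by apply: measurable_minr; apply: measurable_funB => //; exact: measurable_coord.
Qed.

Let dist_ge0 (x : 'rV[R]_m.+1) : rect a b x -> 0 <= dist_faces a b j x.
Proof.
by move=> xr; have /andP[h1 h2] := xr j; rewrite /dist_faces le_min !subr_ge0 h1 h2.
Qed.

(** [v] is integrable after multiplication by the distance to the faces, and
    this distance is at least [de] on the support of [prim g]. *)
Let vGi : (mu m.+1).-integrable (rect a b) (EFin \o (fun x => v x * prim g (x ord0 j))).
Proof.
have [M M0 HM] := supp_in_bounded sG hG.
pose de : R := Num.min (p - a ord0 j) (b ord0 j - q).
have de0 : 0 < de by rewrite lt_min !subr_gt0 ap qb.
have de_le (x : 'rV[R]_m.+1) : p < x ord0 j -> x ord0 j < q -> de <= dist_faces a b j x.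
  move=> h1 h2; rewrite /de /dist_faces le_min !ge_min.
  by apply/andP; split; apply/orP; [right|left]; lra.
pose h (x : 'rV[R]_m.+1) := prim g (x ord0 j) * (dist_faces a b j x)^-1.
have mh : measurable_fun (rect a b) h.
  apply: measurable_funM; first exact: measurable_funTS (mcomp sG).
  have H1 : {in rect a b, (fun x => (Num.max 0 (dist_faces a b j x))^-1) =1
     (fun x => (dist_faces a b j x)^-1)}.
    by move=> x /set_mem xr; rewrite (max_idPr _) // dist_ge0.
  apply: (eq_measurable_fun _ H1); apply: measurable_funTS.
  apply: measurable_funV => [x|]; first by rewrite le_max lexx.
  by apply: measurable_maxr => //; exact: measurable_cst.
have E : {in rect a b, (fun x => ((dist_faces a b j x * v x) * h x)%:E) =1
    (fun x => (v x * prim g (x ord0 j))%:E)}.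
  move=> x /set_mem xr; congr (_%:E); rewrite /h.
  have [xp|px] := leP (x ord0 j) p; first by rewrite hG ?mul0r ?mulr0 //; left.
  have [qx|xq] := leP q (x ord0 j); first by rewrite hG ?mul0r ?mulr0 //; right.
  by field; rewrite gt_eqF // (lt_le_trans de0) // de_le.
suff K : (mu m.+1).-integrable (rect a b)
    (EFin \o (fun x => (dist_faces a b j x * v x) * h x)).
  by apply: eq_integrable K => // x xr; exact: E.
apply: (integrable_bddM mr dvi mh (M := M / de)).
move=> x xr; rewrite /h normrM.
have [xp|px] := leP (x ord0 j) p.
  by rewrite hG ?normr0 ?mul0r ?divr_ge0 // ?(ltW de0) //; left.
have [qx|xq] := leP q (x ord0 j).
  by rewrite hG ?normr0 ?mul0r ?divr_ge0 // ?(ltW de0) //; right.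
apply: ler_pM => //; rewrite normfV gtr0_norm.
  by rewrite lef_pV2 ?posrE // ?(lt_le_trans de0) // de_le.
by rewrite (lt_le_trans de0) // de_le.
Qed.

Let Hi : (mu m.+1).-integrable (rect a b) (EFin \o H).
Proof. exact: (integrableD mr ugi vGi). Qed.

Let F (y : 'rV[R]_m) := \int[mu1]_(t in `[a ord0 j, b ord0 j]) H (insert_coord j t y).

Let Fi : (mu m).-integrable (rect a' b') (EFin \o F).
Proof. exact: integrable_rect_coord Hi. Qed.

Let F_orth (al be : 'rV[R]_m) (k : nat) : strictly_inside a' b' al be ->
  \int[mu m]_(y in rect a' b')
    (F y * tens (fun i => cutoff (al ord0 i) (be ord0 i) k) y) = 0.
Proof.
move=> Hab; set eta := tens _.
pose gam i := oapp (fun i => cutoff (al ord0 i) (be ord0 i) k) (prim g) (unlift j i).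
have gamj : gam j = prim g by rewrite /gam unlift_none.
have gaml i : gam (lift j i) = cutoff (al ord0 i) (be ord0 i) k by rewrite /gam liftK.
have sgam i : smooth1 (gam i).
  by case: (unliftP j i) => [l|] ->; rewrite ?gaml ?gamj //; exact: smooth_cutoff.
have meta : measurable_fun setT eta.
  rewrite /eta /tens; apply: measurable_prod => i _.
  exact: (measurableT_comp (measurable_smooth (smooth_cutoff _ _ _)) (measurable_coord i)).
have etax (x : 'rV[R]_m.+1) : tens gam x = prim g (x ord0 j) * eta (col' j x).
  rewrite /tens (bigD1_ord j) //= gamj; congr (_ * _).
  by apply: eq_bigr => i _; rewrite gaml mxE.
have eta1 y : `|eta y| <= 1.
  rewrite /eta /tens normr_prod; apply: prodr_ile1 => i _.
  by rewrite normr_ge0 cutoff_norm_le1.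
have partx (x : 'rV[R]_m.+1) : partial j (tens gam) x = g (x ord0 j) * eta (col' j x).
  rewrite partial_tens // /tens (bigD1_ord j) //= eqxx gamj; congr (_ * _).
    by rewrite derive1E; apply: derive_val; exact: is_derive_prim hg _.
  by apply: eq_bigr => i _; rewrite eq_sym (negbTE (neq_lift _ _)) gaml mxE.
have tf : test_function (rect a b)° (tens gam).
  apply: (@test_function_tens _ _ a b (@insert_coord R m.+1 j p al)
    (@insert_coord R m.+1 j q be)) => // i.
  - case: (unliftP j i) => [l|] ->; rewrite ?insert_coord_lift ?insert_coordE //.
    by have [] := Hab l; rewrite mxE.
  - case: (unliftP j i) => [l|] ->; rewrite ?insert_coord_lift ?insert_coordE //.
    by have [_ _] := Hab l; rewrite mxE.
  - case: (unliftP j i) => [l|] ->; rewrite ?insert_coord_lift ?insert_coordE ?gamj //.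
    by rewrite gaml => t; exact: cutoff_eq0.
have metac : measurable_fun setT (fun x : 'rV[R]_m.+1 => eta (col' j x)).
  exact: (measurableT_comp meta (measurable_col' j)).
have etai (f : 'rV[R]_m.+1 -> R) : (mu m.+1).-integrable (rect a b) (EFin \o f) ->
    (mu m.+1).-integrable (rect a b) (EFin \o (fun x => f x * eta (col' j x))).
  move=> fi; apply: (integrable_bddM mr fi (M := 1)) => //.
  exact: measurable_funTS metac.
have W0 : \int[mu m.+1]_(x in rect a b) (H x * eta (col' j x)) = 0.
  have -> : \int[mu m.+1]_(x in rect a b) (H x * eta (col' j x)) =
     \int[mu m.+1]_(x in rect a b) (u x * g (x ord0 j) * eta (col' j x)) +
     \int[mu m.+1]_(x in rect a b) (v x * prim g (x ord0 j) * eta (col' j x)).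
    rewrite -RintegralD //; [|exact: etai ugi|exact: etai vGi].
    by apply: eq_Rintegral => x _; rewrite /H mulrDl.
  have := weak tf.
  under eq_integral do rewrite partx mulrA.
  under [X in _ = (- X)%E]eq_integral do rewrite etax mulrA.
  rewrite /Rintegral => ->; rewrite fineN addNr //.
rewrite -[RHS]W0 (Rfubini_rect_coord j (etai _ Hi)) -/a' -/b'.
have mF := @measurable_rect R m a' b'.
apply: ae_eq_Rintegral => //.
- apply: measurable_funM; first by apply/measurable_EFinP; case/integrableP: Fi.
  exact: measurable_funTS.
- have := integrable_rect_coord j (etai _ Hi) => /integrableP[+ _].
  by move/measurable_EFinP.
move: (ae_integrable_rect_coord j Hi); apply: aeS => y Hy /Hy {}Hy.
under [RHS]eq_Rintegral do rewrite col'_insert_coord.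
by rewrite RintegralZr.
Qed.

(** The weak equation is tested with the product of [prim g] in the coordinate
    [j] and of cutoffs in the other coordinates. When the cutoffs tend to the
    indicator of a rectangle, the integral of [F] over this rectangle
    vanishes. *)
Lemma weak_on_lines_fixed : {ae mu m, forall y, rect a' b' y -> F y = 0}.
Proof.
apply: (ae_eq0_of_rect Fi) => al be Hab.
apply: (@integral_cutoff_limit _ _ _ (mu m) _ (@measurable_rect R m a' b') F
  (fun k => tens (fun i => cutoff (al ord0 i) (be ord0 i) k))) => //.
- move=> k; apply: measurable_funTS; apply: measurable_prod => i _.
  exact: (measurableT_comp (measurable_smooth (smooth_cutoff _ _ _)) (measurable_coord i)).
- move=> k x; rewrite /tens normr_prod; apply: prodr_ile1 => i _.
  by rewrite normr_ge0 cutoff_norm_le1.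
- exact: measurable_rect.
- exact: strictly_inside_rect.
- move: (ae_strict_rect al be); apply: aeS => y Hy.
  have -> : \1_(rect al be) y = \prod_i \1_(`]al ord0 i, be ord0 i[%classic) (y ord0 i) :> R.
    rewrite indicE; case: (boolP (y \in _)) => [/set_mem/Hy yab|/negP ny].
      by rewrite big1 // => i _; rewrite indicE mem_set //= in_itv /= yab.
    have [i Hi'] : exists i, ~~ (al ord0 i <= y ord0 i <= be ord0 i).
      apply: contrapT => N; apply: ny; apply/mem_set => i.
      by apply: contrapT => /negP ?; apply: N; exists i.
    rewrite (bigD1 i) //= indicE memNset ?mul0r //= in_itv /= => /andP[h1 h2].
    by move: Hi'; rewrite !ltW.
  by apply: cvg_prodf => i; exact: cutoff_cvg.
- by move=> k; exact: F_orth.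
Qed.

End fixed_test.

(** Countably many test functions in the coordinate [j] determine absolute
    continuity on a line, so the exceptional lines form a null set. *)
Lemma ae_ac_line : {ae mu m, forall y, rect a' b' y ->
  ac_line (a ord0 j) (b ord0 j) (fun t => u (insert_coord j t y))
    (fun t => v (insert_coord j t y))}.
Proof.
have h : 0 < b ord0 j - a ord0 j by rewrite subr_gt0.
pose p0 := a ord0 j + (b ord0 j - a ord0 j) / 3.
pose q0 := a ord0 j + (b ord0 j - a ord0 j) / 2.
have ap0 : a ord0 j < p0 by rewrite ltrDl divr_gt0.
have pq0 : p0 < q0 by rewrite /p0 /q0; lra.
have qb0 : q0 < b ord0 j by rewrite /q0; lra.
have [psi [spsi hpsi psi1]] := exists_unit_cutoff pq0.
have Hae : {ae mu m, forall y, forall abk : rat * rat * nat, rect a' b' y ->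
    a ord0 j < ratr abk.1.1 -> (ratr abk.1.1 : R) < ratr abk.1.2 -> ratr abk.1.2 < b ord0 j ->
    \int[mu1]_(t in `[a ord0 j, b ord0 j]) (u (insert_coord j t y) *
       corr psi (cutoff (ratr abk.1.1) (ratr abk.1.2) abk.2) t + v (insert_coord j t y) *
       prim (corr psi (cutoff (ratr abk.1.1) (ratr abk.1.2) abk.2)) t) = 0}.
  apply: ae_countable => -[[al be] k] /=.
  have [hal|hal] := boolP (a ord0 j < ratr al); last first.
    by apply: nearW => y _ /=.
  have [hab|hab] := boolP ((ratr al : R) < ratr be); last first.
    by apply: nearW => y _ _ /=.
  have [hbe|hbe] := boolP (ratr be < b ord0 j); last first.
    by apply: nearW => y _ _ _ /=.
  (* an interval containing the supports of [psi] and of the cutoff *)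
  pose p := Num.min p0 (ratr al); pose q := Num.max q0 (ratr be).
  have pp0 : p <= p0 by rewrite ge_min lexx.
  have pal : p <= ratr al by rewrite ge_min lexx orbT.
  have qq0 : q0 <= q by rewrite le_max lexx.
  have qbe : ratr be <= q by rewrite le_max lexx orbT.
  have ap : a ord0 j < p by rewrite lt_min ap0.
  have qb : q < b ord0 j by rewrite gt_max qb0.
  have pq : p < q by apply: (le_lt_trans pp0); exact: lt_le_trans qq0.
  set phi := cutoff _ _ k.
  have sphi : smooth1 phi by exact: smooth_cutoff.
  have hphi : supp_in p q phi.
    by move=> t [tp|qt]; apply: cutoff_eq0; [left; exact: le_trans pal|right; exact: le_trans qt].
  have hpsi' : supp_in p q psi.
    by move=> t [tp|qt]; apply: hpsi; [left; exact: le_trans pp0|right; exact: le_trans qt].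
  have sg := smooth_corr spsi sphi; have hg := supp_in_corr hpsi' hphi.
  have hG := supp_in_prim sg hg (integral_corr spsi sphi hpsi' hphi psi1).
  move: (weak_on_lines_fixed ap qb sg hg hG); apply: aeS => y Hy yr _ _ _.
  rewrite -[RHS](Hy yr); apply: eq_Rintegral => t _.
  by rewrite insert_coordE.
have H1 := ae_integrable_rect_coord j ui.
have H2 := ae_integrable_rect_coord j dvi.
move: (aeS2 (fun y h1 h2 => conj h1 h2) H1 H2) Hae.
apply: aeS2 => y [uy dvy] Hy yr.
apply: (ac_line_of_weak ap0 pq0 qb0) spsi hpsi psi1 _; first exact: uy.
- move=> s t as_ tb.
  have mI : measurable (`[s, t] : set X) by exact: measurable_itv.
  pose de : R := Num.min (b ord0 j - t) (s - a ord0 j).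
  have de0 : 0 < de by rewrite lt_min !subr_gt0 as_ tb.
  have sub : `[s, t]%classic `<=` `[a ord0 j, b ord0 j]%classic.
    move=> r /=; rewrite !in_itv /= => /andP[h1 h2].
    by apply/andP; split; [exact/ltW/(lt_le_trans as_)|exact/ltW/(le_lt_trans h2)].
  have mI2 : measurable (`[a ord0 j, b ord0 j] : set X) by exact: measurable_itv.
  have := integrableZl mI de^-1 (integrableS mI2 mI sub (dvy yr)).
  apply: le_integrable => //.
    apply/measurable_EFinP; apply: measurable_funTS.
    exact: (measurableT_comp mv (measurable_ins1 j y)).
  move=> r /=; rewrite in_itv /= => /andP[sr rt].
  rewrite lee_fin /dist_faces insert_coordE !normrM normfV (gtr0_norm de0) mulrA.
  apply: ler_peMl => //; rewrite mulrC ler_pdivlMr // mul1r.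
  apply: le_trans (ler_norm _); rewrite /de le_min !ge_min.
  by apply/andP; split; apply/orP; [left|right]; lra.
- move=> al be k h1 h2 h3.
  exact: Hy (al, be, k) yr h1 h2 h3.
Qed.

End weak_on_lines.

(** * Averages in one direction *)

Section measurable_averages.
Context {R : realType} {m : nat}.
Local Notation X := (measurableTypeR R).
Local Notation mu1 := (@lebesgue_measure R).
Local Notation mu := (@lebesgue_rV R).
Variables (j : 'I_m.+1) (f : 'rV[R]_m.+1 -> R).
Hypothesis mf : measurable_fun setT f.

Let mfE (D : set 'rV[R]_m.+1) : measurable D ->
  measurable_fun setT (EFin \o (f \_ D)).
Proof.
move=> mD; rewrite -restrict_EFin; apply/(measurable_restrictT _ mD).
by apply/measurable_EFinP; exact: measurable_funTS.
Qed.

Let measurable_RC (g : 'rV[R]_m.+1 -> \bar R) : measurable_fun setT g ->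
  measurable_fun setT (fun y : 'rV[R]_m => fine (\int[mu1]_t g (insert_coord j t y))).
Proof.
move=> mg; apply: measurableT_comp; first exact: fine_measurable.
have mp : measurable_fun setT (funepos g) by exact: measurable_funepos.
have mn : measurable_fun setT (funeneg g) by exact: measurable_funeneg.
have p0 x : (0 <= funepos g x)%E by exact: funepos_ge0.
have n0 x : (0 <= funeneg g x)%E by exact: funeneg_ge0.
have h1 := measurable_coord_integral j mp p0; have h2 := measurable_coord_integral j mn n0.
move: (emeasurable_funB h1 h2); apply: eq_measurable_fun => y _.
by rewrite [RHS]integralE; congr (_ - _)%E; apply: eq_integral => ? _; rewrite ?funeposE ?funenegE.
Qed.

Let measurable_RS (g : 'rV[R]_m.+1 -> \bar R) : measurable_fun setT g ->
  measurable_fun setT (fun t : X => fine (\int[mu m]_y g (insert_coord j t y))).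
Proof.
move=> mg; apply: measurableT_comp; first exact: fine_measurable.
have mp : measurable_fun setT (funepos g) by exact: measurable_funepos.
have mn : measurable_fun setT (funeneg g) by exact: measurable_funeneg.
have p0 x : (0 <= funepos g x)%E by exact: funepos_ge0.
have n0 x : (0 <= funeneg g x)%E by exact: funeneg_ge0.
have h1 := measurable_slice_integral j mp p0; have h2 := measurable_slice_integral j mn n0.
move: (emeasurable_funB h1 h2); apply: eq_measurable_fun => y _.
by rewrite [RHS]integralE; congr (_ - _)%E; apply: eq_integral => ? _; rewrite ?funeposE ?funenegE.
Qed.

(** Tonelli gives this for nonnegative functions; apply it to the positive and
    negative parts. *)
Lemma measurable_line_integral (s t : R) :
  measurable_fun setT (fun y : 'rV[R]_m =>
    \int[mu1]_(r in `[s, t]) f (insert_coord j r y)).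
Proof.
pose D : set 'rV[R]_m.+1 := (fun x : 'rV[R]_m.+1 => x ord0 j : X) @^-1` `[s, t].
have mD : measurable D.
  rewrite -[X in measurable X]setTI.
  by apply: measurable_coord => //; exact: measurable_itv.
have := measurable_RC (mfE mD); apply: eq_measurable_fun => y _.
rewrite /= [RHS]Rintegral_mkcond; congr fine; apply: eq_integral => r _ /=.
congr (_%:E); rewrite /patch; congr (if _ then _ else _).
by apply/idP/idP; rewrite !inE /D /= insert_coordE.
Qed.

Lemma measurable_face_integral (p q : 'rV[R]_m) :
  measurable_fun setT (fun t : X =>
    \int[mu m]_(y in rect p q) f (insert_coord j t y)).
Proof.
pose D : set 'rV[R]_m.+1 := (fun x : 'rV[R]_m.+1 => col' j x) @^-1` rect p q.
have mD : measurable D.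
  rewrite -[X in measurable X]setTI.
  exact: (measurable_col' j measurableT (measurable_rect p q)).
have := measurable_RS (mfE mD); apply: eq_measurable_fun => t _.
rewrite /= [RHS]Rintegral_mkcond; congr fine; apply: eq_integral => y _ /=.
congr (_%:E); rewrite /patch; congr (if _ then _ else _).
by apply/idP/idP; rewrite !inE /D /= col'_insert_coord.
Qed.

End measurable_averages.

Section weighted.
Context {R : realType} {m : nat}.
Local Notation X := (measurableTypeR R).
Local Notation mu1 := (@lebesgue_measure R).
Local Notation mu := (@lebesgue_rV R).
Variables (w : 'rV[R]_m.+1 -> R) (a b : 'rV[R]_m.+1).
Hypothesis hw : strong_A2 w.
Hypothesis ab : forall i, a ord0 i < b ord0 i.

Let mr := @measurable_rect R m.+1 a b.
Let mw := measurable_weight hw.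

Definition wnorm2 (f : 'rV[R]_m.+1 -> R) : \bar R :=
  \int[mu m.+1]_(x in rect a b) (f x ^+ 2 * w x)%:E.

Lemma wnorm2_ge0 f : (0 <= wnorm2 f)%E.
Proof.
by apply: integral_ge0 => x _; rewrite lee_fin mulr_ge0 ?sqr_ge0 ?weight_ge0.
Qed.

Let w0 x : 0 <= w x. Proof. exact: weight_ge0 hw x. Qed.

Let mfw (f : 'rV[R]_m.+1 -> R) : measurable_fun setT f ->
  measurable_fun setT (fun x => (f x ^+ 2 * w x)%:E).
Proof.
by move=> mf; apply/measurable_EFinP; apply: measurable_funM => //; exact: measurable_funX.
Qed.

Let fw0 (f : 'rV[R]_m.+1 -> R) x : (0 <= (f x ^+ 2 * w x)%:E)%E.
Proof. by rewrite lee_fin mulr_ge0 // sqr_ge0. Qed.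

Lemma wnorm2B_le (f g : 'rV[R]_m.+1 -> R) : measurable_fun setT f -> measurable_fun setT g ->
  (wnorm2 (fun x => f x - g x)%R <= 2%:E * wnorm2 f + 2%:E * wnorm2 g)%E.
Proof. by move=> mf mg; apply: integral_sqrB_le. Qed.

Lemma wL2_cauchy_schwarz (f : 'rV[R]_m.+1 -> R) : measurable_fun setT f ->
  ((\int[mu m.+1]_(x in rect a b) `|f x|%:E) * (\int[mu m.+1]_(x in rect a b) `|f x|%:E) <=
   wnorm2 f * (\int[mu m.+1]_(x in rect a b) (w x)^-1)%:E)%E.
Proof.
move=> mf; have [Vi _] := A2_rect hw ab.
apply: cauchy_schwarz_weight => //.
- exact: measurable_funTS.
- exact: measurable_funTS.
- by move: (weight_gt0 hw); apply: aeS => x.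
- rewrite -lte_fin fineK; last exact: integrable_fin_num Vi.
  apply: integral_gt0 => //.
  + by case/integrableP: Vi.
  + by move=> x _; rewrite lee_fin invr_ge0.
  + by move: (weight_gt0 hw); apply: aeS => x h _; rewrite lte_fin invr_gt0.
  + apply/eqP => H0; have := rect_measureE ab; rewrite [LHS]H0 => -[v0].
    by have := volume_gt0 ab; rewrite -v0 ltxx.
- by rewrite fineK //; exact: integrable_fin_num Vi.
Qed.

(** The weighted L^2 space of a rectangle is contained in L^1, because [w^-1]
    is integrable there. *)
Lemma wL2_integrable (f : 'rV[R]_m.+1 -> R) : measurable_fun setT f -> (wnorm2 f < +oo)%E ->
  (mu m.+1).-integrable (rect a b) (EFin \o f).
Proof.
move=> mf foo; apply/integrableP; split.
  by apply/measurable_EFinP; exact: measurable_funTS.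
have := wL2_cauchy_schwarz mf.
have I0 : (0 <= \int[mu m.+1]_(x in rect a b) `|f x|%:E)%E by exact: integral_ge0.
have := wnorm2_ge0 f; move: foo; case: (wnorm2 f) => // q _ _.
move=> H; rewrite ltey; apply/negP => /eqP E; move: H.
by rewrite [X in (X * _)%E]E [X in (_ * X)%E]E mulyy -EFinM leye_eq.
Qed.

Definition line_avg (i : 'I_m.+1) (f : 'rV[R]_m.+1 -> R) (x : 'rV[R]_m.+1) : R :=
  (\int[mu1]_(t in `[a ord0 i, b ord0 i]) f (insert_coord i t (col' i x))) /
  (b ord0 i - a ord0 i).

Lemma measurable_line_avg i (f : 'rV[R]_m.+1 -> R) : measurable_fun setT f -> measurable_fun setT (line_avg i f).
Proof.
move=> mf; apply: measurable_funM => //.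
exact: (measurableT_comp (measurable_line_integral i mf _ _) (measurable_col' i)).
Qed.

Lemma line_avg_ins i f t y : line_avg i f (insert_coord i t y) =
  (\int[mu1]_(r in `[a ord0 i, b ord0 i]) f (insert_coord i r y)) /
  (b ord0 i - a ord0 i).
Proof. by rewrite /line_avg col'_insert_coord. Qed.

Section direction.
Variable i : 'I_m.+1.
Let a' := col' i a.
Let b' := col' i b.
Let ab' k : a' ord0 k < b' ord0 k. Proof. by rewrite !mxE. Qed.
Let I : set X := `[a ord0 i, b ord0 i]%classic.
Let mI : measurable I. Proof. exact: measurable_itv. Qed.
Let h := b ord0 i - a ord0 i.
Let h0 : 0 < h. Proof. by rewrite subr_gt0. Qed.

Definition good_line (y : 'rV[R]_m) :=
  [/\ {ae mu1, forall t : X, 0 < w (insert_coord i t y)},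
    mu1.-integrable `[a ord0 i, b ord0 i] (fun t => (w (insert_coord i t y))%:E),
    mu1.-integrable `[a ord0 i, b ord0 i] (fun t => ((w (insert_coord i t y))^-1)%:E) &
    (\int[mu1]_(t in `[a ord0 i, b ord0 i]) w (insert_coord i t y)) *
    (\int[mu1]_(t in `[a ord0 i, b ord0 i]) (w (insert_coord i t y))^-1) <=
    A2const w * (b ord0 i - a ord0 i) ^+ 2].

Lemma ae_good_line : {ae mu m, forall y, rect a' b' y -> good_line y}.
Proof.
have H1 := ae_coord i (weight_gt0 hw).
have H2 := ae_integrable_rect_coord i (integrable_weight hw a b).
have H3 := ae_integrable_rect_coord i (f := fun x => (w x)^-1) (A2_rect hw ab).1.
have H4 := A2_line hw i ab' (ab i).
move: (aeS2 (fun y h1 h2 => conj h1 h2) H1 H2) (aeS2 (fun y h1 h2 => conj h1 h2) H3 H4).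
by apply: aeS2 => y [h1 h2] [h3 h4] yr; split => //; [exact: h2|exact: h3|exact: h4].
Qed.

Let inv_gt0 y : good_line y ->
  0 < \int[mu1]_(t in `[a ord0 i, b ord0 i]) (w (insert_coord i t y))^-1.
Proof.
move=> [wp wi Vi _]; rewrite -lte_fin fineK; last exact: integrable_fin_num Vi.
apply: integral_gt0 => //.
- by case/integrableP: Vi.
- by move=> x _; rewrite lee_fin invr_ge0.
- by move: wp; apply: aeS => t wt _; rewrite lte_fin invr_gt0.
- apply/eqP => H; have := lebesgue_measure_itv `[a ord0 i, b ord0 i].
  by rewrite [LHS]H /= lte_fin ab -EFinB => -[/esym/eqP]; rewrite subr_eq0 gt_eqF.
Qed.

Let lineI (y : 'rV[R]_m) : measurable_fun setT (fun t : X => insert_coord i t y : 'rV[R]_m.+1) := measurable_ins1 i y.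

Let mC (k : 'rV[R]_m.+1 -> R) : measurable_fun setT k ->
  measurable_fun (rect a' b') (fun y => \int[mu1]_(t in `[a ord0 i, b ord0 i])
    (k (insert_coord i t y) ^+ 2 * w (insert_coord i t y))%:E)%E.
Proof.
move=> mk; apply: measurable_funTS.
pose D : set 'rV[R]_m.+1 := (fun x : 'rV[R]_m.+1 => x ord0 i : X) @^-1` I.
have mD : measurable D.
  by rewrite -[X in measurable X]setTI; apply: measurable_coord.
have mk' : measurable_fun setT ((fun x => (k x ^+ 2 * w x)%:E) \_ D).
  by apply/(measurable_restrictT _ mD); apply: measurable_funTS; exact: mfw.
have k0 x : (0 <= ((fun x => (k x ^+ 2 * w x)%:E) \_ D) x)%E.
  by rewrite patchE; case: ifP.
have := measurable_coord_integral i mk' k0; apply: eq_measurable_fun => y _.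
rewrite [RHS]integral_mkcond; apply: eq_integral => t _.
rewrite /patch; congr (if _ then _ else _).
by apply/idP/idP; rewrite !inE /D /= insert_coordE.
Qed.

Let mS (k : 'rV[R]_m.+1 -> R) : measurable_fun setT k ->
  measurable_fun I (fun t : X => \int[mu m]_(y in rect a' b')
    (k (insert_coord i t y) ^+ 2 * w (insert_coord i t y))%:E)%E.
Proof.
move=> mk; apply: measurable_funTS.
pose D : set 'rV[R]_m.+1 := (fun x : 'rV[R]_m.+1 => col' i x) @^-1` rect a' b'.
have mD : measurable D.
  rewrite -[X in measurable X]setTI.
  exact: (measurable_col' i measurableT (measurable_rect a' b')).
have mk' : measurable_fun setT ((fun x => (k x ^+ 2 * w x)%:E) \_ D).
  by apply/(measurable_restrictT _ mD); apply: measurable_funTS; exact: mfw.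
have k0 x : (0 <= ((fun x => (k x ^+ 2 * w x)%:E) \_ D) x)%E.
  by rewrite patchE; case: ifP.
have := measurable_slice_integral i mk' k0; apply: eq_measurable_fun => t _.
rewrite [RHS]integral_mkcond; apply: eq_integral => y _.
rewrite /patch; congr (if _ then _ else _).
by apply/idP/idP; rewrite !inE /D /= col'_insert_coord.
Qed.

Lemma wnorm2_le_of_lines (f g : 'rV[R]_m.+1 -> R) (c : R) : measurable_fun setT f ->
  measurable_fun setT g -> 0 <= c ->
  {ae mu m, forall y, rect a' b' y ->
    (\int[mu1]_(t in `[a ord0 i, b ord0 i])
       (f (insert_coord i t y) ^+ 2 * w (insert_coord i t y))%:E <=
     c%:E * \int[mu1]_(t in `[a ord0 i, b ord0 i])
       (g (insert_coord i t y) ^+ 2 * w (insert_coord i t y))%:E)%E} ->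
  (wnorm2 f <= c%:E * wnorm2 g)%E.
Proof.
move=> mf mg c0 H.
rewrite /wnorm2 (ge0_fubini_rect_coord i) //; last exact: mfw.
rewrite [in leRHS](ge0_fubini_rect_coord i) //; last exact: mfw.
rewrite -ge0_integralZl_EFin //; last 3 first.
- exact: measurable_rect.
- by move=> y _; exact: integral_ge0.
- exact: mC.
apply: ae_ge0_le_integral => //.
- exact: measurable_rect.
- by move=> y _; exact: integral_ge0.
- exact: mC.
- by move=> y _; rewrite mule_ge0 ?lee_fin //; exact: integral_ge0.
- by apply: measurable_funeM; exact: mC.
Qed.

Lemma wnorm2_le_of_slices (f g : 'rV[R]_m.+1 -> R) (c : R) : measurable_fun setT f ->
  measurable_fun setT g -> 0 <= c ->
  {ae mu1, forall t : X, `[a ord0 i, b ord0 i]%classic t ->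
    (\int[mu m]_(y in rect a' b')
       (f (insert_coord i t y) ^+ 2 * w (insert_coord i t y))%:E <=
     c%:E * \int[mu m]_(y in rect a' b')
       (g (insert_coord i t y) ^+ 2 * w (insert_coord i t y))%:E)%E} ->
  (wnorm2 f <= c%:E * wnorm2 g)%E.
Proof.
move=> mf mg c0 H.
rewrite /wnorm2 (ge0_fubini_rect_slice i) //; last exact: mfw.
rewrite [in leRHS](ge0_fubini_rect_slice i) //; last exact: mfw.
rewrite -ge0_integralZl_EFin //; last 2 first.
- by move=> y _; exact: integral_ge0.
- exact: mS.
apply: ae_ge0_le_integral => //.
- by move=> y _; exact: integral_ge0.
- exact: mS.
- by move=> y _; rewrite mule_ge0 ?lee_fin //; exact: integral_ge0.
- by apply: measurable_funeM; exact: mS.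
Qed.

(** Averaging a line reduces to [average_bound] on that line, where [w] is an
    A_2 weight. *)
Lemma line_avg_bound (f g : 'rV[R]_m.+1 -> R) : measurable_fun setT f -> measurable_fun setT g ->
  (mu m.+1).-integrable (rect a b) (EFin \o f) ->
  (mu m.+1).-integrable (rect a b) (EFin \o g) ->
  (wnorm2 (fun x => line_avg i f x - line_avg i g x)%R <=
   (A2const w)%:E * wnorm2 (fun x => f x - g x)%R)%E.
Proof.
move=> mf mg fi gi.
apply: wnorm2_le_of_lines.
- by apply: measurable_funB; exact: measurable_line_avg.
- exact: measurable_funB.
- exact: A2const_ge0.
move: ae_good_line (aeS2 (fun y h1 h2 => conj h1 h2)
  (ae_integrable_rect_coord i fi) (ae_integrable_rect_coord i gi)).
apply: aeS2 => y gl [fy gy] yr.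
have {}gl := gl yr; have {}fy := fy yr; have {}gy := gy yr.
have s0 := inv_gt0 gl; case: gl => wp wi Vi A2y.
under eq_integral => t _ do rewrite !line_avg_ins -mulrBl -RintegralB //.
have mfg : measurable_fun I (fun t : X => f (insert_coord i t y) - g (insert_coord i t y))%R.
  by apply: measurable_funTS; apply: measurable_funB;
    exact: (measurableT_comp _ (lineI y)).
have mwl : measurable_fun I (fun t : X => w (insert_coord i t y)).
  by apply: measurable_funTS; exact: (measurableT_comp _ (lineI y)).
apply: (@average_bound _ _ _ mu1 I (fun t => f (insert_coord i t y) - g (insert_coord i t y))%R
  (fun t => w (insert_coord i t y)) mI mfg mwl _ _ h
  (\int[mu1]_(t in `[a ord0 i, b ord0 i]) w (insert_coord i t y))%R
  (\int[mu1]_(t in `[a ord0 i, b ord0 i]) (w (insert_coord i t y))^-1)%R) => //.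
- by move: wp; apply: aeS.
- by rewrite fineK //; exact: integrable_fin_num wi.
- by rewrite fineK //; exact: integrable_fin_num Vi.
Qed.

End direction.

End weighted.

(** * Averages in several directions *)

Lemma lee_mulDD (R : realType) (p q : R) (x y : \bar R) : 0 <= p -> 0 <= q -> (0 <= x)%E -> (0 <= y)%E ->
  (p%:E * x + q%:E * y <= (p + q)%:E * (x + y))%E.
Proof.
move=> p0 q0 x0 y0; rewrite EFinD ge0_muleDl ?lee_fin // !ge0_muleDr //.
rewrite leeD //.
  by rewrite leeDl // mule_ge0 ?lee_fin.
by rewrite leeDr // mule_ge0 ?lee_fin.
Qed.

Section directions.
Context {R : realType} {m : nat}.
Local Notation X := (measurableTypeR R).
Local Notation mu1 := (@lebesgue_measure R).
Local Notation mu := (@lebesgue_rV R).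
Variables (w : 'rV[R]_m.+1 -> R) (a b : 'rV[R]_m.+1).
Hypothesis hw : strong_A2 w.
Hypothesis ab : forall i, a ord0 i < b ord0 i.
Variables (u : 'rV[R]_m.+1 -> R) (v : 'I_m.+1 -> 'rV[R]_m.+1 -> R).
Hypothesis mu_ : measurable_fun setT u.
Hypothesis ui : (mu m.+1).-integrable (rect a b) (EFin \o u).
Hypothesis mv : forall i, measurable_fun setT (v i).

Let A := A2const w.
Let A0 : 0 <= A. Proof. exact: A2const_ge0. Qed.

Definition poincare_const := (2 + 2 * A) * (2 * (4 * (4 * A) ^+ 3)).

Lemma poincare_const_ge0 : 0 <= poincare_const.
Proof.
by rewrite mulr_ge0 ?addr_ge0 ?mulr_ge0 ?exprn_ge0 // mulr_ge0.
Qed.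

Definition weak_identity i := forall phi, test_function (rect a b)° phi ->
  (\int[mu m.+1]_(x in rect a b) (u x * partial i phi x)%:E =
   - \int[mu m.+1]_(x in rect a b) (v i x * phi x)%:E)%E.

Lemma measurable_dist_faces i :
  measurable_fun setT (fun x : 'rV[R]_m.+1 => dist_faces a b i x).
Proof.
have mc := measurable_coord (R := R) i.
rewrite /dist_faces; apply: measurable_minr.
  by apply: measurable_funB.
by apply: measurable_funB.
Qed.

Let dv i := fun x => dist_faces a b i x * v i x.

Let mdv i : measurable_fun setT (dv i).
Proof. by apply: measurable_funM => //; exact: measurable_dist_faces. Qed.

(** The dyadic intervals required by [line_poincare] are the same for all
    lines, so together they exclude a null set of lines. *)
Lemma line_avg_poincare i : weak_identity i -> (wnorm2 w a b (dv i) < +oo)%E ->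
  (wnorm2 w a b (fun x => u x - line_avg a b i u x)%R <=
   poincare_const%:E * wnorm2 w a b (dv i))%E.
Proof.
move=> wi dvoo.
apply: (wnorm2_le_of_lines (i := i) hw) => //.
- by apply: measurable_funB => //; exact: measurable_line_avg.
- exact: poincare_const_ge0.
have dvi := wL2_integrable hw ab (mdv i) dvoo.
have H1 := ae_ac_line ab (mv i) ui dvi wi.
have H2 := ae_good_line hw ab i.
have H3 := ae_integrable_rect_coord i ui.
have ab' k : col' i a ord0 k < col' i b ord0 k by rewrite !mxE.
pose h (k : nat) : R := (b ord0 i - a ord0 i) / 2 * 2^-1 ^+ k.
have h0 k : 0 < h k.
  by rewrite mulr_gt0 ?exprn_gt0 ?invr_gt0 // divr_gt0 // subr_gt0.
have al k : a ord0 i < a ord0 i + h k by rewrite ltrDl.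
have bl k : b ord0 i - h k < b ord0 i by rewrite ltrBlDr ltrDl.
have H4 := ae_countable (fun k => A2_line hw i ab' (al k)).
have H5 := ae_countable (fun k => A2_line hw i ab' (bl k)).
move: (aeS2 (fun y p1 p2 => conj p1 p2) H1 H2)
  (aeS2 (fun y p1 p2 => conj p1 p2) H3 (aeS2 (fun y p1 p2 => conj p1 p2) H4 H5)).
apply: aeS2 => y [h1 h2] [h3 [h4 h5]] yr.
have {}h1 := h1 yr; have [wp wi' Vi A2y] := h2 yr; have {}h3 := h3 yr.
have m1 := measurable_ins1 i y.
under eq_integral => t _ do rewrite line_avg_ins.
under [in leRHS]eq_integral => t _ do rewrite /dv /dist_faces !insert_coordE.
apply: (@line_poincare _ _ _ A (fun t => w (insert_coord i t y))
  (fun t => u (insert_coord i t y)) (fun t => v i (insert_coord i t y))) => //.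
- exact: (measurableT_comp (measurable_weight hw) m1).
- exact: (measurableT_comp mu_ m1).
- exact: (measurableT_comp (mv i) m1).
- by move=> t; exact: (weight_ge0 hw).
- by move: wp; apply: aeS.
- move=> k; have := h4 k yr; rewrite -/(h k) [X in _ -> _ <= A * X](_ : _ = (a ord0 i + h k - a ord0 i) ^+ 2) //.
  by rewrite (addrC _ (h k)) addrK.
- move=> k; have := h5 k yr; rewrite [X in _ -> _ <= A * X](_ : _ = (b ord0 i - (b ord0 i - h k)) ^+ 2) //.
  by congr (_ ^+ 2); rewrite opprB [RHS]addrC subrK.
Qed.

Definition avg_over (s : seq 'I_m.+1) := foldr (line_avg a b) u s.

Lemma measurable_avg_over (s : seq 'I_m.+1) : measurable_fun setT (avg_over s).
Proof. by elim: s => // i s IH; exact: measurable_line_avg. Qed.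

Lemma avg_over_indep (s : seq 'I_m.+1) (x x' : 'rV[R]_m.+1) : (forall i, i \notin s -> x ord0 i = x' ord0 i) ->
  avg_over s x = avg_over s x'.
Proof.
elim: s x x' => [|i s IH] x x' H.
  by rewrite /avg_over /=; congr u; apply/rowP => i; exact: H.
rewrite /= /line_avg; congr (_ / _); apply: eq_Rintegral => t _.
apply: IH => k; case: (unliftP i k) => [l|] -> ks; last by rewrite !insert_coordE.
rewrite !insert_coord_lift !mxE.
by apply: H; rewrite inE negb_or ks eq_sym neq_lift.
Qed.

Lemma wnorm2C (f g : 'rV[R]_m.+1 -> R) :
  wnorm2 w a b (fun x => f x - g x) = wnorm2 w a b (fun x => g x - f x).
Proof. by apply: eq_integral => x _; congr (_ * _)%:E; ring. Qed.

(** If [f] is the average of [u] over some directions, then [u - P_i f = (u -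
    P_i u) + P_i (u - f)]; the factors 2 come from the square of a sum. *)
Fixpoint avg_const k :=
  if k is l.+1 then 2 * poincare_const + 2 * A * avg_const l else 0.

Lemma avg_const_ge0 k : 0 <= avg_const k.
Proof.
elim: k => //= k IH; rewrite addr_ge0 // mulr_ge0 //; first exact: poincare_const_ge0.
exact: mulr_ge0.
Qed.

Lemma sub_avg_over_bound (s : seq 'I_m.+1) : (forall i, i \in s -> weak_identity i) ->
  (forall i, i \in s -> (wnorm2 w a b (dv i) < +oo)%E) ->
  (wnorm2 w a b (fun x => u x - avg_over s x)%R <=
   (avg_const (size s))%:E * \sum_(i <- s) wnorm2 w a b (dv i))%E.
Proof.
elim: s => [|i s IH] weak fin_.
  rewrite big_nil mule0 /wnorm2 integral0_eq // => x _.
  by rewrite subrr expr0n mul0r.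
have fin' k : k \in s -> (wnorm2 w a b (dv k) < +oo)%E.
  by move=> ks; apply: fin_; rewrite inE ks orbT.
have {}IH := IH (fun k ks => weak k (mem_behead (s := i :: s) ks)) fin'.
have S0 : (0 <= \sum_(k <- s) wnorm2 w a b (dv k))%E.
  by apply: sume_ge0 => k _; exact: wnorm2_ge0 hw _.
have mfs := measurable_avg_over s.
have foo : (wnorm2 w a b (fun x => u x - avg_over s x)%R < +oo)%E.
  apply: (le_lt_trans IH); rewrite lte_mul_pinfty ?lee_fin ?avg_const_ge0 //.
  rewrite big_seq; apply: lte_sum_pinfty => k; exact: fin'.
have fsi : (mu m.+1).-integrable (rect a b) (EFin \o avg_over s).
  have di := wL2_integrable hw ab (measurable_funB mu_ mfs) foo.
  have := integrableB (measurable_rect a b) ui di; apply: eq_integrable => //.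
    exact: measurable_rect.
  by move=> x _ /=; rewrite -EFinB; congr EFin; rewrite opprB addrC subrK.
have step1 := line_avg_poincare (weak i (mem_head i s)) (fin_ i (mem_head i s)).
have step2 := line_avg_bound hw ab i mfs mu_ fsi ui.
have mPu := measurable_line_avg a b i mu_.
have mPf := measurable_line_avg a b i mfs.
have := wnorm2B_le a b hw (measurable_funB mu_ mPu) (measurable_funB mPf mPu).
rewrite [X in (X <= _)%E -> _](_ : _ = wnorm2 w a b (fun x => u x - avg_over (i :: s) x)%R);
  last by apply: eq_integral => x _ /=; congr (_ ^+ 2 * _)%:E; ring.
move=> /le_trans; apply.
rewrite big_cons /= -/(avg_const _).
apply: (le_trans _ (lee_mulDD _ _ _ S0)); last 3 first.
- by rewrite mulr_ge0 // poincare_const_ge0.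
- by rewrite !mulr_ge0 // avg_const_ge0.
- exact: wnorm2_ge0 hw _.
rewrite EFinM -!muleA; apply: leeD; first by apply: lee_wpmul2l => //; rewrite lee_fin.
rewrite -mulrA EFinM -muleA; apply: lee_wpmul2l; first by rewrite lee_fin.
apply: (le_trans step2).
rewrite wnorm2C EFinM -muleA.
by apply: lee_wpmul2l.
Qed.

End directions.

(** * Boundary values and traces *)

Section endpoint.
Context {R : realType}.
Local Notation X := (measurableTypeR R).
Local Notation mu1 := (@lebesgue_measure R).
Variables (a b : R) (u v : R -> R).
Hypothesis ab : a < b.
Hypotheses (ui : mu1.-integrable `[a, b] (EFin \o u)) (vi : mu1.-integrable `[a, b] (EFin \o v)).
Hypothesis uv : ac_line a b u v.

Let I : set X := `[a, b]%classic.
Let mI : measurable I. Proof. exact: measurable_itv. Qed.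
Let tail t := \int[mu1]_(r in `[t, b]) v r.

Let vS s t : a <= s -> t <= b -> mu1.-integrable `[s, t] (EFin \o v).
Proof.
move=> as_ tb; apply: integrableS vi => //.
by move=> r /=; rewrite !in_itv /= => /andP[sr rt]; rewrite (le_trans as_ sr) (le_trans rt tb).
Qed.

Let exists_const : exists c, {ae mu1, forall t : X, I t -> u t + tail t = c}.
Proof.
have [_ [N N0 H]] := uv.
have [s0 /andP[as0 s0b] Ns0] := exists_notin ab N0.
exists (u s0 + tail s0).
have na : {ae mu1, forall t : X, t <> a}.
  by apply: (@ae_notin _ [set a]); exists [set a]; split => //; exact: lebesgue_measure_set1.
have nb : {ae mu1, forall t : X, t <> b}.
  by apply: (@ae_notin _ [set b]); exists [set b]; split => //; exact: lebesgue_measure_set1.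
move: (aeS2 (fun t p q => conj p q) na nb) (ae_notin N0).
apply: aeS2 => t [ta tb] Nt; rewrite /I /= in_itv /= => /andP[at_ tb_].
have {ta}at' : a < t by rewrite lt_neqAle at_ andbT eq_sym; apply/eqP.
have {tb}tb' : t < b by rewrite lt_neqAle tb_ andbT; apply/eqP.
have [ts|st|->] := ltgtP t s0 => //.
  rewrite /tail (@Rintegral_itv_split _ v t s0 b) //; [|exact: ltW|exact: ltW|exact: vS].
  by rewrite -(H t s0) //; ring.
rewrite /tail (@Rintegral_itv_split _ v s0 t b) //; [|exact: ltW|exact: vS (ltW as0) _].
by rewrite -(H s0 t) //; ring.
Qed.

Let v' : X -> R := v \_ I.
Let g : X -> R := \1_I.

Let v'i : mu1.-integrable setT (EFin \o v').
Proof. by rewrite -restrict_EFin; exact: (integrable_mkcond _ mI).1. Qed.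

Let gi : mu1.-integrable setT (EFin \o g).
Proof.
apply/integrableP; split; first by apply/measurable_EFinP; exact: measurable_indic.
under eq_integral do rewrite /= ger0_norm //.
by rewrite integral_indic // setIT [X in (X < _)%E]lebesgue_measure_itv /= lte_fin ab -EFinB ltry.
Qed.

Let headE t : v' t * (\int[mu1]_(s in `]-oo, t]) g s) = ((fun t => (t - a) * v t) \_ I) t.
Proof.
rewrite /v' !patchE; case: ifPn; last by rewrite mul0r.
rewrite inE /I /= in_itv /= => /andP[at_ tb]; rewrite mulrC; congr (_ * _).
have mH : measurable (`]-oo, t] : set X) by exact: measurable_itv.
rewrite /Rintegral integral_indic //.
have -> : I `&` `]-oo, t] = `[a, t]%classic.
  apply/seteqP; split=> s; rewrite /I /= !in_itv /=.
    by move=> [/andP[-> _] ->].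
  by move=> /andP[as_ st]; rewrite as_ st (le_trans st tb).
have H := lebesgue_measure_itv (`[a, t]); rewrite [X in fine X]H /= lte_fin.
by move: at_; rewrite le_eqVlt => /predU1P[->|->]; rewrite ?ltxx ?subrr.
Qed.

Let tailE s : g s * (\int[mu1]_(t in `[s, +oo[) v' t) = (tail \_ I) s.
Proof.
rewrite /g indicE patchE; case: ifPn => sI; last by rewrite mul0r.
rewrite mul1r /v' -Rintegral_mkcondr.
rewrite /tail; congr (Rintegral _ _ _).
move: sI; rewrite inE /I /= in_itv /= => /andP[as_ sb].
apply/seteqP; split=> t; rewrite /I /= !in_itv /= ?andbT.
  by move=> [st /andP[_ tb]]; rewrite st tb.
by move=> /andP[st tb]; rewrite st tb (le_trans as_ st).
Qed.

(** The function on the left is almost everywhere constant, its value being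
    the boundary value of [u] at [b]. Integrating it over [[a, b]] gives a
    formula for this value, which is what makes boundary values measurable
    functions of the line. *)
Lemma ac_line_end : {ae mu1, forall t : X, `[a, b]%classic t ->
  u t + \int[mu1]_(r in `[t, b]) v r =
  (\int[mu1]_(r in `[a, b]) (u r + (r - a) * v r)) / (b - a)}.
Proof.
have [c Hc] := exists_const; move: (Hc); apply: aeS => t ht tI; rewrite -/(tail t) ht //.
have V := volterra gi v'i.
have tI' : mu1.-integrable I (EFin \o tail).
  apply/(integrable_mkcond _ mI); rewrite restrict_EFin.
  by have := integrable_volterra gi v'i; apply: eq_integrable => // s _; rewrite tailE.
have ti2 : mu1.-integrable I (EFin \o (fun r => (r - a) * v r)).
  have mh : measurable_fun I (fun r : X => r - a) by exact: measurable_funB.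
  have : mu1.-integrable I (EFin \o (fun r => v r * (r - a))).
    apply: (integrable_bddM mI vi mh (M := b - a)) => r.
    rewrite /I /= in_itv /= => /andP[ar rb].
    by rewrite ger0_norm ?subr_ge0 // lerB.
  by apply: eq_integrable => // r _; rewrite /= mulrC.
have h0 : b - a != 0 by rewrite subr_eq0 gt_eqF.
rewrite RintegralD //.
have -> : \int[mu1]_(r in I) ((r - a) * v r) = \int[mu1]_(r in I) tail r.
  rewrite Rintegral_mkcond [RHS]Rintegral_mkcond.
  transitivity (\int[mu1]_t (v' t * \int[mu1]_(s in `]-oo, t]) g s)).
    by apply: eq_Rintegral => s _; rewrite headE.
  by rewrite V; apply: eq_Rintegral => s _; rewrite tailE.
rewrite -RintegralD //.
have mB : mu1 I = (b - a)%:E.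
  by rewrite [LHS]lebesgue_measure_itv /= lte_fin ab -EFinB.
rewrite (@ae_eq_Rintegral _ _ _ mu1 I (fun r => u r + tail r) (cst c)) //.
  by rewrite Rintegral_cst // [X in _ * fine X]mB /= mulfK.
apply: measurable_funD; apply/measurable_EFinP; first by case/integrableP: ui.
by case/integrableP: tI'.
Qed.

End endpoint.

Section traces.
Context {R : realType} {m : nat}.
Local Notation X := (measurableTypeR R).
Local Notation mu1 := (@lebesgue_measure R).
Local Notation mu := (@lebesgue_rV R).
Variables (j : 'I_m.+1) (a b : 'rV[R]_m.+1).
Hypothesis ab : forall i, a ord0 i < b ord0 i.

Let a' := col' j a.
Let b' := col' j b.
Let ab' k : a' ord0 k < b' ord0 k. Proof. by rewrite !mxE. Qed.
Let aj := a ord0 j.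
Let bj := b ord0 j.
Let abj : aj < bj. Proof. exact: ab. Qed.
Let F := rect a' b'.
Let mF : measurable F. Proof. exact: measurable_rect. Qed.

Variable c : R.
Hypothesis cI : aj <= c <= bj.

Definition slab_lo (e : R) := Num.max aj (c - e).
Definition slab_hi (e : R) := Num.min bj (c + e).
Let lo := slab_lo.
Let hi := slab_hi.

Let lo_le e : 0 <= e -> lo e <= c.
Proof. by move=> e0; rewrite /lo /slab_lo ge_max; case/andP: cI => -> _ /=; rewrite gerBl. Qed.

Let hi_ge e : 0 <= e -> c <= hi e.
Proof. by move=> e0; rewrite /hi /slab_hi le_min; case/andP: cI => _ -> /=; rewrite lerDl. Qed.

Let lo_hi e : 0 <= e -> lo e <= hi e.
Proof. by move=> e0; exact: le_trans (lo_le e0) (hi_ge e0). Qed.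

Let hi_lo_le e : hi e - lo e <= 2 * e.
Proof.
have h1 : hi e <= c + e by rewrite /hi /slab_hi ge_min lexx orbT.
have h2 : c - e <= lo e by rewrite /lo /slab_lo le_max lexx orbT.
by lra.
Qed.

Let le_hi_lo e : c = aj \/ c = bj -> 0 < e -> e <= bj - aj -> e <= hi e - lo e.
Proof.
move=> cab e0 eh; have l := lo_le (ltW e0); have r := hi_ge (ltW e0).
case: cab => cE.
  have h : c + e <= hi e by rewrite /hi /slab_hi le_min lexx andbT; lra.
  by lra.
have h : lo e <= c - e by rewrite /lo /slab_lo ge_max lexx andbT; lra.
by lra.
Qed.

Let loj e : 'rV[R]_m.+1 := insert_coord j (lo e) a'.
Let hij e : 'rV[R]_m.+1 := insert_coord j (hi e) b'.

Let slabE e : slab a b j c e = rect (loj e) (hij e).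
Proof.
apply/seteqP; split => x /=.
  move=> [xr /=]; rewrite ler_distl => /andP[h1 h2] i; rewrite /loj /hij.
  case: (unliftP j i) => [k|] ->; last first.
    rewrite !insert_coordE /lo /hi /slab_lo /slab_hi ge_max le_min h1 h2 !andbT.
    exact: xr.
  by rewrite !insert_coord_lift !mxE; exact: xr.
move=> xr; have := xr j; rewrite /loj /hij !insert_coordE /lo /hi /slab_lo /slab_hi.
rewrite ge_max le_min => /andP[/andP[h1 h2] /andP[h3 h4]].
split; last by rewrite /= ler_distl h2.
move=> i; case: (unliftP j i) => [k|] ->; first last.
  by rewrite h1.
by have := xr (lift j k); rewrite /loj /hij !insert_coord_lift !mxE.
Qed.

Let measurable_slab e : measurable (slab a b j c e).
Proof. by rewrite slabE; exact: measurable_rect. Qed.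

Let slab_sub e : slab a b j c e `<=` rect a b.
Proof. by move=> x []. Qed.

Let slab_measure_le e : 0 <= e -> (mu m.+1 (slab a b j c e) <= (2 * e * volume a' b')%:E)%E.
Proof.
move=> e0; rewrite slabE.
have H : mu m.+1 (rect (loj e) (hij e)) = (volume (loj e) (hij e))%:E.
  apply: lebesgue_rV_rect => i; rewrite /loj /hij.
  case: (unliftP j i) => [k|] ->; first by rewrite !insert_coord_lift; exact/ltW.
  by rewrite !insert_coordE lo_hi.
rewrite [leLHS]H volume_ins lee_fin ler_wpM2r //.
exact/ltW/volume_gt0.
Qed.

Let ge0_fubini_slab e (f : 'rV[R]_m.+1 -> \bar R) :
  measurable_fun setT f -> (forall x, 0 <= f x)%E ->
  (\int[mu m.+1]_(x in slab a b j c e) f x =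
   \int[mu m]_(y in F) \int[mu1]_(t in `[lo e, hi e]) f (insert_coord j t y))%E.
Proof.
move=> mf f0; rewrite slabE.
have H := ge0_fubini_rect_coord j (loj e) (hij e) mf f0.
have E1 : col' j (loj e) = a' by rewrite /loj col'_insert_coord.
have E2 : col' j (hij e) = b' by rewrite /hij col'_insert_coord.
have E3 : loj e ord0 j = lo e by rewrite /loj insert_coordE.
have E4 : hij e ord0 j = hi e by rewrite /hij insert_coordE.
by rewrite E1 E2 E3 E4 in H; rewrite [LHS]H.
Qed.

Let measurable_slab_line e (f : 'rV[R]_m.+1 -> \bar R) :
  measurable_fun setT f -> (forall x, 0 <= f x)%E ->
  measurable_fun setT (fun y : 'rV[R]_m =>
    \int[mu1]_(t in `[lo e, hi e]) f (insert_coord j t y))%E.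
Proof.
move=> mf f0.
pose D : set 'rV[R]_m.+1 := (fun x : 'rV[R]_m.+1 => x ord0 j : X) @^-1` `[lo e, hi e].
have mD : measurable D.
  by rewrite -[X in measurable X]setTI; apply: measurable_coord => //; exact: measurable_itv.
have mk' : measurable_fun setT (f \_ D).
  by apply/(measurable_restrictT _ mD); exact: measurable_funTS.
have k0 x : (0 <= (f \_ D) x)%E by rewrite patchE; case: ifP.
have := measurable_coord_integral j mk' k0; apply: eq_measurable_fun => y _.
rewrite [RHS]integral_mkcond; apply: eq_integral => t _.
rewrite /patch; congr (if _ then _ else _).
by apply/idP/idP; rewrite !inE /D /= insert_coordE.
Qed.

Variables (u v : 'rV[R]_m.+1 -> R).
Hypotheses (mu_ : measurable_fun setT u) (mv : measurable_fun setT v).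
Hypothesis vi : (mu m.+1).-integrable (rect a b) (EFin \o v).

(** The fundamental theorem of calculus for a boundary value [g] at height
    [c]: on almost every line, [u] at height [t] differs from [g] by at most
    the integral of [|v|] over the points at least as close to [c] as [t]. *)
Definition dominated_at (g : 'rV[R]_m -> R) :=
  [/\ measurable_fun setT g, (mu m).-integrable F (EFin \o g) &
   {ae mu m, forall y, F y -> {ae mu1, forall t : X, `[aj, bj]%classic t ->
     (`|(u (insert_coord j t y) - g y)%R|%:E <=
      \int[mu1]_(r in `[slab_lo `|t - c|%R, slab_hi `|t - c|%R]) `|v (insert_coord j r y)|%:E)%E}}].

Let slab_bound g e : dominated_at g -> 0 <= e ->
  (\int[mu m.+1]_(x in slab a b j c e) `|(u x - g (col' j x))%R|%:E <=
   (2 * e)%:E * \int[mu m.+1]_(x in slab a b j c e) `|v x|%:E)%E.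
Proof.
move=> [mg gi H] e0.
have mug : measurable_fun setT (fun x : 'rV[R]_m.+1 => `|(u x - g (col' j x))%R|%:E).
  apply/measurable_EFinP; apply: measurableT_comp => //; apply: measurable_funB => //.
  exact: (measurableT_comp mg (measurable_col' j)).
have mnv : measurable_fun setT (fun x : 'rV[R]_m.+1 => `|v x|%:E).
  by apply/measurable_EFinP; exact: measurableT_comp.
have mL1 := measurable_slab_line e mug (fun x => ltac:(by rewrite lee_fin)).
have mL2 := measurable_slab_line e mnv (fun x => ltac:(by rewrite lee_fin)).
rewrite !ge0_fubini_slab // -ge0_integralZl_EFin //; last 3 first.
- by move=> y _; apply: integral_ge0.
- exact: measurable_funTS mL2.
- by rewrite mulr_ge0.
apply: ae_ge0_le_integral => //.
- by move=> y _; apply: integral_ge0.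
- exact: measurable_funTS mL1.
- by move=> y _; rewrite mule_ge0 ?lee_fin ?mulr_ge0 //; apply: integral_ge0.
- by apply: measurable_funTS; apply: measurable_funeM; exact: mL2.
move: H; apply: aeS => y Hy yF.
set P := (\int[mu1]_(t in `[lo e, hi e]) `|v (insert_coord j t y)|%:E)%E.
have P0 : (0 <= P)%E by apply: integral_ge0.
have ins1 := measurable_ins1 j y.
apply: (@le_trans _ _ (\int[mu1]_(t in `[lo e, hi e]) P)%E).
  apply: ae_ge0_le_integral => //.
  - by apply: measurable_funTS; exact: (measurableT_comp mug ins1).
  - move: (Hy yF); apply: aeS => t Ht; rewrite /= in_itv /= => /andP[lt th].
    have tI : `[aj, bj]%classic t.
      rewrite /= in_itv /=; move: lt th; rewrite /lo /hi /slab_lo /slab_hi ge_max le_min.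
      by move=> /andP[-> _] /andP[-> _].
    rewrite col'_insert_coord; apply: le_trans (Ht tI) _.
    apply: ge0_subset_integral => //.
    + by apply: measurable_funTS; exact: (measurableT_comp mnv ins1).
    + move: lt th; rewrite /lo /hi /slab_lo /slab_hi ge_max le_min.
      move=> /andP[_ l2] /andP[_ h2].
      have te : `|t - c| <= e by rewrite ler_distl l2.
      move=> r /=; rewrite !in_itv /= !ge_max !le_min => /andP[/andP[-> r2] /andP[-> r4]] /=.
      by apply/andP; split; lra.
rewrite integral_cst // muleC; apply: lee_wpmul2r => //.
have := lebesgue_measure_itv `[lo e, hi e]; move=> H'; rewrite [leLHS]H' /= lte_fin.
case: ifP => _; last by rewrite lee_fin mulr_ge0.
by rewrite -EFinB lee_fin.
Qed.

(** The mean over the thickness [e] is at most twice the integral of [|v|]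
    over the slab, which tends to 0 by absolute continuity of the integral. *)
Lemma face_trace_of_dominated g : dominated_at g -> face_trace a b j c u g.
Proof.
move=> hg; have [mg gi _] := hg; split => //.
have v'i : (mu m.+1).-integrable setT (EFin \o (v \_ (rect a b))).
  by rewrite -restrict_EFin; exact: (integrable_mkcond _ (measurable_rect a b)).1.
have bound e : 0 < e -> (e^-1%:E * \int[mu m.+1]_(x in slab a b j c e) `|(u x - g (col' j x))%R|%:E <=
    2%:E * (\int[mu m.+1]_(x in slab a b j c e) `|(v \_ (rect a b)) x|)%:E)%E.
  move=> e0; have := slab_bound hg (ltW e0).
  have -> : (\int[mu m.+1]_(x in slab a b j c e) `|v x|%:E)%E =
      (\int[mu m.+1]_(x in slab a b j c e) `|(v \_ (rect a b)) x|)%:E.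
    rewrite /Rintegral fineK.
      apply: eq_integral => x /set_mem xs; rewrite patchE mem_set //; exact: slab_sub xs.
    have iv := integrable_abse (integrableS measurableT (measurable_slab e) (@subsetT _ _) v'i).
    exact: (integrable_fin_num _ iv).
  move=> H; apply: le_trans (lee_wpmul2l _ H) _; first by rewrite lee_fin invr_ge0 ltW.
  by rewrite -!EFinM lee_fin !mulrA (mulrC e^-1) divfK ?lexx ?gt_eqF.
apply/fine_cvgP; split.
  near=> e; have e0 : 0 < e by near: e; exact: nbhs_right_gt.
  rewrite ge0_fin_numE; last by rewrite mule_ge0 ?lee_fin ?invr_ge0 ?(ltW e0) //; apply: integral_ge0.
  by apply: le_lt_trans (bound e e0) _; rewrite -EFinM ltry.
apply/cvgrPdist_lt => d d0.
have d2 : 0 < d / 2 by rewrite divr_gt0.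
have [r [r0 Hr]] := integral_normr_continuous v'i d2.
have vol0 := volume_gt0 ab'.
near=> e; have e0 : 0 < e by near: e; exact: nbhs_right_gt.
have er : 2 * e * volume a' b' < r.
  rewrite -ltr_pdivlMr // mulrC -ltr_pdivlMr //; near: e; apply: nbhs_right_lt.
  by rewrite divr_gt0 ?divr_gt0.
have := Hr _ (measurable_slab e).
have sm : (mu m.+1 (slab a b j c e) < r%:E)%E.
  by apply: le_lt_trans (slab_measure_le (ltW e0)) _; rewrite lte_fin.
move=> /(_ sm); rewrite sub0r normrN.
have := bound e e0; rewrite -EFinM.
set P := (_ * _)%E; set Q := Rintegral _ _ _ => PQ Qd.
have P0 : (0 <= P)%E by rewrite mule_ge0 ?lee_fin ?invr_ge0 ?(ltW e0) //; apply: integral_ge0.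
rewrite [X in `|X|](_ : _ = fine P) //.
rewrite ger0_norm ?fine_ge0 // -lte_fin fineK; last first.
  by rewrite ge0_fin_numE // (le_lt_trans PQ) // ltry.
by apply: (le_lt_trans PQ); rewrite lte_fin; lra.
Unshelve. all: by end_near.
Qed.

(** In mean over thin slabs both traces are close to [u], hence to each other,
    and their difference does not depend on the thickness. *)
Lemma face_trace_unique g1 g2 : c = aj \/ c = bj ->
  face_trace a b j c u g1 -> face_trace a b j c u g2 ->
  (\int[mu m]_(y in F) (g1 y)%:E = \int[mu m]_(y in F) (g2 y)%:E)%E.
Proof.
move=> cab [i1 t1] [i2 t2].
have mg (g : 'rV[R]_m -> R) : (mu m).-integrable F (EFin \o g) -> measurable_fun setT (g \_ F).
  move=> gi; apply/(measurable_restrictT _ mF); apply/measurable_EFinP.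
  by case/integrableP: gi.
have m1 := mg _ i1; have m2 := mg _ i2.
have colF e x : slab a b j c e x -> F (col' j x).
  by move=> [xr _] k; rewrite !mxE; exact: xr.
have gE (g : 'rV[R]_m -> R) e : (\int[mu m.+1]_(x in slab a b j c e) `|(u x - g (col' j x))%R|%:E =
    \int[mu m.+1]_(x in slab a b j c e) `|(u x - (g \_ F) (col' j x))%R|%:E)%E.
  by apply: eq_integral => x /set_mem /colF xF; rewrite patchE mem_set.
pose d y := (g1 \_ F) y - (g2 \_ F) y.
have md : measurable_fun setT (fun y => `|d y|%:E).
  by apply/measurable_EFinP; apply: measurableT_comp => //; exact: measurable_funB.
have mdc : measurable_fun setT (fun x : 'rV[R]_m.+1 => `|d (col' j x)|%:E).
  exact: (measurableT_comp md (measurable_col' j)).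
have mug (g : 'rV[R]_m -> R) : measurable_fun setT g ->
    measurable_fun setT (fun x : 'rV[R]_m.+1 => `|(u x - g (col' j x))%R|%:E).
  move=> mg'; apply/measurable_EFinP; apply: measurableT_comp => //; apply: measurable_funB => //.
  exact: (measurableT_comp mg' (measurable_col' j)).
have key e : 0 < e -> e <= bj - aj -> (\int[mu m]_(y in F) `|d y|%:E <=
    e^-1%:E * \int[mu m.+1]_(x in slab a b j c e) `|(u x - g1 (col' j x))%R|%:E +
    e^-1%:E * \int[mu m.+1]_(x in slab a b j c e) `|(u x - g2 (col' j x))%R|%:E)%E.
  move=> e0 eh; rewrite -ge0_muleDr; [|exact: integral_ge0|exact: integral_ge0].
  rewrite (gE g1) (gE g2).
  have n1 := measurable_funTS (mug _ m1) : measurable_fun (slab a b j c e) _.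
  have n2 := measurable_funTS (mug _ m2) : measurable_fun (slab a b j c e) _.
  rewrite -(ge0_integralD _ (measurable_slab e) _ n1 _ n2) //.
  have D0 : (0 <= \int[mu m]_(y in F) `|d y|%:E)%E by apply: integral_ge0.
  have H1 : (e%:E * \int[mu m]_(y in F) `|d y|%:E <=
      \int[mu m.+1]_(x in slab a b j c e) `|d (col' j x)|%:E)%E.
    have mLd := measurable_slab_line e mdc (fun x => ltac:(by rewrite lee_fin)).
    rewrite (ge0_fubini_slab e mdc (fun x => ltac:(by rewrite lee_fin))).
    rewrite -ge0_integralZl_EFin //; last 2 first.
    - exact: measurable_funTS.
    - exact: ltW.
    apply: ge0_le_integral => //.
    - by move=> y _; rewrite mule_ge0 // lee_fin ltW.
    - by apply: measurable_funTS; exact: measurable_funeM.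
    - exact: measurable_funTS mLd.
    move=> y _; under eq_integral do rewrite col'_insert_coord.
    rewrite integral_cst // muleC; apply: lee_wpmul2l => //.
    have l := le_hi_lo cab e0 eh.
    have lh : lo e < hi e by rewrite -subr_gt0 (lt_le_trans e0).
    have H' := lebesgue_measure_itv `[lo e, hi e].
    by rewrite [leRHS]H' /= lte_fin lh -EFinB lee_fin.
  have H2 : (\int[mu m.+1]_(x in slab a b j c e) `|d (col' j x)|%:E <=
      \int[mu m.+1]_(x in slab a b j c e) (`|(u x - (g1 \_ F) (col' j x))%R|%:E +
        `|(u x - (g2 \_ F) (col' j x))%R|%:E))%E.
    apply: ge0_le_integral => //.
    - exact: measurable_funTS.
    - exact: (emeasurable_funD n1 n2).
    move=> x _; rewrite -EFinD lee_fin addrC.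
    have -> : d (col' j x) = (u x - (g2 \_ F) (col' j x)) - (u x - (g1 \_ F) (col' j x)).
      by rewrite /d; ring.
    exact: ler_normB.
  have e1 : e^-1 * e = 1 by rewrite mulVf // gt_eqF.
  rewrite -[leLHS]mul1e -e1 EFinM -muleA; apply: lee_wpmul2l.
    by rewrite lee_fin invr_ge0 ltW.
  exact: le_trans H1 H2.
have I0 : (\int[mu m]_(y in F) `|d y|%:E = 0)%E.
  apply/eqP; rewrite eq_le; apply/andP; split; last by apply: integral_ge0.
  have T : (e^-1%:E * \int[mu m.+1]_(x in slab a b j c e) `|(u x - g1 (col' j x))%R|%:E +
    e^-1%:E * \int[mu m.+1]_(x in slab a b j c e) `|(u x - g2 (col' j x))%R|%:E)%E
    @[e --> 0^'+] --> (0 + 0)%E.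
    exact: cvgeD.
  rewrite -[leRHS]adde0; apply: (cvge_to_ge T).
  near=> e; apply: key; first by near: e; exact: nbhs_right_gt.
  by near: e; apply: nbhs_right_le; rewrite subr_gt0.
have /(ge0_integral_eq0_ae mF (measurable_funTS md)) : (\int[mu m]_(y in F) `|d y|%:E = 0)%E by [].
move=> /(_ (fun y _ => ltac:(by rewrite lee_fin))) H.
apply: ae_eq_integral => //.
- by case/integrableP: i1.
- by case/integrableP: i2.
move: H; apply: aeS => y H yF; have [] := H yF.
move=> /eqP; rewrite normr_eq0 /d !patchE mem_set // subr_eq0 => /eqP E.
by rewrite /= E.
Unshelve. all: by end_near.
Qed.

End traces.

Section interpolation.
Context {R : realType} {m : nat}.
Local Notation X := (measurableTypeR R).
Local Notation mu1 := (@lebesgue_measure R).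
Local Notation mu := (@lebesgue_rV R).
Variables (j : 'I_m.+1) (a b : 'rV[R]_m.+1).
Hypothesis ab : forall i, a ord0 i < b ord0 i.

Let a' := col' j a.
Let b' := col' j b.
Let ab' k : a' ord0 k < b' ord0 k. Proof. by rewrite !mxE. Qed.
Let aj := a ord0 j.
Let bj := b ord0 j.
Let abj : aj < bj. Proof. exact: ab. Qed.
Let F := rect a' b'.
Let mF : measurable F. Proof. exact: measurable_rect. Qed.

Variables (u v : 'rV[R]_m.+1 -> R).
Hypotheses (mu_ : measurable_fun setT u) (mv : measurable_fun setT v).
Hypotheses (ui : (mu m.+1).-integrable (rect a b) (EFin \o u))
  (vi : (mu m.+1).-integrable (rect a b) (EFin \o v)).

Section existence.
Hypothesis hac : {ae mu m, forall y : 'rV[R]_m, F y ->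
  ac_line aj bj (fun t => u (insert_coord j t y)) (fun t => v (insert_coord j t y))}.

Let G (x : 'rV[R]_m.+1) := u x + (x ord0 j - aj) * v x.

Let mG : measurable_fun setT G.
Proof.
apply: measurable_funD => //; apply: measurable_funM => //.
by apply: measurable_funB => //; exact: measurable_coord.
Qed.

Let Gi : (mu m.+1).-integrable (rect a b) (EFin \o G).
Proof.
have mr : measurable (rect a b) by exact: measurable_rect.
have mh : measurable_fun (rect a b) (fun x : 'rV[R]_m.+1 => x ord0 j - aj).
  by apply: measurable_funTS; apply: measurable_funB => //; exact: measurable_coord.
have H := integrable_bddM mr vi mh (M := bj - aj).
have {}H : (mu m.+1).-integrable (rect a b) (EFin \o (fun x => v x * (x ord0 j - aj))).
  apply: H => x /(_ j)/andP[ax xb].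
  by rewrite ger0_norm ?subr_ge0 // lerB.
have := integrableD mr ui H; apply: eq_integrable => // x _.
by rewrite /= -EFinD /G mulrC.
Qed.

Let gb (y : 'rV[R]_m) := (\int[mu1]_(t in `[aj, bj]) G (insert_coord j t y)) / (bj - aj).
Let ga (y : 'rV[R]_m) := gb y - \int[mu1]_(t in `[aj, bj]) v (insert_coord j t y).

Let mgb : measurable_fun setT gb.
Proof. by apply: measurable_funM => //; exact: measurable_line_integral. Qed.

Let gbi : (mu m).-integrable F (EFin \o gb).
Proof.
have := integrableZr mF (bj - aj)^-1 (integrable_rect_coord j Gi).
by apply: eq_integrable => // y _; rewrite /= EFinM.
Qed.

Let on_lines : {ae mu m, forall y : 'rV[R]_m, F y ->
  mu1.-integrable `[aj, bj] (fun t => (v (insert_coord j t y))%:E) /\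
  {ae mu1, forall t : X, `[aj, bj]%classic t ->
    u (insert_coord j t y) + \int[mu1]_(r in `[t, bj]) v (insert_coord j r y) = gb y}}.
Proof.
have H1 := ae_integrable_rect_coord j ui.
have H2 := ae_integrable_rect_coord j vi.
move: (aeS2 (fun y p q => conj p q) H1 H2) hac; apply: aeS2 => y [h1 h2] h3 yF.
split; first exact: h2.
move: (ac_line_end abj (h1 yF) (h2 yF) (h3 yF)); apply: aeS => t ht tI.
rewrite ht // /gb; congr (_ / _); apply: eq_Rintegral => r _.
by rewrite /G insert_coordE.
Qed.

Let le_abse_line y s t : aj <= s -> t <= bj ->
  mu1.-integrable `[aj, bj] (fun t => (v (insert_coord j t y))%:E) ->
  (`|(\int[mu1]_(r in `[s, t]) v (insert_coord j r y))%R|%:E <=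
   \int[mu1]_(r in `[s, t]) `|v (insert_coord j r y)|%:E)%E.
Proof.
move=> as_ tb vI.
have vS : mu1.-integrable `[s, t] (EFin \o (fun t => v (insert_coord j t y))).
  apply: integrableS vI => // r /=; rewrite !in_itv /= => /andP[sr rt].
  by rewrite (le_trans as_ sr) (le_trans rt tb).
apply: (@le_trans _ _ (\int[mu1]_(r in `[s, t]) `|v (insert_coord j r y)|)%:E).
  by rewrite lee_fin; apply: le_normr_Rintegral.
rewrite /Rintegral fineK //.
have := integrable_fin_num _ (integrable_abse vS); exact.
Qed.

Let dominated_b : dominated_at j a b bj u v gb.
Proof.
split => //; move: on_lines; apply: aeS => y H yF; have [vI Ht] := H yF.
move: Ht; apply: aeS => t Ht tI; have := Ht tI => <-.
move: tI; rewrite /= in_itv /= => /andP[at_ tb].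
have -> : slab_lo j a bj `|t - bj| = t.
  rewrite ler0_norm ?subr_le0 // /slab_lo opprB (_ : bj - (bj - t) = t); last by ring.
  exact/max_idPr.
have -> : slab_hi j b bj `|t - bj| = bj by apply/min_idPl; rewrite lerDl.
by rewrite opprD addrA subrr sub0r normrN; exact: le_abse_line.
Qed.

Let dominated_a : dominated_at j a b aj u v ga.
Proof.
split.
- by apply: measurable_funB => //; exact: measurable_line_integral.
- have := integrableB mF gbi (integrable_rect_coord j vi).
  by apply: eq_integrable => // y _; rewrite /= -EFinB.
move: on_lines; apply: aeS => y H yF; have [vI Ht] := H yF.
move: Ht; apply: aeS => t Ht tI; have Ht' := Ht tI.
move: tI; rewrite /= in_itv /= => /andP[at_ tb].
have -> : slab_lo j a aj `|t - aj| = aj by apply/max_idPl; rewrite gerBl.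
have -> : slab_hi j b aj `|t - aj| = t.
  rewrite ger0_norm ?subr_ge0 // /slab_hi addrC subrK.
  exact/min_idPr.
have -> : u (insert_coord j t y) - ga y = \int[mu1]_(r in `[aj, t]) v (insert_coord j r y).
  rewrite /ga -Ht' (@Rintegral_itv_split _ (fun r => v (insert_coord j r y)) aj t bj) //.
  by ring.
exact: le_abse_line.
Qed.

(** The boundary values are the averages given by [ac_line_end] on each line. *)
Lemma exists_dominated : (exists g, dominated_at j a b aj u v g) /\
  (exists g, dominated_at j a b bj u v g).
Proof. by split; [exists ga|exists gb]. Qed.

End existence.

Definition face_avg (t : R) :=
  (\int[mu m]_(y in F) u (insert_coord j t y)) / volume a' b'.

Lemma measurable_face_avg : measurable_fun setT (face_avg : X -> R).
Proof. by apply: measurable_funM => //; exact: measurable_face_integral. Qed.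

Let K := (\int[mu m.+1]_(x in rect a b) `|v x|) / volume a' b'.

(** The pointwise bound is known for almost every line and then almost every
    [t], but is integrated over slices, where the two quantifiers are
    exchanged; this is why it is stated as membership in a measurable set. *)
Lemma face_avg_near_trace c g : dominated_at j a b c u v g ->
  {ae mu1, forall t : X, `[aj, bj]%classic t ->
    `|face_avg t - (\int[mu m]_(y in F) g y) / volume a' b'| <= K}.
Proof.
move=> [mg gi H].
have mnv : measurable_fun setT (fun x : 'rV[R]_m.+1 => `|v x|%:E).
  by apply/measurable_EFinP; exact: measurableT_comp.
have mvr : measurable_fun setT ((fun x => `|v x|%:E) \_ (rect a b)).
  by apply/(measurable_restrictT _ (measurable_rect a b)); exact: measurable_funTS.
have vr0 x : (0 <= ((fun x => `|v x|%:E) \_ (rect a b)) x)%E.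
  by rewrite patchE; case: ifP.
pose L (y : 'rV[R]_m) := (\int[mu1]_t ((fun x => `|v x|%:E) \_ (rect a b)) (insert_coord j t y))%E.
have mL : measurable_fun setT L by exact: measurable_coord_integral.
have LE y : F y -> (\int[mu1]_(t in `[aj, bj]) `|v (insert_coord j t y)|%:E = L y)%E.
  move=> yF; rewrite /L [LHS]integral_mkcond; apply: eq_integral => t _.
  rewrite /patch; congr (if _ then _ else _).
  apply/idP/idP; rewrite !inE => h; first by apply/rect_insE.
  by have /rect_insE[] := h.
(* the pointwise bound, made vacuous outside the rectangle *)
pose Q : set 'rV[R]_m.+1 := ~` rect a b `|`
  (rect a b `&` [set x | (`|(u x - g (col' j x))%R|%:E <= L (col' j x))%E]).
have mr := measurable_rect a b.
have mQ : measurable Q.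
  apply: measurableU; first exact: measurableC.
  apply: (measurable_lee mr).
    apply: measurable_funTS; apply/measurable_EFinP; apply: measurableT_comp => //.
    by apply: measurable_funB => //; exact: (measurableT_comp mg (measurable_col' j)).
  by apply: measurable_funTS; exact: (measurableT_comp mL (measurable_col' j)).
have aeQ : {ae mu m.+1, forall x, Q x}.
  apply: (ae_of_coord (j := j) mQ); move: H; apply: aeS => y H.
  have [yF|nF] := pselect (F y); last first.
    by apply: aeW => t; left => /rect_insE[].
  move: (H yF); apply: aeS => t Ht.
  have [tI|nt] := pselect (`[aj, bj]%classic t); last by left => /rect_insE[].
  right; split; first by apply/rect_insE.
  rewrite /= col'_insert_coord; apply: le_trans (Ht tI) _; rewrite -LE //.
  apply: ge0_subset_integral => //.
    by apply: measurable_funTS; exact: (measurableT_comp mnv (measurable_ins1 j y)).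
  move=> r /=; rewrite !in_itv /= /slab_lo /slab_hi ge_max le_min.
  by move=> /andP[/andP[-> _] /andP[-> _]].
have H1 := ae_slice j aeQ.
have H2 := ae_integrable_rect_slice j ui.
move: H1 H2; apply: aeS2 => t H1 H2 tI; have {}H2 := H2 tI.
have vol0 : 0 < volume a' b' by exact: volume_gt0.
have fi : (mu m).-integrable F (EFin \o (fun y => u (insert_coord j t y) - g y)).
  by have := integrableB mF H2 gi; apply: eq_integrable => // y _; rewrite /= EFinB.
rewrite /face_avg /K -mulrBl -RintegralB // normrM (gtr0_norm (x := _^-1)) ?invr_gt0 //.
apply: ler_wpM2r; first by rewrite invr_ge0 ltW.
apply: (le_trans (le_normr_Rintegral mF fi)).
rewrite -lee_fin /Rintegral !fineK; last 2 first.
- exact: (integrable_fin_num _ (integrable_abse vi)).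
- exact: (integrable_fin_num _ (integrable_abse fi)).
have FU := ge0_fubini_rect_coord j a b mnv (fun x => ltac:(by rewrite lee_fin)).
rewrite [leRHS]FU.
have -> : (\int[mu m]_(y in F) \int[mu1]_(t in `[a ord0 j, b ord0 j]) `|v (insert_coord j t y)|%:E
   = \int[mu m]_(y in F) L y)%E.
  by apply: eq_integral => y /set_mem yF; rewrite -LE.
apply: ae_ge0_le_integral => //.
- by apply/measurable_EFinP; apply: measurableT_comp => //; apply/measurable_EFinP; case/integrableP: fi.
- by move=> y _; apply: integral_ge0.
- exact: measurable_funTS.
move: H1; apply: aeS => y Qy yF; case: Qy => [n|[_ /=]].
  by exfalso; apply: n; apply/rect_insE.
by rewrite col'_insert_coord.
Qed.

End interpolation.

(** * The interpolation error *)

Section estimates.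
Context {R : realType} {m : nat}.
Local Notation X := (measurableTypeR R).
Local Notation mu1 := (@lebesgue_measure R).
Local Notation mu := (@lebesgue_rV R).
Variables (w : 'rV[R]_m.+1 -> R) (j : 'I_m.+1) (a b : 'rV[R]_m.+1).
Hypothesis hw : strong_A2 w.
Hypothesis ab : forall i, a ord0 i < b ord0 i.

Let a' := col' j a.
Let b' := col' j b.
Let ab' k : a' ord0 k < b' ord0 k. Proof. by rewrite !mxE. Qed.
Let aj := a ord0 j.
Let bj := b ord0 j.
Let abj : aj < bj. Proof. exact: ab. Qed.
Let F := rect a' b'.
Let mF : measurable F. Proof. exact: measurable_rect. Qed.
Let A := A2const w.
Let A0 : 0 <= A. Proof. exact: A2const_ge0. Qed.
Let vol0 : 0 < volume a' b'. Proof. exact: volume_gt0. Qed.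

Variables (u v : 'rV[R]_m.+1 -> R).
Hypotheses (mu_ : measurable_fun setT u) (mv : measurable_fun setT v).
Hypothesis ui : (mu m.+1).-integrable (rect a b) (EFin \o u).

Let mU : measurable_fun setT (fun x : 'rV[R]_m.+1 => face_avg j a b u (x ord0 j)).
Proof.
exact: (measurableT_comp (measurable_face_avg j a b mu_) (measurable_coord j)).
Qed.

(** On almost every slice [f] is a constant, and the average of [u] is a
    nearly optimal one by [A2_slice]. *)
Lemma sub_face_avg_bound (f : 'rV[R]_m.+1 -> R) : measurable_fun setT f ->
  (forall t y y', f (insert_coord j t y) = f (insert_coord j t y')) ->
  (wnorm2 w a b (fun x => u x - face_avg j a b u (x ord0 j))%R <=
   (2 + 2 * A)%:E * wnorm2 w a b (fun x => u x - f x)%R)%E.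
Proof.
move=> mf find.
apply: (wnorm2_le_of_slices (i := j) hw) => //.
- exact: measurable_funB.
- exact: measurable_funB.
- by rewrite addr_ge0 // mulr_ge0.
have H1 := ae_slice j (weight_gt0 hw).
have H2 := ae_integrable_rect_slice j (integrable_weight hw a b).
have H3 := ae_integrable_rect_slice j (f := fun x => (w x)^-1) (A2_rect hw ab).1.
have H4 := A2_slice hw j ab' abj.
have H5 := ae_integrable_rect_slice j ui.
move: (aeS2 (fun t p q => conj p q) H1 H2)
  (aeS2 (fun t p q => conj p q) H3 (aeS2 (fun t p q => conj p q) H4 H5)).
apply: aeS2 => t [h1 h2] [h3 [h4 h5]] tI.
have {}h2 := h2 tI; have {}h3 := h3 tI; have {}h4 := h4 tI; have {}h5 := h5 tI.
have m2 := measurable_ins2 j t.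
pose y0 := a'.
under eq_integral => y _ do rewrite insert_coordE.
under [in leRHS]eq_integral => y _ do rewrite (find t y y0).
have FE : mu m F = (volume a' b')%:E by exact: rect_measureE.
pose W (y : 'rV[R]_m) := w (insert_coord j t y).
have mW : measurable_fun setT W by exact: (measurableT_comp (measurable_weight hw) m2).
have W0 y : 0 <= W y by exact: weight_ge0 hw _.
have Wpos : {ae mu m, forall y, F y -> 0 < W y} by move: h1; apply: aeS.
pose s := \int[mu m]_(y in F) (W y)^-1.
have s0 : 0 < s.
  rewrite -lte_fin fineK; last exact: integrable_fin_num h3.
  apply: integral_gt0 => //.
  - by case/integrableP: h3.
  - by move=> x _; rewrite lee_fin invr_ge0.
  - by move: h1; apply: aeS => y wt _; rewrite lte_fin invr_gt0.
  - by apply/eqP => H; have := FE; rewrite [LHS]H => -[v0]; move: vol0; rewrite -v0 ltxx.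
apply: (@sub_average_bound _ _ _ (mu m) F (fun y => u (insert_coord j t y)) W mF _ mW W0 Wpos
  (volume a' b') (\int[mu m]_(y in F) W y) s A) => //.
- exact: (measurableT_comp mu_ m2).
- by rewrite fineK //; exact: integrable_fin_num h2.
- by rewrite fineK //; exact: integrable_fin_num h3.
Qed.

Lemma volume_face : volume a b = (bj - aj) * volume a' b'.
Proof. by rewrite -(@volume_ins R m j) /aj /bj !insert_coordK. Qed.

(** An affine function lies between its boundary values, so [p] is as close to
    the slice averages as the averages of the traces are. The resulting
    constant bound is squared and multiplied by the integral of [w];
    Cauchy-Schwarz and A_2 on the rectangle bound the product. *)
Lemma face_avg_interp_bound (p : 'rV[R]_m.+1 -> R) (al be : R) (ga gb : 'rV[R]_m -> R) :
  (wnorm2 w a b v < +oo)%E ->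
  dominated_at j a b aj u v ga -> dominated_at j a b bj u v gb ->
  (forall x, p x = al + be * x ord0 j) ->
  al + be * aj = (\int[mu m]_(y in F) ga y) / volume a' b' ->
  al + be * bj = (\int[mu m]_(y in F) gb y) / volume a' b' ->
  (wnorm2 w a b (fun x => face_avg j a b u (x ord0 j) - p x)%R <=
   (A * (bj - aj) ^+ 2)%:E * wnorm2 w a b v)%E.
Proof.
move=> voo da db pE pa pb.
have vi := wL2_integrable hw ab mv voo.
pose V := \int[mu m.+1]_(x in rect a b) `|v x|.
pose K := V / volume a' b'.
have h0 : 0 < bj - aj by rewrite subr_gt0.
have mp : measurable_fun setT p.
  rewrite (_ : p = fun x => al + be * x ord0 j); last exact/funext.
  apply: measurable_funD => //; apply: measurable_funM => //; exact: measurable_coord.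
have msq (q : 'rV[R]_m.+1 -> R) : measurable_fun setT q ->
    measurable_fun setT (fun x => (q x ^+ 2 * w x)%:E).
  move=> mq; apply/measurable_EFinP; apply: measurable_funM; last exact: measurable_weight.
  exact: measurable_funX.
have mD : measurable_fun setT (fun x : 'rV[R]_m.+1 => face_avg j a b u (x ord0 j) - p x).
  exact: (measurable_funB mU mp).
have step : (wnorm2 w a b (fun x => face_avg j a b u (x ord0 j) - p x)%R <=
    1%:E * wnorm2 w a b (cst K))%E.
  apply: (wnorm2_le_of_slices (i := j) hw) => //.
  move: (face_avg_near_trace ab mu_ mv ui vi da) (face_avg_near_trace ab mu_ mv ui vi db).
  apply: aeS2 => t Ha Hb tI; have {}Ha := Ha tI; have {}Hb := Hb tI.
  rewrite mul1e; apply: ge0_le_integral => //.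
  - by move=> y _; rewrite lee_fin mulr_ge0 ?sqr_ge0 // weight_ge0.
  - by apply: measurable_funTS; exact: (measurableT_comp (msq _ mD) (measurable_ins2 j t)).
  - by apply: measurable_funTS; exact: (measurableT_comp (msq _ (measurable_cst K)) (measurable_ins2 j t)).
  move=> y _; rewrite lee_fin insert_coordE pE insert_coordE.
  apply: ler_wpM2r; first exact: weight_ge0 hw _.
  rewrite /= -[leLHS]real_normK ?num_real // ler_sqr ?nnegrE //; last first.
    exact: le_trans Ha.
  move: tI Ha Hb; rewrite -pa -pb -/V -/K /= in_itv /= => /andP[at_ tb] Ha Hb.
  move: Ha Hb; rewrite !ler_norml => /andP[Ha1 Ha2] /andP[Hb1 Hb2].
  set U := face_avg j a b u t in Ha1 Ha2 Hb1 Hb2 *.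
  have E : (bj - aj) * (U - (al + be * t)) = (bj - t) * (U - (al + be * aj)) + (t - aj) * (U - (al + be * bj)).
    by ring.
  have q1 : 0 <= bj - t by rewrite subr_ge0.
  have q2 : 0 <= t - aj by rewrite subr_ge0.
  have S k : (bj - aj) * k = (bj - t) * k + (t - aj) * k by ring.
  apply/andP; split; rewrite -(ler_pM2l h0) E S lerD // ler_wpM2l //.
rewrite mul1e in step; apply: (le_trans step).
have [Vi A2R] := A2_rect hw ab.
have CS := wL2_cauchy_schwarz hw ab mv.
have wi := integrable_weight hw a b.
have -> : wnorm2 w a b (cst K) = (K ^+ 2 * \int[mu m.+1]_(x in rect a b) w x)%:E.
  rewrite /wnorm2 EFinM /Rintegral fineK; last exact: (integrable_fin_num (measurable_rect a b) wi).
  rewrite -ge0_integralZl_EFin ?sqr_ge0 //.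
  - exact: measurable_rect.
  - by move=> x _; rewrite lee_fin weight_ge0.
  - by apply: measurable_funTS; apply/measurable_EFinP; exact: measurable_weight.
have n0 := wnorm2_ge0 a b hw v.
have nf : wnorm2 w a b v = (fine (wnorm2 w a b v))%:E by rewrite fineK // ge0_fin_numE.
have VE : (\int[mu m.+1]_(x in rect a b) `|v x|%:E)%E = V%:E.
  by rewrite /V /Rintegral fineK //; exact: (integrable_fin_num (measurable_rect a b) (integrable_abse vi)).
move: CS; rewrite nf VE -!EFinM !lee_fin -/A in n0 *.
set N := fine _; set s := Rintegral _ _ _; set o := Rintegral _ _ _ => CS.
rewrite -/o -/s volume_face in A2R.
have o0 : 0 <= o by apply: Rintegral_ge0 => x _; exact: weight_ge0.
have N0 : 0 <= N by rewrite -lee_fin /N -nf; exact: wnorm2_ge0.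
rewrite /K expr_div_n mulrAC ler_pdivrMr ?exprn_gt0 //.
apply: (@le_trans _ _ (N * s * o)); first by rewrite expr2; apply: ler_wpM2r.
rewrite -mulrA (mulrC s).
apply: le_trans (ler_wpM2l N0 A2R) _.
by rewrite exprMn le_eqVlt; apply/orP; left; apply/eqP; rewrite /A; ring.
Qed.

End estimates.

Section core.
Context {R : realType} {m : nat}.
Local Notation X := (measurableTypeR R).
Local Notation mu1 := (@lebesgue_measure R).
Local Notation mu := (@lebesgue_rV R).
Variables (w : 'rV[R]_m.+1 -> R) (j : 'I_m.+1) (a b : 'rV[R]_m.+1).
Hypothesis hw : strong_A2 w.
Hypothesis ab : forall i, a ord0 i < b ord0 i.

Let a' := col' j a.
Let b' := col' j b.
Let ab' k : a' ord0 k < b' ord0 k. Proof. by rewrite !mxE. Qed.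
Let aj := a ord0 j.
Let bj := b ord0 j.
Let abj : aj < bj. Proof. exact: ab. Qed.
Let F := rect a' b'.
Let mF : measurable F. Proof. exact: measurable_rect. Qed.
Let A := A2const w.
Let A0 : 0 <= A. Proof. exact: A2const_ge0. Qed.
Let vol0 : 0 < volume a' b'. Proof. exact: volume_gt0. Qed.
Let h0 : 0 < bj - aj. Proof. by rewrite subr_gt0. Qed.

Variables (u : 'rV[R]_m.+1 -> R) (v : 'I_m.+1 -> 'rV[R]_m.+1 -> R).
Hypotheses (mu_ : measurable_fun setT u) (mv : forall i, measurable_fun setT (v i)).
Hypothesis uoo : (wnorm2 w a b u < +oo)%E.
Hypothesis weak : forall i, weak_identity a b u v i.
Hypothesis dvoo : forall i, i != j ->
  (wnorm2 w a b (fun x => dist_faces a b i x * v i x)%R < +oo)%E.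
Hypothesis voo : (wnorm2 w a b (v j) < +oo)%E.

Let ui := wL2_integrable hw ab mu_ uoo.
Let vi := wL2_integrable hw ab (mv j) voo.

Let hac : {ae mu m, forall y : 'rV[R]_m, F y ->
  ac_line aj bj (fun t => u (insert_coord j t y)) (fun t => v j (insert_coord j t y))}.
Proof.
apply: (ae_ac_line ab (mv j) ui _ (@weak j)).
have mr : measurable (rect a b) by exact: measurable_rect.
have mh : measurable_fun (rect a b) (fun x : 'rV[R]_m.+1 => dist_faces a b j x).
  exact: measurable_funTS (measurable_dist_faces a b j).
have H := integrable_bddM mr vi mh (M := bj - aj).
have {}H : (mu m.+1).-integrable (rect a b) (EFin \o (fun x => v j x * dist_faces a b j x)).
  apply: H => x /(_ j)/andP[ax xb].
  rewrite ger0_norm /dist_faces; first by rewrite ge_min lerB.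
  by rewrite le_min !subr_ge0 ax xb.
by move: H; apply: eq_integrable => // x _; rewrite /= mulrC.
Qed.

Let ajI : aj <= aj <= bj. Proof. by rewrite lexx ltW. Qed.
Let bjI : aj <= bj <= bj. Proof. by rewrite lexx ltW. Qed.

Let face_const (k : R) : (\int[mu m]_(y in F) k%:E = (k * volume a' b')%:E)%E.
Proof. by rewrite integral_cst // [X in (_ * X)%E](rect_measureE ab'). Qed.

Let face_mean (g : 'rV[R]_m -> R) k : (mu m).-integrable F (EFin \o g) ->
  (\int[mu m]_(y in F) k%:E = \int[mu m]_(y in F) (g y)%:E)%E <->
  k = (\int[mu m]_(y in F) g y) / volume a' b'.
Proof.
move=> gi; have gf : (\int[mu m]_(y in F) (g y)%:E)%E \is a fin_num by exact: (integrable_fin_num mF gi).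
rewrite face_const; split => [E|->]; first by rewrite /Rintegral -E /= mulfK // gt_eqF.
by rewrite /Rintegral divfK ?gt_eqF // fineK.
Qed.

Lemma exists_RT_interp : exists p, RT_interp a b j u p.
Proof.
have [[ga da] [gb db]] := exists_dominated ab mu_ (mv j) ui vi hac.
pose Ma := (\int[mu m]_(y in F) ga y) / volume a' b'.
pose Mb := (\int[mu m]_(y in F) gb y) / volume a' b'.
pose be := (Mb - Ma) / (bj - aj); pose al := Ma - be * aj.
exists (fun x => al + be * x ord0 j); split; first by exists al, be.
move=> c cab; case: cab => ->.
- exists ga; first exact: (face_trace_of_dominated ab ajI mu_ (mv j) vi da).
  under eq_integral do rewrite insert_coordE.
  apply/face_mean; first by case: da.
  by rewrite /al subrK.
exists gb; first exact: (face_trace_of_dominated ab bjI mu_ (mv j) vi db).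
under eq_integral do rewrite insert_coordE.
apply/face_mean; first by case: db.
have E : be * (bj - aj) = Mb - Ma by rewrite /be divfK // gt_eqF.
have -> : al + be * b ord0 j = Ma + be * (bj - aj) by rewrite /al -/bj; ring.
by rewrite E addrC subrK.
Qed.

Definition interp_const := 2 * (2 + 2 * A) * avg_const w m + 2 * A.

Lemma interp_const_ge0 : 0 <= interp_const.
Proof.
by rewrite addr_ge0 ?mulr_ge0 ?addr_ge0 ?mulr_ge0 //; exact: avg_const_ge0.
Qed.

(** [u - p] is the sum of [u - U] and [U - p], where [U] is the average of [u]
    over the slice through the point. *)
Lemma RT_interp_bound p : RT_interp a b j u p ->
  (wnorm2 w a b (fun x => u x - p x)%R <= interp_const%:E *
    (\sum_(i | i != j) wnorm2 w a b (fun x => dist_faces a b i x * v i x)%R +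
     ((bj - aj) ^+ 2)%:E * wnorm2 w a b (v j)))%E.
Proof.
move=> [[al [be pE]] Hp].
have [[ga da] [gb db]] := exists_dominated ab mu_ (mv j) ui vi hac.
have pend c g : aj <= c <= bj -> c = aj \/ c = bj -> dominated_at j a b c u (v j) g ->
    al + be * c = (\int[mu m]_(y in F) g y) / volume a' b'.
  move=> cI cab dg; have [g' tg' E'] := Hp c cab.
  have tg := face_trace_of_dominated ab cI mu_ (mv j) vi dg.
  have U := face_trace_unique ab cI mu_ cab tg' tg.
  apply/face_mean; first by case: dg.
  rewrite -[RHS]U -[RHS]E'; apply: eq_integral => y _.
  by rewrite pE insert_coordE.
have pa := pend aj ga ajI (or_introl erefl) da.
have pb := pend bj gb bjI (or_intror erefl) db.
pose s := enum (predC1 j).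
have sj i : (i \in s) = (i != j) by rewrite mem_enum.
have ss : size s = m by rewrite -cardE cardC1 card_ord.
have B1 := @sub_avg_over_bound _ _ w a b hw ab u v mu_ ui mv s.
have {}B1 := B1 (fun i _ => @weak i) (fun i is_ => dvoo (etrans (esym (sj i)) is_)).
rewrite ss big_enum in B1.
have mf := measurable_avg_over a b mu_ s.
have ind t y y' : avg_over a b u s (insert_coord j t y) = avg_over a b u s (insert_coord j t y').
  apply: avg_over_indep => i; rewrite sj negbK => /eqP ->.
  by rewrite !insert_coordE.
have B2 := sub_face_avg_bound hw ab mu_ ui mf ind.
have B3 := face_avg_interp_bound hw ab mu_ (mv j) ui voo da db pE pa pb.
have mp : measurable_fun setT p.
  rewrite (_ : p = fun x => al + be * x ord0 j); last exact/funext.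
  apply: measurable_funD => //; apply: measurable_funM => //; exact: measurable_coord.
have mU : measurable_fun setT (fun x : 'rV[R]_m.+1 => face_avg j a b u (x ord0 j)).
  exact: (measurableT_comp (measurable_face_avg j a b mu_) (measurable_coord j)).
have := wnorm2B_le a b hw (measurable_funB mu_ mU) (measurable_funB mp mU).
rewrite [X in (X <= _)%E -> _](_ : _ = wnorm2 w a b (fun x => u x - p x)%R);
  last by apply: eq_integral => x _ /=; congr (_ ^+ 2 * _)%:E; ring.
rewrite [X in (_ <= _ + _ * X)%E -> _](_ : _ =
  wnorm2 w a b (fun x => face_avg j a b u (x ord0 j) - p x)%R);
  last by apply: eq_integral => x _ /=; congr (_ * _)%:E; ring.
move=> /le_trans; apply.
set S := (\sum_(i | _) _)%E; set N := wnorm2 w a b (v j).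
have S0 : (0 <= S)%E by apply: sume_ge0 => i _; exact: wnorm2_ge0.
have N0 : (0 <= N)%E by exact: wnorm2_ge0.
have B0 := avg_const_ge0 hw m.
apply: (@le_trans _ _ ((2 * (2 + 2 * A) * avg_const w m)%:E * S +
   (2 * A)%:E * (((bj - aj) ^+ 2)%:E * N))%E).
  apply: leeD.
    rewrite -mulrA EFinM -muleA; apply: lee_wpmul2l => //.
    rewrite EFinM -muleA; apply: (le_trans B2); apply: lee_wpmul2l => //.
    by rewrite lee_fin addr_ge0 // mulr_ge0.
  rewrite muleA -EFinM -mulrA EFinM -muleA; apply: lee_wpmul2l => //.
have M0 : (0 <= ((bj - aj) ^+ 2)%:E * N)%E by rewrite mule_ge0 // lee_fin sqr_ge0.
have k1 : 0 <= 2 * (2 + 2 * A) * avg_const w m.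
  by rewrite !mulr_ge0 // addr_ge0 // mulr_ge0.
have k2 : 0 <= 2 * A by rewrite mulr_ge0.
exact: lee_mulDD.
Qed.

End core.

(** * From squares to norms *)

Section norms.
Context {R : realType} {m : nat}.
Local Notation mu := (@lebesgue_rV R).
Variables (w : 'rV[R]_m.+1 -> R) (a b : 'rV[R]_m.+1).
Hypothesis hw : strong_A2 w.

Lemma wL2norm_lty f : (wL2norm w (rect a b) f < +oo)%E -> (wnorm2 w a b f < +oo)%E.
Proof. by apply: lty_poweRy; rewrite invr_eq0. Qed.

Lemma wL2norm_sqrt f : (wnorm2 w a b f < +oo)%E ->
  wL2norm w (rect a b) f = (Num.sqrt (fine (wnorm2 w a b f)))%:E.
Proof.
move=> foo; rewrite /wL2norm -/(wnorm2 w a b f).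
have f0 := wnorm2_ge0 a b hw f.
by rewrite -powR12_sqrt ?fine_ge0 // -poweR_EFin fineK // ge0_fin_numE.
Qed.

Lemma eq_wL2norm f g : (forall x, rect a b x -> f x = g x) ->
  wL2norm w (rect a b) f = wL2norm w (rect a b) g.
Proof.
by move=> fg; congr (_ `^ _)%E; apply: eq_integral => x /set_mem xr; rewrite fg.
Qed.

Lemma eq_face_trace j c u u' g : (forall x, rect a b x -> u x = u' x) ->
  face_trace a b j c u g -> face_trace a b j c u' g.
Proof.
move=> uu' [gi T]; split => //.
suff -> : (fun e : R => e^-1%:E *
    \int[mu m.+1]_(x in slab a b j c e) `|(u' x - g (col' j x))%R|%:E)%E =
  (fun e : R => e^-1%:E *
    \int[mu m.+1]_(x in slab a b j c e) `|(u x - g (col' j x))%R|%:E)%E by [].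
apply/funext => e; congr (_ * _)%E.
by apply: eq_integral => x /set_mem[xr _]; rewrite uu'.
Qed.

Lemma eq_RT_interp j u u' p : (forall x, rect a b x -> u x = u' x) ->
  RT_interp a b j u p -> RT_interp a b j u' p.
Proof.
move=> uu' [pE H]; split => // c cab; have [g tg E] := H c cab.
by exists g => //; exact: eq_face_trace tg.
Qed.

End norms.

Lemma sqrt_sum_le (R : rcfType) (I : finType) (P : pred I) (C h N : R) (x : I -> R) :
  0 <= C -> 0 <= h -> 0 <= N -> (forall i, 0 <= x i) ->
  Num.sqrt (C * (\sum_(i | P i) x i + h ^+ 2 * N)) <=
  Num.sqrt C * (\sum_(i | P i) Num.sqrt (x i) + h * Num.sqrt N).
Proof.
move=> C0 h0 N0 x0.
have sD (y z : R) : 0 <= y -> 0 <= z -> Num.sqrt (y + z) <= Num.sqrt y + Num.sqrt z.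
  move=> y0 z0; rewrite -(ler_pXn2r (n := 2)) ?nnegrE ?addr_ge0 ?sqrtr_ge0 //.
  rewrite sqr_sqrtr ?addr_ge0 // sqrrD !sqr_sqrtr //.
  by have := mulr_ge0 (sqrtr_ge0 y) (sqrtr_ge0 z); lra.
have X0 : 0 <= \sum_(i | P i) x i by apply: sumr_ge0.
rewrite sqrtrM //; apply: ler_wpM2l; first exact: sqrtr_ge0.
apply: le_trans (sD _ _ X0 _) _; first by rewrite mulr_ge0 // sqr_ge0.
rewrite sqrtrM ?sqr_ge0 // sqrtr_sqr ger0_norm // lerD2r.
suff [] : Num.sqrt (\sum_(i | P i) x i) <= \sum_(i | P i) Num.sqrt (x i) /\
    0 <= \sum_(i | P i) x i by [].
elim/big_rec2: _ => [|i y z _ [IH z0]]; first by rewrite sqrtr0.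
by split; [apply: le_trans (sD _ _ _ _) _ => //; rewrite lerD2l|rewrite addr_ge0].
Qed.

Theorem lemma4p3 (R : realType) (n : nat) (w : 'rV[R]_n -> R) :
  strong_A2 w ->
  exists C : R,
    forall (a b : 'rV[R]_n) (j : 'I_n) (sigma : 'rV[R]_n -> 'rV[R]_n)
           (dsigma_j : 'I_n -> 'rV[R]_n -> R),
    (forall i, a ord0 i < b ord0 i) ->
    let sigma_j := fun x => sigma x ord0 j in
    let rhs := (\sum_(i < n | i != j)
                   wL2norm w (rect a b)
                     (fun x => (dist_faces a b i x * dsigma_j i x)%R)
                + (b ord0 j - a ord0 j)%:E
                  * wL2norm w (rect a b) (dsigma_j j))%E in
    in_wL2 w (rect a b) sigma_j ->
    (forall i, weak_partial a b i sigma_j (dsigma_j i)) ->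
    (rhs < +oo)%E ->
    (exists p, RT_interp a b j sigma_j p) /\
    (forall p, RT_interp a b j sigma_j p ->
       (wL2norm w (rect a b) (fun x => (sigma_j x - p x)%R) <= C%:E * rhs)%E).
Proof.
case: n w => [|m] w hw; first by exists 0 => a b [].
exists (Num.sqrt (interp_const w)) => a b j sigma dsigma ab sigma_j rhs [ms soo] wk rhsoo.
(* extended by zero, the functions are measurable on the whole space *)
pose u := sigma_j \_ (rect a b).
pose v i := dsigma i \_ (rect a b).
have mr := measurable_rect a b.
have uE x : rect a b x -> sigma_j x = u x by move=> xr; rewrite /u patchE mem_set.
have vE i x : rect a b x -> dsigma i x = v i x by move=> xr; rewrite /v patchE mem_set.
have mu_ : measurable_fun setT u by exact/(measurable_restrictT _ mr).
have mv i : measurable_fun setT (v i).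
  by apply/(measurable_restrictT _ mr); case: (wk i).
have weak i : weak_identity a b u v i.
  move=> phi tphi; have [_ _ _ /(_ phi tphi) H] := wk i.
  have -> : (\int[lebesgue_rV m.+1]_(x in rect a b) (u x * partial i phi x)%:E =
      \int[lebesgue_rV m.+1]_(x in rect a b) (sigma_j x * partial i phi x)%:E)%E.
    by apply: eq_integral => x /set_mem xr; rewrite uE.
  rewrite H; congr (- _)%E; apply: eq_integral => x /set_mem xr.
  by rewrite vE.
have h0 : 0 < b ord0 j - a ord0 j by rewrite subr_gt0.
pose D i x := dist_faces a b i x * v i x.
have DE i : wL2norm w (rect a b) (fun x => dist_faces a b i x * dsigma i x) =
    wL2norm w (rect a b) (D i).
  by apply: eq_wL2norm => x xr; rewrite /D vE.
have rhsE : rhs = (\sum_(i < m.+1 | i != j) wL2norm w (rect a b) (D i) +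
    (b ord0 j - a ord0 j)%:E * wL2norm w (rect a b) (v j))%E.
  rewrite /rhs; congr (_ + _ * _)%E; last by apply: eq_wL2norm => x xr; rewrite vE.
  by apply: eq_bigr => i _; exact: DE.
have nn f : (0 <= wL2norm w (rect a b) f)%E by rewrite /wL2norm poweR_ge0.
have S0 : (0 <= \sum_(i < m.+1 | i != j) wL2norm w (rect a b) (D i))%E by apply: sume_ge0.
have T0 : (0 <= (b ord0 j - a ord0 j)%:E * wL2norm w (rect a b) (v j))%E.
  by rewrite mule_ge0 // lee_fin ltW.
rewrite rhsE in rhsoo *.
have Doo i : i != j -> (wnorm2 w a b (D i) < +oo)%E.
  move=> ij; apply: wL2norm_lty; apply: le_lt_trans rhsoo.
  apply: (@le_trans _ _ (\sum_(i < m.+1 | i != j) wL2norm w (rect a b) (D i))%E).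
    by rewrite (bigD1 i) //= leeDl // sume_ge0.
  exact: leeDl.
have voo : (wnorm2 w a b (v j) < +oo)%E.
  apply: wL2norm_lty; rewrite ltey; apply/eqP => E; move: rhsoo.
  by rewrite E gt0_muley ?lte_fin // addey ?ltxx // -ltNye (lt_le_trans _ S0) ?ltNyr.
have uoo : (wnorm2 w a b u < +oo)%E.
  by apply: wL2norm_lty; rewrite -(eq_wL2norm w uE).
split.
  have [p Hp] := exists_RT_interp hw ab mu_ mv uoo weak voo.
  by exists p; apply: eq_RT_interp Hp => x xr; rewrite uE.
move=> p Hp.
have {}Hp : RT_interp a b j u p by apply: eq_RT_interp Hp.
have B := RT_interp_bound hw ab mu_ mv uoo weak Doo voo Hp.
have fE f : (wnorm2 w a b f < +oo)%E -> wnorm2 w a b f = (fine (wnorm2 w a b f))%:E.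
  by move=> foo; rewrite fineK // ge0_fin_numE // (wnorm2_ge0 a b hw).
have f0 f : 0 <= fine (wnorm2 w a b f) by rewrite fine_ge0 // (wnorm2_ge0 a b hw).
rewrite (eq_bigr (fun i => (fine (wnorm2 w a b (D i)))%:E)) in B; last by move=> i ij; exact: (fE _ (Doo i ij)).
rewrite sumEFin (fE _ voo) -EFinM in B.
have {}B : (wnorm2 w a b (fun x => u x - p x)%R <= (interp_const w *
    (\sum_(i < m.+1 | i != j) fine (wnorm2 w a b (D i)) +
     (b ord0 j - a ord0 j) ^+ 2 * fine (wnorm2 w a b (v j))))%:E)%E := B.
rewrite (@eq_wL2norm _ _ w a b _ (fun x => u x - p x)); last by move=> x xr; rewrite uE.
have Poo : (wnorm2 w a b (fun x => u x - p x)%R < +oo)%E by apply: le_lt_trans B _; rewrite ltry.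
rewrite (fE _ Poo) lee_fin in B.
rewrite wL2norm_sqrt // (eq_bigr (fun i => (Num.sqrt (fine (wnorm2 w a b (D i))))%:E)); last first.
  by move=> i ij; rewrite wL2norm_sqrt // Doo.
rewrite sumEFin wL2norm_sqrt // lee_fin.
apply: le_trans (sqrt_sum_le _ _ _ _ _) => //.
- by rewrite ler_wsqrtr.
- exact: interp_const_ge0.
- exact: ltW.
Qed.
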